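(* Let $\epsilon>0$ and let $w\ge 0$ be a constant. There exists a randomized algorithm which, given a graph $G$ on $n$ vertices with treewidth at most $w$ and maximal degree $\Delta$ satisfying $(1+\epsilon)\Delta\ge\Delta+2$, and a bias parameter $\delta\in(0,1)$, outputs a random proper $k$-coloring of $G$ with $k=\lceil(1+\epsilon)\Delta\rceil$ whose distribution $D$ satisfies $d_{TV}(D,U)\le\delta$, where $U$ is the uniform distribution on the proper $k$-colorings of $G$, and which runs in time polynomial in $n$ and $\log(1/\delta)$ (for fixed $\epsilon$ and $w$).
   Context: Graphs are finite, simple and undirected. A proper $k$-coloring of $G=(V,E)$ is a map $\sigma:V\to\{1,\dots,k\}$ with $\sigma(u)\ne\sigma(v)$ for every edge $(u,v)\in E$. Treewidth is the usual notion (minimum over tree decompositions of the maximum bag size minus one). For distributions $\mu,\nu$ on a finite set $\Omega$, $d_{TV}(\mu,\nu)=\max_{S\subseteq\Omega}|\mu(S)-\nu(S)|$.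
   Formalization: For general real ε the algorithm may query the fixed function m ↦ ⌈(1+ε)m⌉, since for uncomputable ε no algorithm given only G and δ can exist (colors used on stars determine ε); for rational ε the algorithm gets only G and δ. *)

(* Defs.v *)
From mathcomp Require Import all_boot all_order all_algebra.
From mathcomp Require Import boolp reals exp.

Set Implicit Arguments.
Unset Strict Implicit.
Unset Printing Implicit Defensive.

Import Order.TTheory GRing.Theory Num.Theory.

Definition simple_graph (V : finType) (e : rel V) : Prop :=
  symmetric e /\ irreflexive e.

Definition max_degree (V : finType) (e : rel V) : nat :=
  \max_(v : V) #|[set u | e v u]|.

Definition is_tree (N : finType) (f : rel N) : Prop :=
  [/\ simple_graph f,
      0 < #|N|,
      forall x y : N, connect f x y
    & forall s : seq N, ucycle f s -> size s <= 2].

Definition tree_decomposition (V : finType) (e : rel V)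
    (N : finType) (f : rel N) (bag : N -> {set V}) : Prop :=
  [/\ is_tree f,
      forall v : V, exists t, v \in bag t,
      forall u v : V, e u v -> exists2 t, u \in bag t & v \in bag t
    & forall (v : V) (s t : N), v \in bag s -> v \in bag t ->
        connect [rel x y | [&& f x y, v \in bag x & v \in bag y]] s t].

(* The predecessor is truncated: a decomposition with only empty bags, possible
   only when there is no vertex, gets width 0 instead of -1. *)
Definition width (V N : finType) (bag : N -> {set V}) : nat :=
  (\max_(t : N) #|bag t|).-1.

Definition has_decomposition_of_width (V : finType) (e : rel V) (w : nat)
    : Prop :=
  exists (N : finType) (f : rel N) (bag : N -> {set V}),
    tree_decomposition e f bag /\ width bag = w.

Lemma ex_decomposition (V : finType) (e : rel V) :
  exists w, `[< has_decomposition_of_width e w >].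
Proof.
pose bag := fun _ : unit => [set: V].
exists (width bag); apply/asboolP.
exists unit, (fun _ _ => false), bag; split=> //; split.
- split=> //; first by rewrite card_unit.
  + by move=> [] []; exact: connect0.
  + by case=> [|x [|y [|z s]]].
- by move=> v; exists tt; rewrite inE.
- by move=> u v _; exists tt; rewrite inE.
- by move=> v [] [] _ _; exact: connect0.
Qed.

Definition treewidth (V : finType) (e : rel V) : nat :=
  ex_minn (ex_decomposition e).

Definition proper_coloring (V : finType) (e : rel V) (k : nat)
    (sigma : {ffun V -> 'I_k}) : bool :=
  [forall u, forall v, e u v ==> (sigma u != sigma v)].

Definition coloring (V : finType) (e : rel V) (k : nat) : finType :=
  {sigma : {ffun V -> 'I_k} | proper_coloring e sigma}.

(* While programs on a random access machine with
   logarithmic cost.  Memory cells hold natural numbers, every evaluated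
   subexpression is charged the bit length of its value, and the only source
   of randomness is the fair coin.  Since operands and results are charged
   their length, time is polynomially related to that of probabilistic Turing
   machines, in spite of the multiplication and division primitives. *)

Inductive binop := Add | Sub | Mul | Div | Mod | Eq | Leq.

Definition eval_binop (o : binop) : nat -> nat -> nat :=
  match o with
  | Add => addn
  | Sub => subn
  | Mul => muln
  | Div => divn
  | Mod => modn
  | Eq => fun a b => a == b
  | Leq => fun a b => a <= b
  end.

(* [Read c a] reads position [a] of the read-only input channel [c];
   [Cell a] is indirect addressing of the memory. *)
Inductive expr :=
  | Const of nat
  | Cell of expr
  | Read of nat & expr
  | Bin of binop & expr & expr.

Inductive cmd :=
  | Skip
  | Store of expr & expr
  | Flip of expr
  | Seq of cmd & cmd
  | If of expr & cmd & cmd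
  | While of expr & cmd.

Definition memory := nat -> nat.
Definition input := nat -> nat -> nat.

Definition empty_memory : memory := fun _ => 0.

Definition update (s : memory) (a x : nat) : memory :=
  fun b => if b == a then x else s b.

Definition bit_length (x : nat) : nat := (trunc_log 2 x).+1.

Fixpoint eval (inp : input) (s : memory) (x : expr) : nat :=
  match x with
  | Const c => c
  | Cell a => s (eval inp s a)
  | Read c a => inp c (eval inp s a)
  | Bin o a b => eval_binop o (eval inp s a) (eval inp s b)
  end.

Fixpoint eval_cost (inp : input) (s : memory) (x : expr) : nat :=
  bit_length (eval inp s x) +
  match x with
  | Const _ => 0
  | Cell a => eval_cost inp s a
  | Read _ a => eval_cost inp s a
  | Bin _ a b => eval_cost inp s a + eval_cost inp s b
  end.

(* [exec inp p s r s' r' t]: started in memory [s] with the coin tosses [r]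
   still to come, [p] halts in memory [s'] after [t] time units, and [r'] is
   the part of [r] that has not been used. *)
Inductive exec (inp : input) :
    cmd -> memory -> seq bool -> memory -> seq bool -> nat -> Prop :=
  | ExecSkip s r :
      exec inp Skip s r s r 1
  | ExecStore a x s r :
      exec inp (Store a x) s r (update s (eval inp s a) (eval inp s x)) r
        (eval_cost inp s a + eval_cost inp s x).+1
  | ExecFlip a s (b : bool) r :
      exec inp (Flip a) s (b :: r) (update s (eval inp s a) b) r
        (eval_cost inp s a).+1
  | ExecSeq p q s r s1 r1 t1 s2 r2 t2 :
      exec inp p s r s1 r1 t1 -> exec inp q s1 r1 s2 r2 t2 ->
      exec inp (Seq p q) s r s2 r2 (t1 + t2).+1
  | ExecIfTrue x p q s r s1 r1 t :
      eval inp s x != 0 -> exec inp p s r s1 r1 t ->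
      exec inp (If x p q) s r s1 r1 (eval_cost inp s x + t).+1
  | ExecIfFalse x p q s r s1 r1 t :
      eval inp s x = 0 -> exec inp q s r s1 r1 t ->
      exec inp (If x p q) s r s1 r1 (eval_cost inp s x + t).+1
  | ExecWhileTrue x p s r s1 r1 t1 s2 r2 t2 :
      eval inp s x != 0 -> exec inp p s r s1 r1 t1 ->
      exec inp (While x p) s1 r1 s2 r2 t2 ->
      exec inp (While x p) s r s2 r2 (eval_cost inp s x + t1 + t2).+1
  | ExecWhileFalse x p s r :
      eval inp s x = 0 ->
      exec inp (While x p) s r s r (eval_cost inp s x).+1.

Local Open Scope ring_scope.

Definition dTV (R : realType) (T : finType) (mu nu : T -> R) : R :=
  \big[Num.max/0]_(S : {set T})
    `|\sum_(x in S) mu x - \sum_(x in S) nu x|.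

Definition uniform (R : realType) (T : finType) (_ : T) : R :=
  #|T|%:R^-1.

Definition coin_law (R : realType) (m : nat) (T : finType)
    (out : m.-tuple bool -> T) (x : T) : R :=
  #|[set r | out r == x]|%:R / 2 ^+ m.

Definition num_colors (R : realType) (eps : R) (d : nat) : nat :=
  `|Num.ceil ((1 + eps) * d%:R)|%N.

Definition binary_digit (R : realType) (delta : R) (i : nat) : nat :=
  (Num.truncn (2 ^+ i.+1 * delta) %% 2)%N.

(* Channel 0 holds the number of vertices, channel 1 the adjacency matrix
   (row by row), channel 2 the binary expansion of [delta].  As [delta] is a
   stream of digits, a program need only read a prefix of it, so that a time
   bound in terms of [log (1 / delta)] makes sense for every real [delta].
   Channel 3 holds a function [phi] that depends on [eps] only.  With
   [phi := num_colors eps] the fixed real [eps] is at the disposal of the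
   program; this is unavoidable when [eps] is not a computable number, because
   the colors used on stars determine [eps].  With a constant [phi] the channel
   carries no information. *)
Definition coloring_input (R : realType) (n : nat) (e : rel 'I_n) (delta : R)
    (phi : nat -> nat) : input :=
  fun c i =>
    match c with
    | 0%N => n
    | 1%N => [exists u : 'I_n, exists v : 'I_n, e u v && (i == u * n + v)%N]
    | 2%N => binary_digit delta i
    | 3%N => phi i
    | _ => 0%N
    end.

(* [m] bounds the running time for all outcomes of the coin tosses, hence also
   the number of tosses: the output is a function of [m] independent fair bits,
   and its law does not depend on the choice of [m].  The color of vertex [v]
   is left in memory cell [v]; colors are numbered from 0. *)
Definition coloring_sampler (R : realType) (eps : R) (w : nat)
    (phi : nat -> nat) (p : cmd) : Prop :=
  exists C : nat,
  forall (n : nat) (e : rel 'I_n) (delta : R),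
    simple_graph e ->
    (treewidth e <= w)%N ->
    (max_degree e)%:R + 2 <= (1 + eps) * (max_degree e)%:R ->
    0 < delta < 1 ->
  exists (m : nat)
         (out : m.-tuple bool -> coloring e (num_colors eps (max_degree e))),
    [/\ m%:R <= C%:R * (1 + n%:R + ln (1 / delta)) ^+ C,
        forall r : m.-tuple bool, exists s r' t,
          [/\ exec (coloring_input e delta phi) p empty_memory r s r' t,
              (t <= m)%N
            & forall v : 'I_n, s v = val (out r) v]
      & dTV (coin_law R out) (@uniform R _) <= delta].

(* Main.v *)
Require Import Defs.
From mathcomp Require Import all_boot all_order all_algebra.
From mathcomp Require Import zify ring lra.
From mathcomp Require Import boolp reals exp.

Set Implicit Arguments.
Unset Strict Implicit.
Unset Printing Implicit Defensive.

(** On a graph of bounded treewidth the colorings can be counted exactly in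
    polynomial time, so no Markov chain is needed, and the hypothesis on [Delta]
    only serves to guarantee that a coloring exists.

    Counting.  A tree decomposition of width [w], rooted arbitrarily, assigns to
    each vertex the depth of the highest bag that contains it, and the vertices
    around a connected set [C] that are at most as deep as all of [C] lie in a
    single bag together with a vertex of [C]; hence there are at most [w] of
    them.  So if a component of [G - b], with at most [w] vertices [b], is
    surrounded by vertices that are at most as deep, one can color a vertex [u]
    of least depth in it: each component of the rest touches [u] but at most
    [w - 1] vertices of [b], and [u] can take the place of one that it does not
    touch.  The number of list colorings of the component is then a sum over the
    colors of [u] of a product over these smaller components.  The table of these
    numbers, indexed by [b], the colors of [b] and a vertex of the component, has
    polynomial size for fixed [w].  The program does not know the tree
    decomposition: it fills the table in [n] rounds, using any [u] for which the
    entries it needs are already known.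

    Sampling.  With [Z] the number of colorings and [X] a random integer of [L]
    bits, the program outputs the coloring of rank [X mod Z] in lexicographic
    order, digit by digit, by counting the colorings with a given prefix.  The law
    of the output is within [Z / 2 ^ L] of the uniform one, and
    [L = log (1 / delta) + n k] bits suffice. *)

(** * Running time of programs *)

(** Speed and correctness are kept apart. In the language in which the counting is written, every
    loop reduces its accumulator modulo a fixed number and has a capped number of iterations, so a
    term runs in polynomial time whatever it computes. That reductions and caps never take effect is
    a statement about values alone. Soundness and completeness of the table are separated too. An
    entry that is filled in is right for any pivot that passes the test of the program; the tree
    decomposition enters only to show that some pivot passes, namely one of least depth. The counts
    must be exact because lexicographic ranks are sums of counts. In return all coins are tossed at
    once, and the only deviation from uniformity comes from reducing [X] modulo [Z]. Some deviation
    is unavoidable: boundedly many fair coins give only dyadic probabilities. *)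

Lemma bit_lengthP x Q : 0 < Q -> (bit_length x <= Q) = (x < 2 ^ Q).
Proof.
move=> Q0; rewrite /bit_length; case: (posnP x) => [->|x0].
  by rewrite trunc_log0 Q0 expn_gt0.
apply/idP/idP => [h|h].
  by apply: leq_trans (trunc_log_ltn x (isT : 1 < 2)) _; rewrite leq_exp2l.
rewrite -(ltn_exp2l _ _ (isT : 1 < 2)); apply: leq_ltn_trans h.
exact: trunc_logP.
Qed.

Lemma ltn_bit_length x : x < 2 ^ bit_length x.
Proof. by rewrite -bit_lengthP. Qed.

Lemma bit_length_mono x y : x <= y -> bit_length x <= bit_length y.
Proof.
by move=> h; rewrite bit_lengthP //; apply: leq_ltn_trans h (ltn_bit_length y).
Qed.

Lemma bit_length_self x : bit_length x <= x.+1.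
Proof. by rewrite bit_lengthP // (leq_trans (ltn_expl x (isT : 1 < 2))) // leq_exp2l. Qed.

Lemma bit_length_bool x : x <= 1 -> bit_length x = 1.
Proof. by case: x => [|[]]. Qed.

Lemma bit_length_mul x y : bit_length (x * y) <= bit_length x + bit_length y.
Proof.
by rewrite bit_lengthP // expnD ltn_mul // ltn_bit_length.
Qed.

Lemma bit_length_add x y : bit_length (x + y) <= bit_length x + bit_length y.
Proof.
rewrite bit_lengthP // expnD.
have := ltn_bit_length x; have := ltn_bit_length y.
set a := 2 ^ _; set b := 2 ^ _ => h1 h2.
(* Bit lengths are at least 1, even for 0, so both powers are at least 2 and their sum is at most
   their product. *)
have : 2 <= a by rewrite /a -[X in X <= _](expn1 2) leq_exp2l.
have : 2 <= b by rewrite /b -[X in X <= _](expn1 2) leq_exp2l.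
nia.
Qed.

Lemma bit_length_binop o x y :
  bit_length (eval_binop o x y) <= bit_length x + bit_length y.
Proof.
case: o => /=.
- exact: bit_length_add.
- by apply: leq_trans (leq_addr _ _); apply: bit_length_mono; apply: leq_subr.
- exact: bit_length_mul.
- by apply: leq_trans (leq_addr _ _); apply: bit_length_mono; apply: leq_div.
- by apply: leq_trans (leq_addr _ _); apply: bit_length_mono; apply: leq_mod.
- by rewrite (bit_length_bool (leq_b1 _)) (leq_trans _ (leq_addr _ _)).
- by rewrite (bit_length_bool (leq_b1 _)) (leq_trans _ (leq_addr _ _)).
Qed.

(** Exact times depend on the contents of the memory; only upper bounds compose well. *)
Definition runs inp p s r s' r' T :=
  exists2 t, exec inp p s r s' r' t & t <= T.

Section Runs.
Variable inp : input.

Lemma runs_leq p s r s' r' T T' :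
  runs inp p s r s' r' T -> T <= T' -> runs inp p s r s' r' T'.
Proof. by move=> [t e l] h; exists t => //; apply: leq_trans h. Qed.

Lemma runs_skip s r : runs inp Skip s r s r 1.
Proof. by exists 1 => //; constructor. Qed.

Lemma runs_store a x s r :
  runs inp (Store a x) s r (update s (eval inp s a) (eval inp s x)) r
    (eval_cost inp s a + eval_cost inp s x).+1.
Proof. by eexists; [constructor|]. Qed.

Lemma runs_flip a s b r :
  runs inp (Flip a) s (b :: r) (update s (eval inp s a) b) r
    (eval_cost inp s a).+1.
Proof. by eexists; [constructor|]. Qed.

Lemma runs_seq p q s r s1 r1 s2 r2 T1 T2 :
  runs inp p s r s1 r1 T1 -> runs inp q s1 r1 s2 r2 T2 ->
  runs inp (Defs.Seq p q) s r s2 r2 (T1 + T2).+1.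
Proof.
move=> [t1 e1 h1] [t2 e2 h2]; exists (t1 + t2).+1; first exact: ExecSeq e1 e2.
by rewrite ltnS leq_add.
Qed.

Lemma runs_if x p q s r s' r' T :
  runs inp (if eval inp s x != 0 then p else q) s r s' r' T ->
  runs inp (If x p q) s r s' r' (eval_cost inp s x + T).+1.
Proof.
move=> [t e h]; exists (eval_cost inp s x + t).+1; last by rewrite ltnS leq_add2l.
by case: eqP e => [h0|/eqP h0] e; [apply: ExecIfFalse | apply: ExecIfTrue].
Qed.

(** The invariant is indexed by the number of completed iterations and also sees the remaining
    coins, so that loops may toss. The extra unit in [K.+1] pays for the last, failing test. *)
Lemma runs_while x p (I : nat -> memory -> seq bool -> Prop) K T Tx s r :
  (forall i s r, i <= K -> I i s r -> eval_cost inp s x <= Tx /\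
     (eval inp s x != 0) = (i < K)) ->
  (forall i s r, i < K -> I i s r ->
     exists s' r', runs inp p s r s' r' T /\ I i.+1 s' r') ->
  I 0 s r ->
  exists s' r', runs inp (While x p) s r s' r' (K.+1 * (Tx + T).+1) /\ I K s' r'.
Proof.
move=> hx hp HI.
(* Induction on the number [j] of iterations still to come, because a loop unfolds from its first
   iteration. *)
suff: forall j s r, j <= K -> I (K - j) s r ->
    exists s' r', runs inp (While x p) s r s' r' (j.+1 * (Tx + T).+1) /\ I K s' r'.
  by apply; rewrite ?subnn.
clear s r HI; elim=> [|j IH] s r jK; rewrite ?subn0.
  move=> HI; exists s, r; split=> //.
  have [h1 h2] := hx _ _ _ (leqnn K) HI.
  move: h2; rewrite ltnn => /negbFE/eqP h2.
  exists (eval_cost inp s x).+1; first exact: ExecWhileFalse.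
  by rewrite mul1n ltnS; apply: leq_trans h1 (leq_addr _ _).
move=> HI; have lt : K - j.+1 < K by lia.
have [h1 h2] := hx _ _ _ (ltnW lt) HI.
have [s1 [r1 [[t e ht] HI1]]] := hp _ _ _ lt HI.
have eqj : (K - j.+1).+1 = K - j by lia.
rewrite eqj in HI1.
have [s2 [r2 [[t2 e2 ht2] HI2]]] := IH _ _ (ltnW jK) HI1.
exists s2, r2; split=> //.
exists (eval_cost inp s x + t + t2).+1.
  by apply: ExecWhileTrue e e2; rewrite h2.
by rewrite [_.+2 * _]mulSn -addSn leq_add // ltnS leq_add.
Qed.

End Runs.

Notation "p ;; q" := (Defs.Seq p q) (at level 60, right associativity).

(* The program variable [i] is stored at address [n + i], where [n] is read from
   channel 0, because the cells below [n] are reserved for the output. *)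
Definition addr i := Bin Add (Read 0 (Const 0)) (Const i).
Definition cell i := Cell (addr i).
Definition assign i x := Store (addr i) x.

Definition holds n (s : memory) (env : seq nat) :=
  forall i, i < size env -> s (n + i) = nth 0 env i.

Lemma holds_rcons n s env x :
  holds n s (rcons env x) <-> holds n s env /\ s (n + size env) = x.
Proof.
split=> [h|[h hx] i].
  split=> [i lt|].
    by rewrite h ?size_rcons ?leqW // nth_rcons lt.
  by rewrite h ?size_rcons // nth_rcons ltnn eqxx.
rewrite size_rcons ltnS leq_eqVlt nth_rcons => /orP[/eqP->|lt].
  by rewrite ltnn eqxx.
by rewrite lt h.
Qed.

Lemma holds_frame n s s' env D : size env <= D ->
  (forall a, a < n + D -> s' a = s a) -> holds n s env -> holds n s' env.
Proof. by move=> h1 h2 h i lt; rewrite h2 ?h //; lia. Qed.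

Section Cost.
Variables (inp : input) (n Q : nat).
Hypothesis inp0 : forall i, inp 0 i = n.
Hypothesis nQ : bit_length n <= Q.

Lemma eval_addr s i : eval inp s (addr i) = n + i.
Proof. by rewrite /= inp0. Qed.

Lemma eval_cell s i : eval inp s (cell i) = s (n + i).
Proof. by rewrite /= inp0. Qed.

Lemma cost_addr s i : eval_cost inp s (addr i) <= Q + Q + i + i + 4.
Proof.
rewrite /= !inp0.
have := bit_length_add n i; have := bit_length_self i.
rewrite (bit_length_bool (leq0n 1)); lia.
Qed.

Lemma cost_cell s i A : bit_length (s (n + i)) <= A ->
  eval_cost inp s (cell i) <= A + (Q + Q + i + i + 4).
Proof.
move=> h; have -> : eval_cost inp s (cell i) =
  bit_length (s (eval inp s (addr i))) + eval_cost inp s (addr i) by [].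
by apply: leq_add; rewrite ?cost_addr // eval_addr.
Qed.

Lemma runs_assign s r i x A : eval_cost inp s x <= A ->
  runs inp (assign i x) s r (update s (n + i) (eval inp s x)) r
    (Q + Q + i + i + 5 + A).
Proof.
move=> h; rewrite -(eval_addr s).
apply: runs_leq; first exact: runs_store.
by have := cost_addr s i; lia.
Qed.

End Cost.

(** From [Q = 2] on, a pure power of [Q] absorbs coefficients and constants, so a polynomial bound
    is carried by a single exponent. *)
Definition poly_bounded (f : nat -> nat) :=
  exists c, forall Q, 2 <= Q -> f Q <= Q ^ c.

Lemma poly_const a : poly_bounded (fun=> a).
Proof.
by exists a => Q hQ; apply: ltnW; apply: ltn_expl.
Qed.

Lemma poly_pow c : poly_bounded (fun Q => Q ^ c).
Proof. by exists c. Qed.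

Lemma poly_id : poly_bounded (fun Q => Q).
Proof. by exists 1 => Q; rewrite expn1. Qed.

Lemma poly_mul f g : poly_bounded f -> poly_bounded g -> poly_bounded (fun Q => f Q * g Q).
Proof. by move=> [a ha] [b hb]; exists (a + b) => Q h; rewrite expnD leq_mul ?ha ?hb. Qed.

Lemma poly_add f g : poly_bounded f -> poly_bounded g -> poly_bounded (fun Q => f Q + g Q).
Proof.
move=> [a ha] [b hb]; exists (a + b).+1 => Q h.
apply: leq_trans (leq_add (ha Q h) (hb Q h)) _.
rewrite expnS expnD.
have [] : 0 < Q ^ a /\ 0 < Q ^ b by rewrite !expn_gt0; lia.
move: (Q ^ a) (Q ^ b) => x y x0 y0.
by apply: leq_trans (_ : 2 * (x * y) <= _); [nia | rewrite leq_mul].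
Qed.

Lemma poly_succ f : poly_bounded f -> poly_bounded (fun Q => (f Q).+1).
Proof. by move=> h; have [c hc] := poly_add (poly_const 1) h; exists c => Q /hc. Qed.

Lemma poly_exp f c : poly_bounded f -> poly_bounded (fun Q => f Q ^ c).
Proof.
by move=> [a ha]; exists (a * c) => Q h; rewrite expnM; case: c => // c; rewrite leq_exp2r ?ha.
Qed.

Ltac poly := repeat first
  [ exact: poly_id | exact: poly_const | apply: poly_add | apply: poly_mul
  | apply: poly_succ | exact: poly_pow | apply: poly_exp ].

(** * A functional language whose terms all run in polynomial time *)

Inductive tm :=
  | TVar of nat
  | TCst of nat
  | TAdj of tm
  | TBin of binop & tm & tm
  | TLet of tm & tm
  | TIf of tm & tm & tm
  | TIter of tm & tm & tm.

(* Variables are de Bruijn levels.  Variables 0 and 1 hold the modulus applied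
   to the accumulator of a loop and the cap on the number of iterations; in
   this way every term runs in polynomial time unconditionally, see [comp_ok].
   In [TBin o a b] the value of [a] is an additional variable of [b], because
   [b] is compiled below it. *)
Fixpoint ev (inp : input) (env : seq nat) (t : tm) : nat :=
  match t with
  | TVar i => nth 0 env i
  | TCst c => c
  | TAdj a => inp 1 (ev inp env a)
  | TBin o a b =>
    let x := ev inp env a in eval_binop o x (ev inp (rcons env x) b)
  | TLet a b => ev inp (rcons env (ev inp env a)) b
  | TIf c a b => if ev inp env c != 0 then ev inp env a else ev inp env b
  | TIter c a b =>
    let K := minn (ev inp env c) (nth 0 env 1) in
    iteri K
      (fun i x => ev inp (rcons (rcons (rcons env K) i) x) b %% nth 0 env 0)
      (ev inp (rcons (rcons env K) 0) a)
  end.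

(** The value ends in variable [d], and the variables from [d] on serve as a stack, so nothing is
    ever saved. In a loop, [d] holds the number of iterations, [d.+1] the counter and [d.+2] the
    accumulator. A variable out of scope is read as 0, the default of [nth] in [ev]. *)
Fixpoint compile (d : nat) (t : tm) : cmd :=
  match t with
  | TVar i => assign d (if i < d then cell i else Const 0)
  | TCst c => assign d (Const c)
  | TAdj a => compile d a ;; assign d (Read 1 (cell d))
  | TBin o a b => compile d a ;; compile d.+1 b ;; assign d (Bin o (cell d) (cell d.+1))
  | TLet a b => compile d a ;; compile d.+1 b ;; assign d (cell d.+1)
  | TIf c a b => compile d c ;; If (cell d) (compile d a) (compile d b)
  | TIter c a b =>
    compile d c ;;
    If (Bin Leq (cell d) (cell 1)) Skip (assign d (cell 1)) ;;
    assign d.+1 (Const 0) ;;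
    compile d.+2 a ;;
    While (Bin Defs.Sub (cell d) (cell d.+1))
      (compile d.+3 b ;;
       assign d.+2 (Bin Mod (cell d.+3) (cell 0)) ;;
       assign d.+1 (Bin Add (cell d.+1) (Const 1))) ;;
    assign d (cell d.+2)
  end.

(** Values are bounded by their length, except the cap on iterations, which is itself at most [Q].
    The modulus must be positive for a reduction to bound its result. *)
Definition env_ok n Q (env : seq nat) :=
  [/\ 2 <= size env, 2 <= Q, bit_length n <= Q, 0 < nth 0 env 0
    & nth 0 env 1 <= Q] /\ forall i, bit_length (nth 0 env i) <= Q.

Definition input_ok n (inp : input) :=
  (forall i, inp 0 i = n) /\ (forall i, inp 1 i <= 1).

(** The exponent is fixed before the input, the environment and [Q]. It bounds both the time and the
    length of the result, since the result becomes part of the environment of later terms. *)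
Definition comp_spec t d c := forall inp n Q env s r,
  input_ok n inp -> env_ok n Q env -> size env = d -> holds n s env ->
  exists s', [/\ runs inp (compile d t) s r s' r (Q ^ c),
    s' (n + d) = ev inp env t, bit_length (ev inp env t) <= Q ^ c
    & forall a, a < n + d -> s' a = s a].

Lemma env_ok_leq n Q Q' env : Q <= Q' -> env_ok n Q env -> env_ok n Q' env.
Proof.
by move=> h [[? ? ? ? ?] h']; split; [split => //; lia | move=> i; apply: leq_trans h].
Qed.

Lemma env_ok_rcons n Q env x :
  bit_length x <= Q -> env_ok n Q env -> env_ok n Q (rcons env x).
Proof.
move=> hx [[h1 h2 h3 h4 h5] h6]; split.
  have e0 : 0 < size env by lia.
  by split=> //; rewrite ?size_rcons ?nth_rcons ?e0 ?h1 //; lia.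
move=> i; rewrite nth_rcons; case: ltnP => // _; case: eqP => // _.
by rewrite (bit_length_bool (leq0n 1)); lia.
Qed.

Lemma update_frame s a x b : b < a -> update s a x b = s b.
Proof. by rewrite /update => h; rewrite ltn_eqF. Qed.

Lemma update_same s a x : update s a x a = x.
Proof. by rewrite /update eqxx. Qed.

Lemma bit_length_expr inp s x : bit_length (eval inp s x) <= eval_cost inp s x.
Proof. by case: x => *; apply: leq_addr. Qed.

Lemma cost_const inp s x : eval_cost inp s (Const x) <= x.+1.
Proof. by rewrite /= addn0 bit_length_self. Qed.

Lemma cost_bin inp s o x y A B : eval_cost inp s x <= A -> eval_cost inp s y <= B ->
  eval_cost inp s (Bin o x y) <= A + B + (A + B).
Proof.
move=> ha hb; have -> : eval_cost inp s (Bin o x y) =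
  bit_length (eval_binop o (eval inp s x) (eval inp s y)) +
  (eval_cost inp s x + eval_cost inp s y) by [].
apply: leq_add; last exact: leq_add.
apply: leq_trans (bit_length_binop _ _ _) _.
apply: leq_add; [exact: leq_trans (bit_length_expr _ _ _) ha |
  exact: leq_trans (bit_length_expr _ _ _) hb].
Qed.

Lemma cost_read1 n inp s x A : input_ok n inp -> eval_cost inp s x <= A ->
  eval_cost inp s (Read 1 x) <= A.+1.
Proof.
move=> [_ h] hA; have -> : eval_cost inp s (Read 1 x) =
  bit_length (inp 1 (eval inp s x)) + eval_cost inp s x by [].
by rewrite (bit_length_bool (h _)).
Qed.

Definition cell_cost d Q := Q + Q + d + d + 4.

(* The last command of the code of a term: it stores the value of [x] in
   variable [d], knowing that the earlier commands, which ended in memory [s1],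
   left the variables below [d] alone. *)
Lemma assign_spec inp n Q d x v s s1 r1 A : input_ok n inp -> bit_length n <= Q ->
  eval inp s1 x = v -> eval_cost inp s1 x <= A ->
  (forall a, a < n + d -> s1 a = s a) ->
  exists s', [/\ runs inp (assign d x) s1 r1 s' r1 (cell_cost d Q + A).+1,
    s' (n + d) = v, bit_length v <= A
    & forall a, a < n + d -> s' a = s a].
Proof.
move=> hi nQ <- hA hs; exists (update s1 (n + d) (eval inp s1 x)); split.
- by apply: runs_leq (runs_assign hi.1 nQ _ _ hA) _; rewrite /cell_cost; lia.
- exact: update_same.
- exact: leq_trans (bit_length_expr _ _ _) hA.
- by move=> a h; rewrite update_frame ?hs.
Qed.

Lemma pow_ge Q a : 2 <= Q -> Q <= Q ^ a.+1.
Proof. by move=> h; rewrite -[X in X <= _]expn1 leq_exp2l. Qed.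

Lemma comp_var i d : exists c, comp_spec (TVar i) d c.
Proof.
have [c hc] : poly_bounded (fun Q => (cell_cost d Q + (Q + cell_cost i Q)).+1) by poly.
exists c => inp n Q env s r hi [[_ Q2 nQ _ _] he] hd hh.
have [] := @assign_spec inp n Q d (if i < d then cell i else Const 0) (nth 0 env i)
  s s r (Q + cell_cost i Q) hi nQ.
- case: ltnP => h; first by rewrite (eval_cell hi.1) hh ?hd.
  by rewrite nth_default ?hd.
- case: ltnP => h; first by apply: (cost_cell hi.1 nQ); rewrite hh ?hd.
  by apply: leq_trans (cost_const _ _ _) _; lia.
- by [].
move=> s' [h1 h2 h3 h4]; exists s'; split=> //; first exact: runs_leq h1 (hc _ Q2).
by apply: leq_trans h3 _; apply: leq_trans (hc _ Q2); lia.
Qed.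

Lemma comp_cst x d : exists c, comp_spec (TCst x) d c.
Proof.
have [c hc] : poly_bounded (fun Q => (cell_cost d Q + x.+1).+1) by poly.
exists c => inp n Q env s r hi [[_ Q2 nQ _ _] he] hd hh.
have [] // := @assign_spec inp n Q d (Const x) x s s r x.+1 hi nQ.
  exact: cost_const.
move=> s' [h1 h2 h3 h4]; exists s'; split=> //; first exact: runs_leq h1 (hc _ Q2).
by apply: leq_trans h3 _; apply: leq_trans (hc _ Q2); lia.
Qed.

Lemma comp_adj a d ca : comp_spec a d ca -> exists c, comp_spec (TAdj a) d c.
Proof.
move=> IHa.
have [c hc] : poly_bounded (fun Q =>
  (Q ^ ca + (cell_cost d Q + (Q ^ ca + cell_cost d Q).+1).+1).+1) by poly.
exists c => inp n Q env s r hi he hd hh.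
have [[_ Q2 nQ _ _] _] := he.
have [s1 [r1 e1 b1 f1]] := IHa _ _ _ _ _ r hi he hd hh.
have [] // := @assign_spec inp n Q d (Read 1 (cell d)) (inp 1 (ev inp env a)) s s1 r
  (Q ^ ca + cell_cost d Q).+1 hi nQ.
- by rewrite -e1 -(eval_cell hi.1).
- by apply: (cost_read1 hi); apply: (cost_cell hi.1); rewrite ?e1.
move=> s' [h1 h2 h3 h4]; exists s'; split=> //.
  by apply: runs_leq (runs_seq r1 h1) _; apply: hc.
by apply: leq_trans h3 _; apply: leq_trans (hc _ Q2); lia.
Qed.

Lemma holds_ext n s s1 env x d : size env = d -> holds n s env ->
  (forall a, a < n + d -> s1 a = s a) -> s1 (n + d) = x -> holds n s1 (rcons env x).
Proof.
move=> hd hh hf e; apply/holds_rcons; split; last by rewrite hd.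
by apply: holds_frame hf hh; rewrite hd.
Qed.

Lemma comp_bin o a b d ca cb : comp_spec a d ca -> comp_spec b d.+1 cb ->
  exists c, comp_spec (TBin o a b) d c.
Proof.
(* The value of [a] may have [Q ^ ca] bits, so [b] is run with the length bound [Q ^ ca.+1], which
   dominates both [Q] and [Q ^ ca]. *)
move=> IHa IHb; pose g Q := (Q ^ ca.+1) ^ cb.
pose A Q := (Q ^ ca + cell_cost d Q) + (g Q + cell_cost d.+1 Q) +
            ((Q ^ ca + cell_cost d Q) + (g Q + cell_cost d.+1 Q)).
have [c hc] : poly_bounded (fun Q =>
  (Q ^ ca + (g Q + (cell_cost d Q + A Q).+1).+1).+1) by rewrite /A /g; poly.
exists c => inp n Q env s r hi he hd hh.
have [[_ Q2 nQ _ _] _] := he.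
have [s1 [r1 e1 b1 f1]] := IHa _ _ _ _ _ r hi he hd hh.
have hh1 := holds_ext hd hh f1 e1.
have hQ : Q <= Q ^ ca.+1 by apply: pow_ge.
have he1 : env_ok n (Q ^ ca.+1) (rcons env (ev inp env a)).
  apply: env_ok_rcons; last exact: env_ok_leq he.
  by apply: leq_trans b1 _; rewrite leq_exp2l.
have hd1 : size (rcons env (ev inp env a)) = d.+1 by rewrite size_rcons hd.
have [s2 [r2 e2 b2 f2]] := IHb _ _ _ _ _ r hi he1 hd1 hh1.
have e12 : s2 (n + d) = ev inp env a by rewrite f2 // addnS.
have [] // := @assign_spec inp n Q d (Bin o (cell d) (cell d.+1)) (ev inp env (TBin o a b))
  s s2 r (A Q) hi nQ.
- by rewrite /= hi.1 e12 e2.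
- by apply: cost_bin; apply: (cost_cell hi.1) => //; rewrite ?e12 ?e2.
- by move=> x h; rewrite f2 ?f1 // addnS ltnW.
move=> s' [h1 h2 h3 h4]; exists s'; split=> //.
  by apply: runs_leq (runs_seq r1 (runs_seq r2 h1)) _; apply: hc.
by apply: leq_trans h3 _; apply: leq_trans (hc _ Q2); lia.
Qed.

Lemma comp_let a b d ca cb : comp_spec a d ca -> comp_spec b d.+1 cb ->
  exists c, comp_spec (TLet a b) d c.
Proof.
move=> IHa IHb; pose g Q := (Q ^ ca.+1) ^ cb.
have [c hc] : poly_bounded (fun Q =>
  (Q ^ ca + (g Q + (cell_cost d Q + (g Q + cell_cost d.+1 Q)).+1).+1).+1) by rewrite /g; poly.
exists c => inp n Q env s r hi he hd hh.
have [[_ Q2 nQ _ _] _] := he.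
have [s1 [r1 e1 b1 f1]] := IHa _ _ _ _ _ r hi he hd hh.
have hh1 := holds_ext hd hh f1 e1.
have hQ : Q <= Q ^ ca.+1 by apply: pow_ge.
have he1 : env_ok n (Q ^ ca.+1) (rcons env (ev inp env a)).
  apply: env_ok_rcons; last exact: env_ok_leq he.
  by apply: leq_trans b1 _; rewrite leq_exp2l.
have hd1 : size (rcons env (ev inp env a)) = d.+1 by rewrite size_rcons hd.
have [s2 [r2 e2 b2 f2]] := IHb _ _ _ _ _ r hi he1 hd1 hh1.
have [] // := @assign_spec inp n Q d (cell d.+1) (ev inp env (TLet a b))
  s s2 r (g Q + cell_cost d.+1 Q) hi nQ.
- by rewrite (eval_cell hi.1) e2.
- by apply: (cost_cell hi.1) => //; rewrite ?e2.
- by move=> x h; rewrite f2 ?f1 // addnS ltnW.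
move=> s' [h1 h2 h3 h4]; exists s'; split=> //.
  by apply: runs_leq (runs_seq r1 (runs_seq r2 h1)) _; apply: hc.
by apply: leq_trans h3 _; apply: leq_trans (hc _ Q2); lia.
Qed.

Lemma comp_if x a b d cx ca cb :
  comp_spec x d cx -> comp_spec a d ca -> comp_spec b d cb ->
  exists c, comp_spec (TIf x a b) d c.
Proof.
move=> IHx IHa IHb.
have [c hc] : poly_bounded (fun Q =>
  (Q ^ cx + ((Q ^ cx + cell_cost d Q) + (Q ^ ca + Q ^ cb)).+1).+1) by poly.
exists c => inp n Q env s r hi he hd hh.
have [[_ Q2 nQ _ _] _] := he.
have [s1 [r1 e1 b1 f1]] := IHx _ _ _ _ _ r hi he hd hh.
have hh1 : holds n s1 env by apply: holds_frame f1 hh; rewrite hd.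
have hcost : eval_cost inp s1 (cell d) <= Q ^ cx + cell_cost d Q.
  by apply: (cost_cell hi.1); rewrite ?e1.
have [s2 [r2 e2 b2 f2]] : exists s2, [/\
    runs inp (if eval inp s1 (cell d) != 0 then compile d a else compile d b) s1 r s2 r
      (Q ^ ca + Q ^ cb),
    s2 (n + d) = ev inp env (TIf x a b), bit_length (ev inp env (TIf x a b)) <= Q ^ ca + Q ^ cb
    & forall y, y < n + d -> s2 y = s y].
  rewrite (eval_cell hi.1) e1 /=.
  case: ifP => _.
    have [s2 [r2 e2 b2 f2]] := IHa _ _ _ _ _ r hi he hd hh1.
    exists s2; split=> //; first by apply: runs_leq r2 _; apply: leq_addr.
      by apply: leq_trans b2 (leq_addr _ _).
    by move=> y h; rewrite f2 ?f1.
  have [s2 [r2 e2 b2 f2]] := IHb _ _ _ _ _ r hi he hd hh1.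
  exists s2; split=> //; first by apply: runs_leq r2 _; apply: leq_addl.
    by apply: leq_trans b2 (leq_addl _ _).
  by move=> y h; rewrite f2 ?f1.
exists s2; split=> //; last by apply: leq_trans b2 _; apply: leq_trans (hc _ Q2); lia.
apply: runs_leq (runs_seq r1 (runs_if r2)) _.
by apply: leq_trans (hc _ Q2); rewrite !ltnS leq_add2l ltnS leq_add2r.
Qed.

(** Reducing the accumulator stops its length from growing with the iterations: every round of the
    body costs the same polynomial in [Q], and there are at most [Q] rounds. *)
Lemma comp_iter x a b d cx ca cb : 2 <= d ->
  comp_spec x d cx -> comp_spec a d.+2 ca -> comp_spec b d.+3 cb ->
  exists c, comp_spec (TIter x a b) d c.
Proof.
move=> d2 IHx IHa IHb; pose g Q := (Q ^ ca.+1) ^ cb.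
pose Ax Q := (Q ^ cx + cell_cost d Q) + (Q + cell_cost 1 Q)
             + ((Q ^ cx + cell_cost d Q) + (Q + cell_cost 1 Q)).
pose Aw Q := (Q + cell_cost d Q) + (Q + cell_cost d.+1 Q)
             + ((Q + cell_cost d Q) + (Q + cell_cost d.+1 Q)).
pose Am Q := (g Q + cell_cost d.+3 Q) + (Q + cell_cost 0 Q)
             + ((g Q + cell_cost d.+3 Q) + (Q + cell_cost 0 Q)).
pose Ai Q := (Q + cell_cost d.+1 Q) + 2 + ((Q + cell_cost d.+1 Q) + 2).
pose body Q := (g Q + ((cell_cost d.+2 Q + Am Q).+1 + (cell_cost d.+1 Q + Ai Q).+1).+1).+1.
pose Ae Q := Q ^ ca.+1 + cell_cost d.+2 Q.
have [c hc] : poly_bounded (fun Q =>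
  (Q ^ cx + ((Ax Q + ((cell_cost d Q + (Q + cell_cost 1 Q)).+1 + 1)).+1 +
  ((cell_cost d.+1 Q + 1).+1 + (Q ^ ca + ((Q.+1 * (Aw Q + body Q).+1) +
   (cell_cost d Q + Ae Q).+1).+1).+1).+1).+1).+1).
  by rewrite /body /Ax /Aw /Am /Ai /Ae /g; poly.
exists c => inp n Q env s r hi he hd hh.
have [[_ Q2 nQ M0 NQ] hb] := he.
have hcell j s0 A : bit_length (s0 (n + j)) <= A ->
    eval_cost inp s0 (cell j) <= A + cell_cost j Q by apply: (cost_cell hi.1).
have [s1 [r1 e1 b1 f1]] := IHx _ _ _ _ _ r hi he hd hh.
set K := minn (ev inp env x) (nth 0 env 1).
have hh1 : holds n s1 env by apply: holds_frame f1 hh; rewrite hd.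
have eN : s1 (n + 1) = nth 0 env 1 by rewrite hh1 // hd.
have KQ : K <= Q by apply: leq_trans (geq_minr _ _) NQ.
have bK : bit_length K <= Q by apply: leq_trans (hb 1); apply: bit_length_mono (geq_minr _ _).
have [s2 [r2 e2 f2]] : exists s2, [/\
    runs inp (If (Bin Leq (cell d) (cell 1)) Skip (assign d (cell 1))) s1 r s2 r
      (Ax Q + ((cell_cost d Q + (Q + cell_cost 1 Q)).+1 + 1)).+1,
    s2 (n + d) = K & forall y, y < n + d -> s2 y = s y].
  have hcost : eval_cost inp s1 (Bin Leq (cell d) (cell 1)) <= Ax Q.
    by apply: cost_bin; apply: hcell; rewrite ?e1 ?eN.
  have [s2 [r2 e2 f2]] : exists s2, [/\
      runs inp (if eval inp s1 (Bin Leq (cell d) (cell 1)) != 0 then Skip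
                else assign d (cell 1)) s1 r s2 r
        ((cell_cost d Q + (Q + cell_cost 1 Q)).+1 + 1),
      s2 (n + d) = K & forall y, y < n + d -> s2 y = s y].
    rewrite /= hi.1 e1 eN; case: leqP => hle /=.
      exists s1; split=> //; last by rewrite e1 /K (minn_idPl hle).
      by apply: runs_leq (runs_skip _ _ _) _; apply: leq_addl.
    have [] // := @assign_spec inp n Q d (cell 1) K s s1 r (Q + cell_cost 1 Q) hi nQ.
    - by rewrite (eval_cell hi.1) eN /K (minn_idPr (ltnW hle)).
    - by apply: hcell; rewrite eN.
    move=> s2 [h1 h2 h3 h4]; exists s2; split=> //.
    by apply: runs_leq h1 _; apply: leq_addr.
  exists s2; split=> //; apply: runs_leq (runs_if r2) _.
  by rewrite ltnS leq_add2r.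
have hh2 : holds n s2 (rcons env K) by apply: holds_ext hd hh f2 e2.
have hd1 : size (rcons env K) = d.+1 by rewrite size_rcons hd.
have he1 : env_ok n Q (rcons env K) by apply: env_ok_rcons he.
have [] // := @assign_spec inp n Q d.+1 (Const 0) 0 s2 s2 r 1 hi nQ.
move=> s3 [r3 e3 _ f3].
have hh3 := holds_ext hd1 hh2 f3 e3.
have hd2 : size (rcons (rcons env K) 0) = d.+2 by rewrite size_rcons hd1.
have he2 : env_ok n Q (rcons (rcons env K) 0).
  by apply: env_ok_rcons he1; rewrite (bit_length_bool (leq0n 1)); lia.
have [s4 [r4 e4 b4 f4]] := IHa _ _ _ _ _ r hi he2 hd2 hh3.
pose acc i := iteri i
  (fun i x => ev inp (rcons (rcons (rcons env K) i) x) b %% nth 0 env 0)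
  (ev inp (rcons (rcons env K) 0) a).
have hQ : Q <= Q ^ ca.+1 by apply: pow_ge.
(* Only the initial value, which is not reduced, can be longer than [Q]. *)
have hacc i : bit_length (acc i) <= Q ^ ca.+1.
  case: i => [|i]; first by apply: leq_trans b4 _; rewrite leq_exp2l.
  apply: leq_trans hQ; apply: leq_trans (hb 0); apply: bit_length_mono.
  by rewrite /acc /= ltnW // ltn_mod.
pose I i s5 r5 := [/\ r5 = r, holds n s5 (rcons (rcons (rcons env K) i) (acc i)) &
   forall y, y < n + d -> s5 y = s y].
have hI i s5 r5 : I i s5 r5 -> [/\ s5 (n + d) = K, s5 (n + d.+1) = i,
     s5 (n + d.+2) = acc i & s5 (n + 0) = nth 0 env 0].
  move=> [_ /holds_rcons[/holds_rcons[/holds_rcons[h0 h1] h2] h3] _].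
  by rewrite !size_rcons hd in h1 h2 h3; split=> //; rewrite h0 // hd ltnW.
have [s6 [r6 [rw [er6 h6 f6]]]] : exists s' r', runs inp
    (While (Bin Defs.Sub (cell d) (cell d.+1))
      (compile d.+3 b ;;
       assign d.+2 (Bin Mod (cell d.+3) (cell 0)) ;;
       assign d.+1 (Bin Add (cell d.+1) (Const 1)))) s4 r s' r'
      (K.+1 * (Aw Q + body Q).+1) /\ I K s' r'.
  apply: runs_while.
  - move=> i s5 r5 iK /hI[eK ei _ _]; split.
      apply: cost_bin; apply: hcell; rewrite ?eK ?ei //.
      by apply: leq_trans bK; apply: bit_length_mono.
    by rewrite /= hi.1 eK ei subn_eq0 -ltnNge.
  - move=> i s5 r5 iK II; have [eK ei ea e0] := hI _ _ _ II.
    have [er h5 f5] := II; subst r5.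
    set env3 := rcons _ _ in h5.
    have hd3 : size env3 = d.+3 by rewrite size_rcons size_rcons hd1.
    have bi : bit_length i <= Q by apply: leq_trans bK; apply: bit_length_mono (ltnW iK).
    have he3 : env_ok n (Q ^ ca.+1) env3.
      do ![apply: env_ok_rcons => //]; last exact: env_ok_leq he.
        by apply: leq_trans hQ.
      by apply: leq_trans hQ.
    have [s7 [r7 e7 b7 f7]] := IHb _ _ _ _ _ r hi he3 hd3 h5.
    have [] // := @assign_spec inp n Q d.+2 (Bin Mod (cell d.+3) (cell 0)) (acc i.+1)
      s5 s7 r (Am Q) hi nQ.
    + have -> : acc i.+1 = ev inp env3 b %% nth 0 env 0 by [].
      by rewrite /= hi.1 e7 f7 ?e0 // ltn_add2l.
    + apply: cost_bin; apply: hcell; first by rewrite e7.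
      by rewrite f7 ?e0 // ltn_add2l.
    + by move=> y hy; rewrite f7 // addnS ltnW.
    move=> s8 [r8 e8 _ f8].
    have e8i : s8 (n + d.+1) = i by rewrite f8 // ltn_add2l.
    have hA9 : eval_cost inp s8 (Bin Add (cell d.+1) (Const 1)) <= Ai Q.
      by apply: cost_bin; [apply: hcell; rewrite e8i | exact: cost_const].
    exists (update s8 (n + d.+1) i.+1), r; split.
      have := runs_assign hi.1 nQ r d.+1 hA9.
      have -> : eval inp s8 (Bin Add (cell d.+1) (Const 1)) = i.+1.
        by rewrite /= hi.1 e8i addn1.
      move=> r9.
      apply: runs_leq (runs_seq r7 (runs_seq r8 r9)) _.
      by rewrite /body /g /cell_cost; lia.
    have fr y : y < n + d.+1 -> update s8 (n + d.+1) i.+1 y = s5 y.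
      by move=> hy; rewrite update_frame // f8 // addnS ltnW.
    split=> //.
      apply/holds_rcons; split; last first.
        rewrite size_rcons hd1 /update ifF ?e8 //; lia.
      apply: (holds_ext hd1 _ fr (update_same _ _ _)).
      by move: h5 => /holds_rcons[/holds_rcons[]].
    by move=> y hy; rewrite fr ?f5 // addnS ltnW.
  - split=> //.
      apply/holds_rcons; split; last by rewrite hd2 e4.
      by apply: holds_frame f4 hh3; rewrite hd2.
    by move=> y hy; rewrite f4 ?f3 ?f2 //; lia.
have [eK _ ea _] := hI _ _ _ (And3 er6 h6 f6); subst r6.
have [] // := @assign_spec inp n Q d (cell d.+2) (acc K) s s6 r (Ae Q) hi nQ.
- by rewrite (eval_cell hi.1) ea.
- by apply: hcell; rewrite ea.
move=> s' [h1 h2 h3 h4]; exists s'; split=> //.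
  apply: runs_leq (runs_seq r1 (runs_seq r2 (runs_seq r3 (runs_seq r4 (runs_seq rw h1))))) _.
  apply: leq_trans (hc _ Q2).
  have : K.+1 * (Aw Q + body Q).+1 <= Q.+1 * (Aw Q + body Q).+1 by rewrite leq_mul2r ltnS KQ orbT.
  lia.
by apply: leq_trans h3 _; apply: leq_trans (hc _ Q2); lia.
Qed.

(** The whole time analysis of the counting: the exponent depends on the term and its level only,
    and no fact about values is used. The level is at least 2 because the first two variables are
    the modulus and the cap. *)
Theorem comp_ok t d : 2 <= d -> exists c, comp_spec t d c.
Proof.
elim: t d => [i|x|a IHa|o a IHa b IHb|a IHa b IHb|x IHx a IHa b IHb|x IHx a IHa b IHb] d d2.
- exact: comp_var.
- exact: comp_cst.
- by have [ca ha] := IHa d d2; apply: comp_adj ha.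
- have [ca ha] := IHa d d2; have [cb hb] := IHb d.+1 (leqW d2).
  exact: comp_bin ha hb.
- have [ca ha] := IHa d d2; have [cb hb] := IHb d.+1 (leqW d2).
  exact: comp_let ha hb.
- have [cx hx] := IHx d d2; have [ca ha] := IHa d d2; have [cb hb] := IHb d d2.
  exact: comp_if hx ha hb.
- have [cx hx] := IHx d d2; have [ca ha] := IHa d.+2 (leqW (leqW d2)).
  have [cb hb] := IHb d.+3 (leqW (leqW (leqW d2))).
  exact: comp_iter d2 hx ha hb.
Qed.

(** * A functional language compiled to programs *)

(* Terms in higher-order abstract syntax: a term is given the number of the
   variables in scope, hence the level of the next variable. *)
Definition term := nat -> tm.

Definition tvar i : term := fun _ => TVar i.
Definition tcst c : term := fun _ => TCst c.
Definition tread (a : term) : term := fun d => TAdj (a d).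
Definition tbin o (a b : term) : term := fun d => TBin o (a d) (b d.+1).
Definition tlet (a : term) (f : term -> term) : term :=
  fun d => TLet (a d) (f (tvar d) d.+1).
Definition tif (c a b : term) : term := fun d => TIf (c d) (a d) (b d).
Definition titer (c a : term) (f : term -> term -> term) : term :=
  fun d => TIter (c d) (a d.+2) (f (tvar d.+1) (tvar d.+2) d.+3).

Definition tadd := tbin Add.
Definition tsub := tbin Defs.Sub.
Definition tmul := tbin Mul.
Definition tdiv := tbin Div.
Definition tmod := tbin Mod.
Definition teq := tbin Eq.
Definition tleq := tbin Leq.
Definition tlt a b := tleq (tadd a (tcst 1)) b.
Definition tnot a := teq a (tcst 0).
Definition tand := tmul.
Definition tor a b := tnot (tand (tnot a) (tnot b)).
Definition timp a b := tor (tnot a) b.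
Definition tsum c (f : term -> term) := titer c (tcst 0) (fun i x => tadd x (f i)).
Definition tprod c (f : term -> term) := titer c (tcst 1) (fun i x => tmul x (f i)).
Definition thas c (f : term -> term) := tlt (tcst 0) (tsum c f).
Definition tall c (f : term -> term) := tnot (thas c (fun i => tnot (f i))).
(** The summand at [i] is 1 when no index up to [i] satisfies [f]; the sum is thus the first index
    that does, or [c] if none does. *)
Definition tfind c (f : term -> term) :=
  tsum c (fun i => tnot (thas (tadd i (tcst 1)) f)).
Definition tpow b e := titer e (tcst 1) (fun _ x => tmul x b).
Definition tget b x i := tmod (tdiv x (tpow b i)) b.
Definition ttab b c (f : term -> term) := tsum c (fun i => tmul (f i) (tpow b i)).

(** The language has only numbers, so an array is a number whose digits in base [b] are its
    entries. *)
Definition get b x i := x %/ b ^ i %% b.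
Definition tab b K (g : nat -> nat) := \sum_(i < K) g i * b ^ i.

Lemma tab_recr b K g : tab b K.+1 g = tab b K g + g K * b ^ K.
Proof. by rewrite /tab big_ord_recr. Qed.

Lemma tab_recl b K g : tab b K.+1 g = g 0 + b * tab b K (g \o S).
Proof.
rewrite /tab big_ord_recl muln1 big_distrr /=; congr (_ + _).
by apply: eq_bigr => i _; rewrite expnS mulnCA.
Qed.

Lemma ltn_tab b K g : (forall i, i < K -> g i < b) -> tab b K g < b ^ K.
Proof.
elim: K => [|K IH] h; first by rewrite /tab big_ord0.
rewrite tab_recr expnS.
have := IH (fun i lt => h i (leqW lt)); have := h K (leqnn _).
by move: (tab b K g) (b ^ K) => x y; nia.
Qed.

Lemma get_tab b K g i : (forall j, j < K -> g j < b) -> i < K -> get b (tab b K g) i = g i.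
Proof.
rewrite /get; elim: K g i => [//|K IH] g i hg.
have b0 : 0 < b by apply: leq_trans (hg 0 _).
rewrite tab_recl; case: i => [|i] lt.
  by rewrite expn0 divn1 addnC mulnC modnMDl modn_small ?hg.
by rewrite expnS divnMA addnC mulnC divnMDl // (divn_small (hg 0 isT)) addn0 IH // => j lt'; apply: hg.
Qed.

Lemma get_lt b x i : 0 < b -> get b x i < b.
Proof. by move=> h; rewrite ltn_mod. Qed.

Lemma get0 b i : get b 0 i = 0.
Proof. by rewrite /get div0n mod0n. Qed.

(** * Values of terms when reductions and caps have no effect *)

Section Den.
Variables (inp : input) (env0 : seq nat).
Hypothesis size_env0 : 2 <= size env0.
Let M := nth 0 env0 0.
Let N := nth 0 env0 1.
Hypothesis NM : N < M.

(* The prefix order makes [den] stable under the binding of new variables. *)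
Definition den env (t : term) v := forall env',
  prefix env env' -> prefix env0 env' -> ev inp env' (t (size env')) = v.

Lemma den_mono env env' t v : prefix env env' -> den env t v -> den env' t v.
Proof. by move=> h d e /(prefix_trans h); apply: d. Qed.

Lemma nth_prefix (e e' : seq nat) i : prefix e e' -> i < size e -> nth 0 e' i = nth 0 e i.
Proof. by move=> /prefixP[x ->] h; rewrite nth_cat h. Qed.

Lemma den_global env i : i < size env0 -> den env (tvar i) (nth 0 env0 i).
Proof. by move=> h e _ p; apply: nth_prefix. Qed.

Lemma den_cst env c : den env (tcst c) c.
Proof. by []. Qed.

Lemma den_rcons e x : den (rcons e x) (tvar (size e)) x.
Proof.
by move=> e' p _; rewrite /= (nth_prefix p) ?size_rcons // nth_rcons ltnn eqxx.
Qed.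

Lemma den_read env a x : den env a x -> den env (tread a) (inp 1 x).
Proof. by move=> h e p p0; rewrite /= h. Qed.

Lemma den_bin o env a b x y :
  den env a x -> den env b y -> den env (tbin o a b) (eval_binop o x y).
Proof.
move=> ha hb e p p0; rewrite /= ha //; congr eval_binop.
by rewrite -(size_rcons e x) hb // (prefix_trans _ (prefix_rcons _ _)).
Qed.

Lemma den_let env a f x v : den env a x ->
  (forall env' t, prefix env env' -> den env' t x -> den env' (f t) v) ->
  den env (tlet a f) v.
Proof.
move=> ha hf e p p0; rewrite /= ha // -(size_rcons e x).
have pe := prefix_rcons e x.
apply: (hf (rcons e x)); last 1 first.
- exact: prefix_trans pe.
- exact: prefix_trans pe.
- exact: den_rcons.
- exact: prefix_refl.
Qed.

Lemma den_if env c a a' (b : bool) x y : den env c b ->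
  (b -> den env a x) -> (~~ b -> den env a' y) ->
  den env (tif c a a') (if b then x else y).
Proof.
move=> hc ha ha' e p p0; rewrite /= hc //.
by case: b ha ha' {hc} => /= [ha _|_ ha]; apply: ha.
Qed.

(** The two bounds make the cap and the reductions void. The initial value [f 0] needs no bound
    since it is never reduced. *)
Lemma den_iter env c a body K (f : nat -> nat) :
  den env c K -> den env a (f 0) -> K <= N ->
  (forall i, i < K -> f i.+1 < M) ->
  (forall i env' ti tx, i < K -> prefix env env' -> den env' ti i ->
     den env' tx (f i) -> den env' (body ti tx) (f i.+1)) ->
  den env (titer c a body) (f K).
Proof.
move=> hc ha KN hM hb e p p0.
rewrite /= hc // (nth_prefix p0 (size_env0)) (nth_prefix p0 (ltnW size_env0)).
rewrite (minn_idPl KN).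
have pe x y : prefix e (rcons (rcons e x) y).
  by apply: prefix_trans (prefix_rcons _ _); apply: prefix_rcons.
have pe3 x y z : prefix e (rcons (rcons (rcons e x) y) z).
  by apply: prefix_trans (prefix_rcons _ _).
suff h j : j <= K -> iteri j (fun i x => ev inp (rcons (rcons (rcons e K) i) x)
    (body (tvar (size e).+1) (tvar (size e).+2) (size e).+3) %% nth 0 env0 0)
    (ev inp (rcons (rcons e K) 0) (a (size e).+2)) = f j by apply: h.
elim: j => [|j IH] lt.
  have -> : (size e).+2 = size (rcons (rcons e K) 0) by rewrite !size_rcons.
  by rewrite /= ha // (prefix_trans _ (pe _ _)).
rewrite /= IH ?(ltnW lt) //.
set e3 := rcons _ _.
have -> : (size e).+3 = size e3 by rewrite !size_rcons.
rewrite (hb j e3) //.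
- by rewrite modn_small // hM.
- exact: prefix_trans (pe3 _ _ _).
- apply: (den_mono (prefix_rcons _ _)).
  by rewrite -(size_rcons e K); apply: den_rcons.
- have -> : (size e).+2 = size (rcons (rcons e K) j) by rewrite !size_rcons.
  exact: den_rcons.
- exact: prefix_refl.
- exact: prefix_trans (pe3 _ _ _).
Qed.

Lemma den_add env a b x y : den env a x -> den env b y -> den env (tadd a b) (x + y).
Proof. exact: den_bin. Qed.
Lemma den_sub env a b x y : den env a x -> den env b y -> den env (tsub a b) (x - y).
Proof. exact: den_bin. Qed.
Lemma den_mul env a b x y : den env a x -> den env b y -> den env (tmul a b) (x * y).
Proof. exact: den_bin. Qed.
Lemma den_div env a b x y : den env a x -> den env b y -> den env (tdiv a b) (x %/ y).
Proof. exact: den_bin. Qed.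
Lemma den_mod env a b x y : den env a x -> den env b y -> den env (tmod a b) (x %% y).
Proof. exact: den_bin. Qed.
Lemma den_eq env a b (x y : nat) : den env a x -> den env b y -> den env (teq a b) (x == y).
Proof. exact: den_bin. Qed.
Lemma den_leq env a b x y : den env a x -> den env b y -> den env (tleq a b) (x <= y).
Proof. exact: den_bin. Qed.
Lemma den_lt env a b x y : den env a x -> den env b y -> den env (tlt a b) (x < y).
Proof. by move=> ha hb; rewrite -addn1; apply: den_leq => //; apply: den_add. Qed.
Lemma den_not env a (b : bool) : den env a b -> den env (tnot a) (~~ b).
Proof. by move=> h; have := den_eq h (@den_cst env 0); case: b {h}. Qed.
Lemma den_and env a b (x y : bool) : den env a x -> den env b y -> den env (tand a b) (x && y).
Proof. by rewrite -mulnb; apply: den_mul. Qed.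
Lemma den_or env a b (x y : bool) : den env a x -> den env b y -> den env (tor a b) (x || y).
Proof. by move=> ha hb; rewrite -[_ || _]negbK negb_or; apply: den_not; apply: den_and; apply: den_not. Qed.
Lemma den_imp env a b (x y : bool) : den env a x -> den env b y -> den env (timp a b) (x ==> y).
Proof. by rewrite implybE => ha hb; apply: den_or => //; apply: den_not. Qed.

Lemma den_sum env c f K (g : nat -> nat) : den env c K -> K <= N -> \sum_(i < K) g i < M ->
  (forall i env' t, i < K -> prefix env env' -> den env' t i -> den env' (f t) (g i)) ->
  den env (tsum c f) (\sum_(i < K) g i).
Proof.
move=> hc KN hM hf.
apply: (@den_iter _ _ _ _ K (fun j => \sum_(i < j) g i)) => //.
- by rewrite big_ord0; apply: den_cst.
- move=> i lt; apply: leq_ltn_trans hM.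
  rewrite -(big_mkord xpredT) -[X in _ <= X](big_mkord xpredT).
  by rewrite (@big_cat_nat _ _ _ i.+1 0 K) //= leq_addr.
- by move=> i e ti tx lt p di dx; rewrite big_ord_recr; apply: den_add => //; apply: hf.
Qed.

(** Partial sums are bounded by the full sum, but a later factor 0 can make the full product smaller
    than a partial one; hence a bound on each of them. *)
Lemma den_prod env c f K (g : nat -> nat) : den env c K -> K <= N ->
  (forall j, j <= K -> \prod_(i < j) g i < M) ->
  (forall i env' t, i < K -> prefix env env' -> den env' t i -> den env' (f t) (g i)) ->
  den env (tprod c f) (\prod_(i < K) g i).
Proof.
move=> hc KN hM hf.
apply: (@den_iter _ _ _ _ K (fun j => \prod_(i < j) g i)) => //.
- by rewrite big_ord0; apply: den_cst.
- by move=> i lt; apply: hM.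
- by move=> i e ti tx lt p di dx; rewrite big_ord_recr; apply: den_mul => //; apply: hf.
Qed.

Lemma sum_bool_has (p : nat -> bool) K : (0 < \sum_(i < K) p i) = has p (iota 0 K).
Proof.
elim: K => [|K IH]; first by rewrite big_ord0.
rewrite big_ord_recr -[in RHS]addn1 iotaD has_cat -IH add0n addn_gt0 /= orbF.
by case: (p K).
Qed.

Lemma sum_bool_leq (p : nat -> bool) K : \sum_(i < K) p i <= K.
Proof. by rewrite -[X in _ <= X]muln1 -[X in X * 1]card_ord -sum_nat_const leq_sum // => i _; apply: leq_b1. Qed.

Lemma sum_bool_find (p : nat -> bool) K :
  \sum_(i < K) ~~ has p (iota 0 i.+1) = find p (iota 0 K).
Proof.
elim: K => [|K IH]; first by rewrite big_ord0.
rewrite big_ord_recr IH -[in RHS]addn1 -[(nat_of_ord _).+1]addn1 !iotaD find_cat has_cat.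
rewrite size_iota add0n /= orbF.
have [h|h] := boolP (has p (iota 0 K)); first by rewrite addn0.
rewrite (hasNfind h) size_iota; case: (p K) => //=; lia.
Qed.

Lemma den_has env c f K (p : nat -> bool) : den env c K -> K <= N ->
  (forall i env' t, i < K -> prefix env env' -> den env' t i -> den env' (f t) (p i)) ->
  den env (thas c f) (has p (iota 0 K)).
Proof.
move=> hc KN hf; rewrite -sum_bool_has; apply: den_lt; first exact: den_cst.
apply: (@den_sum _ _ _ _ (fun i => p i)) => //.
by apply: leq_ltn_trans (sum_bool_leq _ _) _; apply: leq_ltn_trans NM.
Qed.

Lemma den_all env c f K (p : nat -> bool) : den env c K -> K <= N ->
  (forall i env' t, i < K -> prefix env env' -> den env' t i -> den env' (f t) (p i)) ->
  den env (tall c f) (all p (iota 0 K)).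
Proof.
move=> hc KN hf; have -> : all p (iota 0 K) = ~~ has (predC p) (iota 0 K).
  by rewrite has_predC negbK.
by apply: den_not; apply: den_has => // i e t lt pe d; apply: den_not; apply: hf.
Qed.

Lemma den_find env c f K (p : nat -> bool) : den env c K -> K <= N ->
  (forall i env' t, i < K -> prefix env env' -> den env' t i -> den env' (f t) (p i)) ->
  den env (tfind c f) (find p (iota 0 K)).
Proof.
move=> hc KN hf; rewrite -sum_bool_find.
apply: (@den_sum _ _ _ _ (fun i => ~~ has p (iota 0 i.+1))) => //.
  by apply: leq_ltn_trans (sum_bool_leq (fun i => ~~ has p (iota 0 i.+1)) K) _; apply: leq_ltn_trans NM.
move=> i e t lt pe d; apply: den_not; apply: den_has.
- by have := den_add d (@den_cst e 1); rewrite addn1.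
- exact: leq_trans KN.
- move=> j e' t' lt' pe' d'; apply: hf => //; first exact: leq_trans lt.
  exact: prefix_trans pe'.
Qed.

Lemma den_pow env tb te b i : den env tb b -> den env te i -> 0 < b -> i <= N -> b ^ i < M ->
  den env (tpow tb te) (b ^ i).
Proof.
move=> hb hi b0 iN hM; apply: (@den_iter _ _ _ _ i (fun j => b ^ j)) => //.
  move=> j lt; apply: leq_ltn_trans hM; exact: leq_pexp2l.
move=> j e ti tx lt p di dx; rewrite expnSr; apply: den_mul => //.
exact: den_mono hb.
Qed.

Lemma den_get env tb tx ti b x i : den env tb b -> den env tx x -> den env ti i -> 0 < b ->
  i <= N -> b ^ i < M -> den env (tget tb tx ti) (get b x i).
Proof.
move=> hb hx hi b0 iN hM; apply: den_mod => //; apply: den_div => //.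
exact: den_pow.
Qed.

Lemma den_tab env tb tc f b K g : den env tb b -> den env tc K -> 0 < b -> K <= N ->
  b ^ K < M -> tab b K g < M ->
  (forall i env' t, i < K -> prefix env env' -> den env' t i -> den env' (f t) (g i)) ->
  den env (ttab tb tc f) (tab b K g).
Proof.
move=> hb hc b0 KN hM hM' hf.
apply: (@den_sum _ _ _ _ (fun i => g i * b ^ i)) => //.
move=> i e t lt p d; apply: den_mul; first exact: hf.
apply: den_pow => //; first exact: den_mono hb.
  by apply: leq_trans KN; apply: ltnW.
by apply: leq_ltn_trans hM; apply: leq_pexp2l => //; apply: ltnW.
Qed.

End Den.

(** * The counting algorithm *)

Section Functions.
Variables (n k W : nat) (adj : nat -> nat -> bool).

Definition radix := n + k + 1.
Definition width2 := W + W + 1.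
Definition nstates := radix ^ width2.
(** Base of the table of counts: a count is at most [k ^ n <= 2 ^ (n * k)], and the table stores it
    plus one. *)
Definition cap := 2 ^ (n * k + 2).

(* A state encodes in base [radix] the separator [b_0, ..., b_(W-1)], where a
   digit that is not a vertex marks an unused position, the colors of the
   separator, and a root vertex. *)
Definition dig s i := get radix s i.
Definition root_of s := dig s (W + W).
Definition insep s x := has (fun j => dig s j == x) (iota 0 W).

Definition bit m x := get 2 m x == 1.
Definition bitmask (p : nat -> bool) := tab 2 n p.
Definition reach_step s m := bitmask (fun y => ~~ insep s y &&
  (bit m y || has (fun z => bit m z && adj z y) (iota 0 n))).
Definition reach0 s := bitmask (fun y => (y == root_of s) && ~~ insep s y).
Definition reach s := iter n (reach_step s) (reach0 s).
Definition conn s x := bit (reach s) x.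

Definition upd s j u c v := tab radix width2 (fun i =>
  if i == j then u else if i == W + j then c else if i == W + W then v else dig s i).

Section Table.
Variable P : nat -> nat -> bool.

Definition allowed s x c := P x c &&
  all (fun j => adj (dig s j) x ==> ~~ (dig s (W + j) == c)) (iota 0 W).
(** Entry 0 means that the count is not yet known. A known count is stored plus one, since it can
    itself be 0. *)
Definition entry T s := get cap T s.
(** Position [j] can be given to [u] if its old vertex has no neighbor in the new component and the
    required entries are known for all colors of [u]. Adjacency is tested on the component after the
    replacement; when the test succeeds, forgetting the old vertex has not enlarged the
    component. *)
Definition valid T s u v j := all (fun c =>
  ~~ (entry T (upd s j u c v) == 0) &&
  all (fun x => conn (upd s j u c v) x ==> ~~ adj (dig s j) x) (iota 0 n)) (iota 0 k).
Definition position T s u v := find (valid T s u v) (iota 0 W).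
Definition good_pivot T s u := conn s u && all (fun v =>
  (conn s v && ~~ (v == u)) ==> (position T s u v < W)) (iota 0 n).
Definition pivot T s := find (good_pivot T s) (iota 0 n).
Definition is_least s v := all (fun y => ~~ conn s y) (iota 0 v).
(** Only the least vertex of a component contributes, so each component enters the product once; the
    subtraction undoes the shift of the stored counts. *)
Definition factor T s u c v :=
  if conn s v && ~~ (v == u) && is_least (upd s (position T s u v) u c v) v
  then entry T (upd s (position T s u v) u c v) - 1 else 1.
Definition value T s :=
  if pivot T s < n
  then (\sum_(c < k) allowed s (pivot T s) c * \prod_(v < n) factor T s (pivot T s) c v) + 1
  else 0.
Definition next_table T := tab cap nstates (value T).
Definition dp_table r := iter r next_table 0.
Definition start v := tab radix width2 (fun i =>
  if i < W then n else if i == W + W then v else 0).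
Definition total_count := \prod_(v < n)
  (if is_least (start v) v then entry (dp_table n) (start v) - 1 else 1).
End Table.

(* As [c0] grows, the counts become the partial sums that locate the color of
   [v] in the lexicographic order. *)
Definition prefix_ok a v c0 x c :=
  ((x < v) ==> (c == dig a x)) && ((x == v) ==> (c < c0)).
Definition count_prefix a v c0 := total_count (prefix_ok a v c0).
Definition rank a v := \sum_(i < v) count_prefix a i (dig a i).
Definition next_color x a v := \sum_(c < k) (rank a v + count_prefix a v c.+1 <= x).
Definition unrank x := iteri n (fun v a => a + next_color x a v * radix ^ v) 0.

End Functions.

(** * The algorithm as terms of the language *)

Definition tn := tvar 2.
Definition tk := tvar 3.
Definition tradix := tadd (tadd tn tk) (tcst 1).
Definition tcap := tpow (tcst 2) (tadd (tmul tn tk) (tcst 2)).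

Section Program.
Variable W : nat.

Definition twidth2 := tcst (width2 W).
Definition tnstates := tpow tradix twidth2.
Definition tdig s i := tget tradix s i.
Definition troot s := tdig s (tcst (W + W)).
Definition tinsep s x := thas (tcst W) (fun j => teq (tdig s j) x).
Definition tbit m x := teq (tget (tcst 2) m x) (tcst 1).
Definition tmask p := ttab (tcst 2) tn p.
Definition tadj z y := tread (tadd (tmul z tn) y).
Definition treach_step s m := tmask (fun y => tand (tnot (tinsep s y))
  (tor (tbit m y) (thas tn (fun z => tand (tbit m z) (tadj z y))))).
Definition treach0 s := tmask (fun y => tand (teq y (troot s)) (tnot (tinsep s y))).
Definition treach s := titer tn (treach0 s) (fun _ m => treach_step s m).
Definition tconn s x := tbit (treach s) x.
Definition tupd s j u c v := ttab tradix twidth2 (fun i =>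
  tif (teq i j) u (tif (teq i (tadd (tcst W) j)) c
    (tif (teq i (tcst (W + W))) v (tdig s i)))).

Section TTable.
Variable P : term -> term -> term.

Definition tallowed s x c := tand (P x c)
  (tall (tcst W) (fun j => timp (tadj (tdig s j) x)
     (tnot (teq (tdig s (tadd (tcst W) j)) c)))).
Definition tentry T s := tget tcap T s.
Definition tvalid T s u v j := tall tk (fun c =>
  tand (tnot (teq (tentry T (tupd s j u c v)) (tcst 0)))
  (tall tn (fun x => timp (tconn (tupd s j u c v) x) (tnot (tadj (tdig s j) x))))).
Definition tposition T s u v := tfind (tcst W) (tvalid T s u v).
Definition tgood T s u := tand (tconn s u) (tall tn (fun v =>
  timp (tand (tconn s v) (tnot (teq v u))) (tlt (tposition T s u v) (tcst W)))).
Definition tpivot T s := tfind tn (tgood T s).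
Definition tis_least s v := tall v (fun y => tnot (tconn s y)).
Definition tfactor T s u c v :=
  tif (tand (tand (tconn s v) (tnot (teq v u)))
        (tis_least (tupd s (tposition T s u v) u c v) v))
    (tsub (tentry T (tupd s (tposition T s u v) u c v)) (tcst 1)) (tcst 1).
Definition tvalue T s :=
  tif (tlt (tpivot T s) tn)
    (tadd (tsum tk (fun c => tmul (tallowed s (tpivot T s) c)
       (tprod tn (fun v => tfactor T s (tpivot T s) c v)))) (tcst 1))
    (tcst 0).
Definition tnext T := ttab tcap tnstates (tvalue T).
Definition ttable r := titer r (tcst 0) (fun _ T => tnext T).
Definition tstart v := ttab tradix twidth2 (fun i =>
  tif (tlt i (tcst W)) tn (tif (teq i (tcst (W + W))) v (tcst 0))).
Definition ttotal := tprod tn (fun v =>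
  tif (tis_least (tstart v) v) (tsub (tentry (ttable tn) (tstart v)) (tcst 1)) (tcst 1)).
End TTable.

Definition tprefix_ok a v c0 x c :=
  tand (timp (tlt x v) (teq c (tdig a x))) (timp (teq x v) (tlt c c0)).
Definition tcount a v c0 := ttotal (tprefix_ok a v c0).
Definition trank a v := tsum v (fun i => tcount a i (tdig a i)).
Definition tnext_color x a v := tsum tk (fun c =>
  tleq (tadd (trank a v) (tcount a v (tadd c (tcst 1)))) x).
Definition tunrank x := titer tn (tcst 0)
  (fun v a => tadd a (tmul (tnext_color x a v) (tpow tradix v))).

End Program.

(** * The terms denote the functions of the algorithm *)

Section ProgramCorrect.
Variables (inp : input) (env0 : seq nat) (n k W : nat) (adj : nat -> nat -> bool).
Hypothesis size_env0 : 4 <= size env0.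
Hypothesis env0n : nth 0 env0 2 = n.
Hypothesis env0k : nth 0 env0 3 = k.
Let M := nth 0 env0 0.
Let N := nth 0 env0 1.
Hypothesis n_gt0 : 0 < n.
Hypothesis k_gt0 : 0 < k.
Hypothesis inp_adj : forall x y, y < n -> inp 1 (x * n + y) = adj x y.
Hypothesis states_N : nstates n k W <= N.
Hypothesis width_N : width2 W <= N.
Hypothesis nk_N : n * k + 2 <= N.
Hypothesis NM : N < M.
Hypothesis cap_M : N * (N * cap n k ^ n + 1) * cap n k ^ N < M.

Let size2 : 2 <= size env0. Proof. by apply: leq_trans size_env0. Qed.
Local Notation den := (den inp env0).
Local Notation q := (radix n k).

Let n_N : n <= N. Proof. by nia. Qed.
Let k_N : k <= N. Proof. by nia. Qed.
Let q2 : 1 < q. Proof. by rewrite /radix; lia. Qed.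
Let q0 : 0 < q. Proof. by rewrite /radix; lia. Qed.
Let W_N : W <= N. Proof. by move: width_N; rewrite /width2; lia. Qed.
Let cap4 : 4 <= cap n k.
Proof. by rewrite /cap -[4]/(2 ^ 2) leq_exp2l // leq_addl. Qed.
Let cap0 : 0 < cap n k. Proof. by lia. Qed.
Let N0 : 0 < N. Proof. by lia. Qed.

Let capN_M : cap n k ^ N < M.
Proof.
apply: leq_ltn_trans cap_M; rewrite leq_pmull // muln_gt0 N0 /=; lia.
Qed.

Let pow2 i : i <= N -> 2 ^ i < M.
Proof.
move=> h; apply: leq_ltn_trans capN_M; apply: leq_trans (_ : 2 ^ N <= _).
  by rewrite leq_exp2l.
by rewrite leq_exp2r //; lia.
Qed.

Let powcap i : i <= N -> cap n k ^ i < M.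
Proof. by move=> h; apply: leq_ltn_trans capN_M; rewrite leq_exp2l //; lia. Qed.

Let powq i : i <= N -> q ^ i < M.
Proof.
move=> h; apply: leq_ltn_trans capN_M; apply: leq_trans (_ : q ^ N <= _).
  by rewrite leq_exp2l.
rewrite leq_exp2r // /cap.
apply: leq_trans (ltnW (ltn_expl _ (isT : 1 < 2))) _.
by rewrite leq_exp2l // /radix; nia.
Qed.

(** On entering the body of a loop, this carries all known denotations to the larger environment. *)
Ltac lift p := repeat match goal with
  | H : den ?e _ _ |- _ =>
    match type of p with is_true (prefix e _) => apply (den_mono p) in H end
  end.

Let den_n env : den env tn n.
Proof. by rewrite -env0n; apply: den_global; apply: leq_trans size_env0. Qed.

Let den_k env : den env tk k.
Proof. by rewrite -env0k; apply: den_global; apply: leq_trans size_env0. Qed.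

Let den_radix env : den env tradix q.
Proof. by apply: den_add => //; apply: den_add. Qed.

Let den_cap env : den env tcap (cap n k).
Proof.
apply: den_pow => //; last exact: pow2.
by apply: den_add => //; apply: den_mul.
Qed.

Lemma den_dig env ts ti s i : den env ts s -> den env ti i -> i <= N ->
  den env (tdig ts ti) (dig n k s i).
Proof. by move=> hs hi iN; apply: den_get => //; apply: powq. Qed.

Lemma den_root env ts s : den env ts s -> den env (troot W ts) (root_of n k W s).
Proof.
by move=> hs; apply: den_dig => //; move: width_N; rewrite /width2; lia.
Qed.

Lemma den_insep env ts tx s x : den env ts s -> den env tx x ->
  den env (tinsep W ts tx) (insep n k W s x).
Proof.
move=> hs hx; apply: den_has => // i e t lt p d; lift p.
by apply: den_eq => //; apply: den_dig => //; lia.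
Qed.

Lemma den_bit env tm tx m x : den env tm m -> den env tx x -> x <= N ->
  den env (tbit tm tx) (bit m x).
Proof. by move=> hm hx xN; apply: den_eq => //; apply: den_get => //; apply: pow2. Qed.

Lemma bitmask_lt p : bitmask n p < 2 ^ n.
Proof. by apply: ltn_tab => i _; case: (p i). Qed.

Lemma den_mask env tp (p : nat -> bool) :
  (forall i env' t, i < n -> prefix env env' -> den env' t i -> den env' (tp t) (p i)) ->
  den env (tmask tp) (bitmask n p).
Proof.
move=> h; have lt := bitmask_lt p.
apply: den_tab => //; first exact: pow2.
exact: ltn_trans (pow2 n_N).
Qed.

Lemma den_adj env tz ty z y : den env tz z -> den env ty y -> y < n ->
  den env (tadj tz ty) (adj z y).
Proof.
move=> hz hy lt; rewrite -inp_adj //; apply: den_read; apply: den_add => //.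
exact: den_mul.
Qed.

Lemma den_reach_step env ts tm s m : den env ts s -> den env tm m ->
  den env (treach_step W ts tm) (reach_step n k W adj s m).
Proof.
move=> hs hm; apply: den_mask => y e t lt p d; lift p.
apply: den_and; first by apply: den_not; apply: den_insep.
apply: den_or; first by apply: den_bit => //; lia.
apply: den_has => // z e' t' lt' p' d'; lift p'.
by apply: den_and; [apply: den_bit => //; lia | apply: den_adj].
Qed.

Lemma den_reach env ts s : den env ts s -> den env (treach W ts) (reach n k W adj s).
Proof.
move=> hs.
apply: (den_iter size2 (f := fun i => iter i (reach_step n k W adj s) (reach0 n k W s))) => //.
- apply: den_mask => y e t lt p d; lift p.
  apply: den_and; first by apply: den_eq => //; apply: den_root.
  by apply: den_not; apply: den_insep.
- move=> i lt /=; apply: ltn_trans (pow2 n_N).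
  exact: bitmask_lt.
- by move=> i e t tx lt p d dx; lift p; apply: den_reach_step.
Qed.

Lemma den_conn env ts tx s x : den env ts s -> den env tx x -> x <= N ->
  den env (tconn W ts tx) (conn n k W adj s x).
Proof. by move=> hs hx xN; apply: den_bit => //; apply: den_reach. Qed.

Lemma dig_lt s i : dig n k s i < q.
Proof. exact: get_lt. Qed.

Lemma upd_lt s j u c v : u < q -> c < q -> v < q -> upd n k W s j u c v < nstates n k W.
Proof.
by move=> hu hc hv; apply: ltn_tab => i _; do 3!case: ifP => _ //; apply: dig_lt.
Qed.

Lemma start_lt v : v < q -> start n k W v < nstates n k W.
Proof.
move=> hv; apply: ltn_tab => i _; case: ifP => _; first by rewrite /radix; lia.
by case: ifP.
Qed.

Lemma den_upd env ts tj tu tc tv s j u c v : den env ts s -> den env tj j ->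
  den env tu u -> den env tc c -> den env tv v -> u < q -> c < q -> v < q ->
  den env (tupd W ts tj tu tc tv) (upd n k W s j u c v).
Proof.
move=> hs hj hu hc hv uq cq vq.
have SM : nstates n k W < M by apply: leq_ltn_trans NM.
apply: den_tab => //.
  by apply: ltn_trans SM; apply: upd_lt.
move=> i e t lt p d; lift p.
apply: den_if => [|_|_] //; first exact: den_eq.
apply: den_if => [|_|_] //; first by apply: den_eq => //; apply: den_add.
apply: den_if => [|_|_] //; first by apply: den_eq.
by apply: den_dig => //; lia.
Qed.

Lemma den_start env tv v : den env tv v -> v < q -> den env (tstart W tv) (start n k W v).
Proof.
move=> hv vq; have SM : nstates n k W < M by apply: leq_ltn_trans NM.
apply: den_tab => //; first by apply: ltn_trans SM; apply: start_lt.
move=> i e t lt p d; lift p.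
apply: den_if => [|_|_] //; first exact: den_lt.
by apply: den_if => [|_|_] //; apply: den_eq.
Qed.

Let n_q : n < q. Proof. by rewrite /radix; lia. Qed.
Let k_q : k < q. Proof. by rewrite /radix; lia. Qed.

Lemma den_entry env tT ts T s : den env tT T -> den env ts s -> s < nstates n k W ->
  den env (tentry tT ts) (entry n k T s).
Proof.
move=> hT hs lt; have sN : s <= N by apply: leq_trans (ltnW lt) states_N.
by apply: den_get => //; apply: powcap.
Qed.

Lemma den_is_least env ts tv s v : den env ts s -> den env tv v -> v <= N ->
  den env (tis_least W ts tv) (is_least n k W adj s v).
Proof.
move=> hs hv vN; apply: den_all => // y e t lt p d; lift p.
by apply: den_not; apply: den_conn => //; lia.
Qed.

Lemma entry_lt T s : entry n k T s < cap n k.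
Proof. exact: get_lt. Qed.

Lemma prod_cap (f : nat -> nat) j : (forall i, f i < cap n k) -> \prod_(i < j) f i <= cap n k ^ j.
Proof.
move=> h; rewrite -[X in _ ^ X]card_ord -prod_nat_const.
by apply: leq_prod => i _; apply: ltnW.
Qed.

Section TableCorrect.
Variables (P : nat -> nat -> bool) (tP : term -> term -> term) (envP : seq nat).
Hypothesis den_P : forall env tx tc x c, prefix envP env -> den env tx x -> den env tc c ->
  x < n -> den env (tP tx tc) (P x c).

Let Pmono (e e' : seq nat) : prefix e e' -> prefix envP e -> prefix envP e'.
Proof. by move=> h h'; apply: prefix_trans h. Qed.

Lemma den_allowed env ts tx tc s x c : prefix envP env -> den env ts s -> den env tx x -> den env tc c ->
  x < n -> den env (tallowed W tP ts tx tc) (allowed n k W adj P s x c).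
Proof.
move=> pe hs hx hc lt; apply: den_and; first exact: den_P.
apply: den_all => // j e t ltj p d; lift p.
apply: den_imp; first by apply: den_adj => //; apply: den_dig => //; lia.
apply: den_not; apply: den_eq => //; apply: den_dig => //; first exact: den_add.
by move: width_N; rewrite /width2; lia.
Qed.

Lemma den_valid env tT ts tu tv tj T s u v j : den env tT T -> den env ts s -> den env tu u ->
  den env tv v -> den env tj j -> u < n -> v < n -> j < W ->
  den env (tvalid W tT ts tu tv tj) (valid n k W adj T s u v j).
Proof.
move=> hT hs hu hv hj un vn jW; have un' := ltn_trans un n_q; have vn' := ltn_trans vn n_q.
apply: den_all => // c e t ltc p d; lift p; have cq := ltn_trans ltc k_q.
apply: den_and.
  apply: den_not; apply: den_eq => //; apply: den_entry => //; first exact: den_upd.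
  exact: upd_lt.
apply: den_all => // x e' t' ltx p' d'; lift p'.
apply: den_imp.
  by apply: den_conn => //; [apply: den_upd | lia].
by apply: den_not; apply: den_adj => //; apply: den_dig => //; lia.
Qed.

Lemma den_position env tT ts tu tv T s u v : den env tT T -> den env ts s -> den env tu u ->
  den env tv v -> u < n -> v < n ->
  den env (tposition W tT ts tu tv) (position n k W adj T s u v).
Proof.
move=> hT hs hu hv un vn; apply: den_find => // j e t lt p d; lift p.
exact: den_valid.
Qed.

Lemma den_good env tT ts tu T s u : den env tT T -> den env ts s -> den env tu u ->
  u < n -> den env (tgood W tT ts tu) (good_pivot n k W adj T s u).
Proof.
move=> hT hs hu un; apply: den_and; first by apply: den_conn => //; lia.
apply: den_all => // v e t lt p d; lift p.
apply: den_imp.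
  by apply: den_and; [apply: den_conn => //; lia | apply: den_not; apply: den_eq].
by apply: den_lt => //; apply: den_position.
Qed.

Lemma den_pivot env tT ts T s : den env tT T -> den env ts s ->
  den env (tpivot W tT ts) (pivot n k W adj T s).
Proof.
by move=> hT hs; apply: den_find => // u e t lt p d; lift p; apply: den_good.
Qed.

Lemma factor_lt T s u c v : factor n k W adj T s u c v < cap n k.
Proof.
rewrite /factor; case: ifP => _; last by lia.
by apply: leq_ltn_trans (leq_subr _ _) (entry_lt _ _).
Qed.

Lemma den_factor env tT ts tu tc tv T s u c v : den env tT T -> den env ts s -> den env tu u ->
  den env tc c -> den env tv v -> u < n -> c < k -> v < n ->
  den env (tfactor W tT ts tu tc tv) (factor n k W adj T s u c v).
Proof.
move=> hT hs hu hc hv un ck vn.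
have un' := ltn_trans un n_q; have vn' := ltn_trans vn n_q; have ck' := ltn_trans ck k_q.
have hp := den_position hT hs hu hv un vn.
have hup := den_upd hs hp hu hc hv un' ck' vn'.
apply: den_if => [|_|_] //.
  apply: den_and; last by apply: den_is_least => //; lia.
  by apply: den_and; [apply: den_conn => //; lia | apply: den_not; apply: den_eq].
by apply: den_sub => //; apply: den_entry => //; apply: upd_lt.
Qed.

Lemma value_sum_leq T s : \sum_(c < k) allowed n k W adj P s (pivot n k W adj T s) c *
  \prod_(v < n) factor n k W adj T s (pivot n k W adj T s) c v <= N * cap n k ^ n.
Proof.
apply: leq_trans (_ : k * cap n k ^ n <= _); last by rewrite leq_mul2r k_N orbT.
rewrite -[X in X * _]card_ord -sum_nat_const; apply: leq_sum => c _.
rewrite -[X in _ <= X]mul1n leq_mul ?leq_b1 //.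
by apply: prod_cap => v; apply: factor_lt.
Qed.

Lemma den_value env tT ts T s : prefix envP env -> den env tT T -> den env ts s ->
  den env (tvalue W tP tT ts) (value n k W adj P T s).
Proof.
move=> pe hT hs; have hp := den_pivot hT hs.
apply: den_if => [|hn|_] //; first exact: den_lt.
apply: den_add => //.
apply: (den_sum size2 (g := fun c => allowed n k W adj P s (pivot n k W adj T s) c *
  \prod_(v < n) factor n k W adj T s (pivot n k W adj T s) c v)) => //.
  apply: leq_ltn_trans (value_sum_leq _ _) _; apply: leq_ltn_trans cap_M.
  rewrite -mulnA leq_mul2l; apply/orP; right.
  apply: leq_trans (leq_pmulr _ _); first by nia.
  by rewrite expn_gt0 cap0.
move=> c e t lt p d; lift p; have pe' := Pmono p pe.
apply: den_mul; first exact: den_allowed.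
apply: (den_prod size2 (g := factor n k W adj T s (pivot n k W adj T s) c)) => //.
  move=> j jn; apply: leq_ltn_trans (prod_cap _ _) (powcap (leq_trans jn n_N)).
  by move=> v; apply: factor_lt.
by move=> v e' t' lt' p' d'; lift p'; apply: den_factor.
Qed.

(** At this point entries are not known to be counts and might exceed the base [cap n k], so the
    table is bounded by the shape of its defining formula alone. This bound is the origin of
    [cap_M]. *)
Lemma next_ltM T : next_table n k W adj P T < M.
Proof.
apply: leq_ltn_trans cap_M.
apply: leq_trans (_ : \sum_(i < nstates n k W) (N * cap n k ^ n + 1) * cap n k ^ N <= _).
  apply: leq_sum => i _; apply: leq_mul.
    by rewrite /value; case: ifP => _; rewrite ?leq_add2r ?value_sum_leq // leq0n.
  rewrite leq_exp2l; last by lia.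
  exact: leq_trans (ltnW (ltn_ord i)) states_N.
by rewrite sum_nat_const card_ord -mulnA leq_mul2r states_N orbT.
Qed.

Lemma den_table env : prefix envP env ->
  den env (ttable W tP tn) (dp_table n k W adj P n).
Proof.
move=> pe; apply: (den_iter size2 (f := dp_table n k W adj P)) => //.
  by move=> i lt; apply: next_ltM.
move=> i e t tx lt p d dx; lift p; have pe' := Pmono p pe.
have hS : den e (tnstates W) (nstates n k W).
  by apply: den_pow => //; apply: leq_ltn_trans NM.
apply: den_tab => //; first exact: powcap.
  exact: next_ltM.
move=> s e' t' lt' p' d'; lift p'; apply: den_value => //; exact: Pmono pe'.
Qed.

Let total_factor v :=
  if is_least n k W adj (start n k W v) v
  then entry n k (dp_table n k W adj P n) (start n k W v) - 1 else 1.

Let total_factor_lt v : total_factor v < cap n k.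
Proof.
rewrite /total_factor; case: ifP => _; last by lia.
by apply: leq_ltn_trans (leq_subr _ _) (entry_lt _ _).
Qed.

Lemma total_leq : total_count n k W adj P <= cap n k ^ n.
Proof. exact: (prod_cap (f := total_factor)). Qed.

Lemma den_total env : prefix envP env -> den env (ttotal W tP) (total_count n k W adj P).
Proof.
move=> pe; apply: (den_prod size2 (g := total_factor)) => //.
  move=> j jn; apply: leq_ltn_trans (powcap (leq_trans jn n_N)).
  exact: prod_cap.
move=> v e t lt p d; have vq := ltn_trans lt n_q.
have hs := den_start d vq.
apply: den_if => [|_|_] //; first by apply: den_is_least => //; lia.
apply: den_sub => //; apply: den_entry => //; last exact: start_lt.
by apply: den_table; apply: Pmono pe.
Qed.

End TableCorrect.

Lemma den_count env ta tv tc a v c : den env ta a -> den env tv v -> den env tc c ->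
  den env (tcount W ta tv tc) (count_prefix n k W adj a v c).
Proof.
move=> ha hv hc; apply: (den_total (envP := env)) (prefix_refl _).
move=> e tx tc' x c' p hx hc' xn; lift p.
apply: den_and; apply: den_imp => //; try exact: den_lt; try exact: den_eq.
by apply: den_eq => //; apply: den_dig => //; lia.
Qed.

Lemma den_rank env ta tv a v : den env ta a -> den env tv v -> v <= n ->
  den env (trank W ta tv) (rank n k W adj a v).
Proof.
move=> ha hv vn.
apply: (den_sum size2 (g := fun i => count_prefix n k W adj a i (dig n k a i))) => //; first exact: leq_trans n_N.
  apply: leq_ltn_trans cap_M.
  apply: leq_trans (_ : \sum_(i < v) cap n k ^ n <= _).
    by apply: leq_sum => i _; apply: total_leq.
  rewrite sum_nat_const card_ord -mulnA leq_mul //; first exact: leq_trans n_N.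
  apply: leq_trans (leq_pmulr _ _); first by nia.
  by rewrite expn_gt0 cap0.
move=> i e t lt p d; lift p; apply: den_count => //; apply: den_dig => //; lia.
Qed.

Lemma next_color_leq x a v : next_color n k W adj x a v <= k.
Proof.
exact: (sum_bool_leq (fun c => rank n k W adj a v + count_prefix n k W adj a v c.+1 <= x)).
Qed.

Lemma den_next_color env tx ta tv x a v : den env tx x -> den env ta a -> den env tv v -> v < n ->
  den env (tnext_color W tx ta tv) (next_color n k W adj x a v).
Proof.
move=> hx ha hv vn.
apply: (den_sum size2 (g := fun c => rank n k W adj a v + count_prefix n k W adj a v c.+1 <= x)) => //.
  exact: leq_ltn_trans (next_color_leq x a v) (leq_ltn_trans k_N NM).
move=> c e t lt p d; lift p; apply: den_leq => //; apply: den_add.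
  by apply: den_rank => //; apply: ltnW.
have := den_add d (@den_cst inp env0 e 1); rewrite addn1 => d1.
exact: den_count.
Qed.

Theorem den_unrank env tx x : den env tx x -> den env (tunrank W tx) (unrank n k W adj x).
Proof.
move=> hx; pose f i := iteri i (fun v a => a + next_color n k W adj x a v * q ^ v) 0.
have hf i : f i < q ^ i.
  elim: i => [|i IH]; first by rewrite expn0.
  have := next_color_leq x (f i) i; rewrite /f /= -/(f i) expnS.
  move: (next_color _ _ _ _ _ _ _) IH => y; rewrite /radix; nia.
apply: (den_iter size2 (f := f)) => //.
  by move=> i lt; apply: ltn_trans (hf _) (powq _); apply: leq_trans n_N.
move=> i e t ta lt p d da; lift p; apply: den_add => //; apply: den_mul.
  exact: den_next_color.
by apply: den_pow => //; [|apply: powq]; lia.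
Qed.

End ProgramCorrect.

(** * List colorings and components *)

Section Counting.
Variables (n k : nat) (adj : nat -> nat -> bool).
Hypothesis adj_sym : forall x y, adj x y = adj y x.
Hypothesis adj_lt : forall x y, adj x y -> y < n.

(** Separators are arbitrary predicates here because [extend B u] may have one vertex more than a
    state can hold. *)
Inductive reachable (B : pred nat) (x : nat) : nat -> Prop :=
  | Reach0 : x < n -> ~~ B x -> reachable B x x
  | ReachS y z : reachable B x y -> adj y z -> ~~ B z -> reachable B x z.

Lemma reachable_lt B x y : reachable B x y -> y < n.
Proof. by case=> // ? ? _ /adj_lt. Qed.

Lemma reachable_ltl B x y : reachable B x y -> x < n.
Proof. by elim. Qed.

Lemma reachableN B x y : reachable B x y -> ~~ B y.
Proof. by case. Qed.

Lemma reachableNl B x y : reachable B x y -> ~~ B x.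
Proof. by elim. Qed.

Lemma reachable_trans B x y z : reachable B x y -> reachable B y z -> reachable B x z.
Proof. by move=> hx; elim=> // z1 z2 _ h; apply: ReachS. Qed.

Lemma reachable_sym B x y : reachable B x y -> reachable B y x.
Proof.
elim=> [hx hB|y1 y2 h1 h2 a hB]; first exact: Reach0.
apply: reachable_trans h2; apply: (ReachS (y := y2)); first exact: Reach0 (adj_lt a) hB.
  by rewrite adj_sym.
exact: reachableN h1.
Qed.

Lemma reachable_sub (B B' : pred nat) x y :
  (forall z, B' z -> B z) -> reachable B x y -> reachable B' x y.
Proof.
move=> h; have hN z : ~~ B z -> ~~ B' z by apply: contra; apply: h.
elim=> [? ?|y1 y2 _ IH a /hN]; first by apply: Reach0 => //; apply: hN.
exact: ReachS IH a.
Qed.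

Definition extend (B : pred nat) u : pred nat := fun x => B x || (x == u).

Lemma reachable_extend B u x y : reachable (extend B u) x y -> reachable B x y.
Proof. by apply: reachable_sub => z hz; rewrite /extend hz. Qed.

(** On a path from [x] to [u], the vertex just before the first visit to [u] qualifies. *)
Lemma reachable_neighbor B x u : reachable B x u -> x != u ->
  exists2 y, reachable (extend B u) x y & adj y u.
Proof.
move=> h xu.
have hN z : ~~ B z -> z != u -> ~~ extend B u z by rewrite /extend negb_or => -> ->.
suff : forall y, reachable B x y -> reachable (extend B u) x y \/
    exists2 y, reachable (extend B u) x y & adj y u.
  case/(_ _ h) => // /reachableN.
  by rewrite /extend eqxx orbT.
move=> y; elim=> [? ?|y1 y2 _ [IH|IH] a hB]; last by right.
  by left; apply: Reach0 => //; apply: hN.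
have [e|ne] := eqVneq y2 u; first by rewrite e in a; right; exists y1.
by left; apply: ReachS IH a (hN _ hB ne).
Qed.

Section Conn.
Variables (W s : nat).
Local Notation insep := (insep n k W s).
Local Notation root := (root_of n k W s).

Lemma bit_bitmask p y : y < n -> bit (bitmask n p) y = p y.
Proof.
move=> lt; have hp j : j < n -> p j < 2 by case: (p j).
by rewrite /bit /bitmask (get_tab hp lt); case: (p y).
Qed.

(** That [n] rounds are enough is the fixpoint theorem for monotone operators on subsets of an
    [n]-element set. Putting the root into every image makes [reach0] the first iterate from the
    empty set. *)
Let F (X : {set 'I_n}) : {set 'I_n} := [set y : 'I_n |
  ~~ insep y && [|| y == root :> nat, y \in X | [exists z in X, adj z y]]].

Let F_mono : {homo F : X Y / X \subset Y}.
Proof.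
move=> X Y /subsetP h; apply/subsetP => y; rewrite !inE => /andP[-> /or3P[->|/h ->|]] //=.
  by rewrite orbT.
case/exists_inP => z /h hz a; apply/orP; right; apply/orP; right.
by apply/exists_inP; exists z.
Qed.

Let reach_iter i (y : 'I_n) :
  bit (iter i (reach_step n k W adj s) (reach0 n k W s)) y = (y \in iter i.+1 F set0).
Proof.
elim: i y => [|i IH] y.
  rewrite bit_bitmask //= inE in_set0 /= andbC; congr (_ && _).
  have -> : [exists z in @set0 'I_n, adj z y] = false.
    by apply/exists_inP => -[z]; rewrite inE.
  by rewrite orbF.
rewrite iterS [iter i.+2 _ _]iterS inE bit_bitmask //; case: (boolP (insep y)) => //= hy.
rewrite IH.
have -> : has (fun z => bit (iter i (reach_step n k W adj s) (reach0 n k W s)) z && adj z y)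
   (iota 0 n) = [exists z in iter i.+1 F set0, adj z y].
  apply/hasP/exists_inP => [[z]|[z hz a]].
    rewrite mem_iota add0n => /= lt /andP[h a].
    by exists (Ordinal lt) => //; rewrite -IH.
  by exists (z : nat); rewrite ?mem_iota ?add0n ?ltn_ord //= IH hz.
rewrite orbA; congr (_ || _).
by case: eqP => // e; rewrite iterS inE hy e eqxx.
Qed.

Lemma connP x : x < n -> reflect (reachable insep root x) (conn n k W adj s x).
Proof.
move=> lt; have -> : conn n k W adj s x = (Ordinal lt \in fixset F).
  rewrite /conn /reach -[x]/(val (Ordinal lt)) reach_iter iterS.
  have -> : iter n F set0 = fixset F by rewrite /fixset card_ord.
  by rewrite fixsetK.
apply: (iffP idP) => [|h].
  rewrite -[x]/(val (Ordinal lt)) /fixset; move: #|_| (Ordinal lt) => i.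
  elim: i => [|i IH] y; first by rewrite inE.
  rewrite iterS inE => /andP[hy /or3P[/eqP e|/IH //|/exists_inP[z /IH h a]]].
    by rewrite [val y]e; apply: Reach0; rewrite -e.
  exact: ReachS h a hy.
elim: h lt => [x0 hB|y z h1 IH a hB] lt.
  by rewrite -(fixsetK F_mono) inE hB eqxx.
rewrite -(fixsetK F_mono) inE hB /=; apply/orP; right; apply/orP; right.
by apply/exists_inP; exists (Ordinal (reachable_lt h1)).
Qed.

Lemma conn_reachable x : x < n -> conn n k W adj s x -> reachable insep root x.
Proof. by move=> h /(connP h). Qed.

Lemma reachable_conn x : reachable insep root x -> conn n k W adj s x.
Proof. by move=> h; apply/connP => //; apply: reachable_lt h. Qed.

End Conn.

(* The number of proper colorings of the subgraph induced by [s] in which the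
   color of [x] satisfies [A x]: coloring [x] with [c] amounts to removing [c]
   from the lists of the neighbors of [x]. *)
Definition remove_color (A : nat -> nat -> bool) x c y d :=
  A y d && ~~ (adj x y && (d == c)).

Fixpoint colorings (s : seq nat) (A : nat -> nat -> bool) : nat :=
  if s is x :: s' then \sum_(c < k) A x c * colorings s' (remove_color A x c) else 1.

Lemma eq_colorings s A A' :
  (forall x, x \in s -> A x =1 A' x) -> colorings s A = colorings s A'.
Proof.
elim: s A A' => //= x s IH A A' h; apply: eq_bigr => c _.
rewrite h ?mem_head //; congr (_ * _); apply: IH => y hy d.
by rewrite /remove_color h // inE hy orbT.
Qed.

(** Both sides sum over pairs of colors, and the constraint between [x] and [y] is symmetric. Hence
    the order in which vertices are colored does not affect the count. *)
Lemma colorings_swap x y s A : colorings (x :: y :: s) A = colorings (y :: x :: s) A.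
Proof.
rewrite /=; under eq_bigr do rewrite big_distrr /=.
rewrite exchange_big /=; apply: eq_bigr => c _; rewrite big_distrr /=.
apply: eq_bigr => d _; rewrite !mulnA; congr (_ * _).
  rewrite /remove_color (adj_sym y x) (eq_sym (nat_of_ord d)).
  by rewrite -!mulnb; lia.
apply: eq_colorings => z _ f; rewrite /remove_color.
by rewrite -!andbA; congr (_ && _); rewrite andbC.
Qed.

Lemma colorings_rem x s A : x \in s -> colorings s A = colorings (x :: rem x s) A.
Proof.
elim: s A => //= y s IH A; rewrite inE eq_sym; case: eqP => [<-//|_] /= xs.
rewrite -[RHS]/(colorings (x :: y :: rem x s) A) colorings_swap /=.
by apply: eq_bigr => c _; rewrite IH.
Qed.

Lemma perm_colorings s s' A : perm_eq s s' -> colorings s A = colorings s' A.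
Proof.
elim: s s' A => [|x s IH] s' A h.
  by rewrite perm_sym in h; rewrite (perm_nilP h).
have xs : x \in s' by rewrite -(perm_mem h) mem_head.
rewrite (colorings_rem _ xs) /=; apply: eq_bigr => c _; congr (_ * _); apply: IH.
by rewrite -(perm_cons x) (perm_trans h) // perm_to_rem.
Qed.

Lemma colorings_cat s s' A : (forall x y, x \in s -> y \in s' -> ~~ adj x y) ->
  colorings (s ++ s') A = colorings s A * colorings s' A.
Proof.
elim: s A => [|x s IH] A h /=; first by rewrite mul1n.
rewrite big_distrl /=; apply: eq_bigr => c _; rewrite -mulnA; congr (_ * _).
rewrite IH; last by move=> y z hy hz; apply: h => //; rewrite inE hy orbT.
congr (_ * _); apply: eq_colorings => y hy d.
by rewrite /remove_color (negbTE (h x y (mem_head _ _) hy)) andbT.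
Qed.

Lemma colorings_leq s A : colorings s A <= k ^ size s.
Proof.
elim: s A => //= x s IH A; rewrite expnS.
rewrite -[X in X * _]card_ord -sum_nat_const; apply: leq_sum => c _.
by rewrite -[X in _ <= X]mul1n leq_mul ?leq_b1.
Qed.

(* Each component is represented by its least vertex. *)
Lemma colorings_components (D : pred nat) (K : rel nat) A :
  (forall x, x < n -> D x -> K x x) ->
  (forall x y, x < n -> y < n -> D x -> K x y -> D y /\ K y x) ->
  (forall x y z, x < n -> y < n -> z < n -> D x -> K x y -> K y z -> K x z) ->
  (forall x y, x < n -> y < n -> D x -> D y -> adj x y -> K x y) ->
  colorings [seq x <- iota 0 n | D x] A =
  \prod_(v < n) (if D v && all (fun y => ~~ K v y) (iota 0 v)
                 then colorings [seq x <- iota 0 n | K v x] A else 1).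
Proof.
move=> Krefl Ksym Ktrans Kadj.
(* [L i] is the union of the components whose least vertex is below [i]; passing to [i.+1] adds the
   component of [i] exactly when [i] is its least vertex. *)
pose L i := [seq x <- iota 0 n | D x && has (K x) (iota 0 i)].
have H i : i <= n -> colorings (L i) A =
  \prod_(v < i) (if D v && all (fun y => ~~ K v y) (iota 0 v)
                 then colorings [seq x <- iota 0 n | K v x] A else 1).
  elim: i => [|i IH] lt.
    by rewrite big_ord0 /L (eq_filter (a2 := pred0)) ?filter_pred0 // => x; rewrite andbF.
  rewrite big_ord_recr /= -IH; last exact: ltnW.
  have eqS x : has (K x) (iota 0 i.+1) = has (K x) (iota 0 i) || K x i.
    by rewrite -[i.+1]addn1 iotaD has_cat /= orbF.
  have [/andP[Di /allP least]|hno] := boolP (D i && _); last first.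
    rewrite muln1; congr colorings; apply: eq_in_filter => x.
    rewrite mem_iota add0n eqS => /= xn; case Dx : (D x) => //=.
    case hK : (K x i); rewrite ?orbF ?orbT //; apply/esym.
    have [Di _] := Ksym _ _ xn lt Dx hK.
    move: hno; rewrite Di /= -has_predC => /hasP[y].
    rewrite mem_iota add0n /= negbK => yi Ky.
    apply/hasP; exists y; first by rewrite mem_iota.
    by apply: Ktrans hK Ky => //; lia.
  have disj x y : x < n -> y < n -> D x -> K x y -> y < i -> K i x -> False.
    move=> xn yn Dx Kxy yi Kix; have := least y; rewrite mem_iota => /(_ yi) /negP; apply.
    exact: Ktrans Kix Kxy.
  rewrite -colorings_cat; last first.
    move=> x y; rewrite !mem_filter !mem_iota !add0n /= => /andP[/andP[Dx /hasP[z]]].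
    rewrite mem_iota add0n => /= zi Kxz xn /andP[Kiy yn]; apply/negP => a.
    have zn : z < n by lia.
    have [Dy Kyi] := Ksym _ _ lt yn Di Kiy.
    have Kxy := Kadj _ _ xn yn Dx Dy a.
    have [_ Kyx] := Ksym _ _ xn yn Dx Kxy.
    exact: (disj x z xn zn Dx Kxz zi (Ktrans _ _ _ lt yn xn Di Kiy Kyx)).
  apply: perm_colorings; apply: uniq_perm.
  - by rewrite filter_uniq ?iota_uniq.
  - rewrite cat_uniq !filter_uniq ?iota_uniq //= andbT; apply/hasPn => x.
    rewrite !mem_filter !mem_iota !add0n /= => /andP[Kix xn]; apply/negP => /andP[].
    case/andP => Dx /hasP[y]; rewrite mem_iota add0n => /= yi Kxy _.
    by apply: (disj x y xn _ Dx Kxy yi Kix); lia.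
  move=> x; rewrite mem_cat !mem_filter eqS !mem_iota !add0n /=.
  case xn : (x < n); rewrite ?andbF ?andbT //.
  apply/andP/orP => [[Dx /orP[h|h]]|[/andP[-> ->]//|h]].
  - by left; rewrite Dx h.
  - by right; have [] := Ksym _ _ xn lt Dx h.
  - by have [-> ->] := Ksym _ _ lt xn Di h; rewrite orbT.
rewrite -H //; congr colorings; apply: eq_in_filter => x.
rewrite mem_iota add0n => /= xn; case Dx : (D x) => //=; apply/esym/hasP.
by exists x; rewrite ?mem_iota //; apply: Krefl.
Qed.

End Counting.

(** * Correctness of the dynamic program *)

Section Table.
Variables (n k W : nat) (adj : nat -> nat -> bool).
Hypothesis adj_sym : forall x y, adj x y = adj y x.
Hypothesis adj_lt : forall x y, adj x y -> y < n.

Local Notation dig := (dig n k).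
Local Notation insep := (insep n k W).
Local Notation root_of := (root_of n k W).
Local Notation conn := (conn n k W adj).
Local Notation upd := (upd n k W).
Local Notation start := (start n k W).
Local Notation nstates := (nstates n k W).
Local Notation reachable := (reachable n adj).
Local Notation colorings := (colorings k adj).
Local Notation entry := (entry n k).
Local Notation q := (radix n k).

Let n_q : n < q. Proof. by rewrite /radix; lia. Qed.
Let k_q : k < q. Proof. by rewrite /radix; lia. Qed.
Let q0 : 0 < q. Proof. by rewrite /radix; lia. Qed.

Lemma cap_gt s A : size s <= n -> colorings s A + 1 < cap n k.
Proof.
move=> h; have : k ^ size s <= 2 ^ (n * k).
  apply: leq_trans (_ : (2 ^ k) ^ size s <= _).
    have [->|s0] := posnP (size s); first by rewrite !expn0.
    by rewrite leq_exp2r //; apply: ltnW; apply: ltn_expl.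
  by rewrite -expnM leq_exp2l // mulnC leq_mul2r h orbT.
have := colorings_leq k adj s A; rewrite /cap expnD.
have : 0 < 2 ^ (n * k) by rewrite expn_gt0.
by move: (2 ^ (n * k)) (k ^ size s) (colorings s A) => x y z; lia.
Qed.

Section Update.
Variables (s j u c v : nat).
Hypotheses (jW : j < W) (un : u < n) (ck : c < k) (vn : v < n).

Let dig_upd i : i < width2 W -> dig (upd s j u c v) i =
  if i == j then u else if i == W + j then c else if i == W + W then v else dig s i.
Proof.
move=> h; rewrite /dig get_tab //.
have uq := ltn_trans un n_q; have vq := ltn_trans vn n_q; have cq := ltn_trans ck k_q.
by move=> x _; do 3!case: ifP => _ //; apply: get_lt.
Qed.

Lemma root_upd : root_of (upd s j u c v) = v.
Proof.
rewrite /root_of dig_upd ?eqxx /width2 ?addn1 //.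
by rewrite !ifF //; lia.
Qed.

Lemma sep_upd i : i < W -> dig (upd s j u c v) i = if i == j then u else dig s i.
Proof.
move=> h; rewrite dig_upd /width2; last by lia.
by case: ifP => // _; rewrite !ifF //; lia.
Qed.

Lemma color_upd i : i < W -> dig (upd s j u c v) (W + i) = if i == j then c else dig s (W + i).
Proof.
move=> h; rewrite dig_upd /width2; last by lia.
by rewrite ifF ?eqn_add2l; [case: ifP => // _; rewrite ifF //|]; lia.
Qed.

Lemma insep_upd x : insep (upd s j u c v) x -> extend (insep s) u x.
Proof.
case/hasP => i; rewrite mem_iota add0n => /= iW; rewrite sep_upd // /extend.
case: ifP => _ /eqP <-; first by rewrite eqxx orbT.
by apply/orP; left; apply/hasP; exists i; rewrite ?mem_iota.
Qed.

Lemma insep_updN x : extend (insep s) u x -> ~~ insep (upd s j u c v) x -> x = dig s j.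
Proof.
move=> hx /hasPn hN.
have h i : i < W -> dig (upd s j u c v) i != x by move=> lt; apply: hN; rewrite mem_iota.
case/orP: hx => [/hasP[i]|/eqP e].
  rewrite mem_iota add0n => /= iW /eqP e; have := h _ iW; rewrite sep_upd // e.
  by case: (eqVneq i j) => [<-|_] //; rewrite eqxx.
by have := h _ jW; rewrite sep_upd // eqxx e eqxx.
Qed.

Hypothesis nonadj : forall x, reachable (extend (insep s) u) v x -> ~~ adj (dig s j) x.
Hypothesis v_out : ~~ extend (insep s) u v.

(** The component could grow only through the forgotten vertex, which has no neighbor in it. *)
Lemma reachable_upd x :
  reachable (insep (upd s j u c v)) v x <-> reachable (extend (insep s) u) v x.
Proof.
split; last by apply: reachable_sub => z; apply: insep_upd.
elim=> [? _|y z hy IH a hz]; first exact: Reach0.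
apply: (ReachS IH a); apply/negP => hz'.
have e := insep_updN hz' hz.
by have := nonadj IH; rewrite -e adj_sym a.
Qed.

Lemma conn_upd x : x < n ->
  reflect (reachable (extend (insep s) u) v x) (conn (upd s j u c v) x).
Proof.
move=> lt; apply: (iffP (connP k adj_lt W (upd s j u c v) lt)); rewrite root_upd.
  by move/reachable_upd.
by move=> h; apply/reachable_upd.
Qed.

(** Giving [c] to [u] removes [c] from the lists of the neighbors of [u]. The new content of
    position [j] expresses this constraint, and the constraint that it overwrites was void on this
    component. *)
Lemma allowed_upd P x d : reachable (extend (insep s) u) v x ->
  allowed n k W adj P (upd s j u c v) x d =
  remove_color adj (allowed n k W adj P s) u c x d.
Proof.
move=> hx; rewrite /remove_color /allowed -andbA; congr (_ && _).
have nj := nonadj hx.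
apply/allP/andP => [h|[/allP h1 h2] i]; last first.
  rewrite mem_iota add0n => /= iW; rewrite sep_upd // color_upd //.
  case: ifP => _; last by apply: h1; rewrite mem_iota.
  by move: h2; rewrite negb_and implybE eq_sym.
split; last first.
  have := h j; rewrite mem_iota => /(_ jW); rewrite sep_upd // color_upd // eqxx.
  by rewrite implybE negb_and eq_sym.
apply/allP => i; rewrite mem_iota add0n => /= iW.
have [->|ne] := eqVneq i j; first by rewrite (negbTE nj).
by have := h i; rewrite mem_iota => /(_ iW); rewrite sep_upd // color_upd // (negbTE ne).
Qed.

End Update.

Definition component s := [seq x <- iota 0 n | conn s x].
Definition answer P s := colorings (component s) (allowed n k W adj P s).

Lemma size_component s : size (component s) <= n.
Proof. by rewrite size_filter (leq_trans (count_size _ _)) ?size_iota. Qed.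

Lemma pivotP T s : pivot n k W adj T s < n -> good_pivot n k W adj T s (pivot n k W adj T s).
Proof.
rewrite /pivot; set p := good_pivot n k W adj T s => h.
have hp : has p (iota 0 n) by rewrite has_find size_iota.
by have := nth_find 0 hp; rewrite nth_iota.
Qed.

Lemma positionP T s u v : position n k W adj T s u v < W ->
  valid n k W adj T s u v (position n k W adj T s u v).
Proof.
rewrite /position; set p := valid n k W adj T s u v => h.
have hp : has p (iota 0 W) by rewrite has_find size_iota.
by have := nth_find 0 hp; rewrite nth_iota.
Qed.

(** * Every known entry is a correct count *)

Section Sound.
Variable P : nat -> nat -> bool.

(** Nothing is claimed about unknown entries, so this is preserved whichever pivot the program
    finds. *)
Definition sound T := forall s, s < nstates -> entry T s != 0 -> entry T s = answer P s + 1.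

Lemma upd_small s j u c v : u < n -> c < k -> v < n -> upd s j u c v < nstates.
Proof.
move=> hu hc hv.
have uq := ltn_trans hu n_q; have vq := ltn_trans hv n_q; have cq := ltn_trans hc k_q.
by apply: ltn_tab => i _; do 3!case: ifP => _ //; apply: get_lt.
Qed.

Lemma value_sound T s : sound T -> value n k W adj P T s != 0 ->
  value n k W adj P T s = answer P s + 1.
Proof.
move=> hT; rewrite /value; case: ifP => // un _; congr (_ + _).
have /andP[su /allP hgood] := pivotP un; move: un su hgood; set u := pivot _ _ _ _ _ _.
move=> un su hgood.
have ru := conn_reachable adj_lt un su.
pose D x := conn s x && (x != u).
have DP x : x < n -> reflect (reachable (insep s) u x /\ x != u) (D x).
  move=> xn; apply: (iffP andP) => -[h1 h2]; split=> //.
    apply: reachable_trans (reachable_sym adj_sym adj_lt ru) _.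
    exact: conn_reachable.
  by apply: (reachable_conn adj_lt); apply: reachable_trans ru h1.
have D_ext x y : D x -> reachable (extend (insep s) u) x y -> D y.
  move=> Dx h; have xn := reachable_ltl h; have yn := reachable_lt adj_lt h.
  have /(DP _ xn)[h1 h2] := Dx; apply/(DP _ yn); split.
    exact: reachable_trans h1 (reachable_extend h).
  by apply: contraNneq (reachableN h) => ->; rewrite /extend eqxx orbT.
have Dout x : x < n -> D x -> ~~ extend (insep s) u x.
  by move=> xn /(DP _ xn)[h1 h2]; rewrite /extend negb_or h2 (reachableN h1).
pose j := position n k W adj T s u.
have hpos v : v < n -> D v -> j v < W /\ valid n k W adj T s u v (j v).
  move=> vn Dv; have := hgood v; rewrite mem_iota => /(_ vn) /implyP /(_ Dv) jW.
  by split=> //; apply: positionP.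
(* The component tested by [valid], around the separator after the replacement, contains the
   component around the separator with [u] added. *)
have hvalid v c x : v < n -> D v -> c < k -> reachable (extend (insep s) u) v x ->
    ~~ adj (dig s (j v)) x.
  move=> vn Dv ck h; have [jW /allP hv] := hpos v vn Dv.
  have := hv c; rewrite mem_iota => /(_ ck) /andP[_ /allP h2].
  have xn := reachable_lt adj_lt h.
  have := h2 x; rewrite mem_iota => /(_ xn) /implyP; apply.
  apply: (reachable_conn adj_lt); rewrite root_upd //.
  by apply: reachable_sub h => z; apply: insep_upd.
have perm : perm_eq (component s) (u :: [seq x <- iota 0 n | D x]).
  apply: uniq_perm; rewrite /= ?filter_uniq ?iota_uniq //.
    by rewrite mem_filter /D eqxx andbF.
  move=> x; rewrite inE !mem_filter mem_iota add0n /= /D.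
  by case: eqP => [->|_]; rewrite ?su ?un ?andbT //= andbF.
rewrite /answer (perm_colorings _ adj_sym _ perm) /=.
apply: eq_bigr => c _; congr (_ * _).
(* For [v] outside [D] the position [j v] need not be valid; this is why [colorings_components] asks
   for the properties of an equivalence only on [D]. *)
pose K v x := conn (upd s (j v) u c v) x.
have KP v x : v < n -> x < n -> D v -> reflect (reachable (extend (insep s) u) v x) (K v x).
  move=> vn xn Dv; have [jW _] := hpos v vn Dv; apply: conn_upd => //.
    by move=> y; apply: hvalid Dv (ltn_ord c).
  exact: Dout.
rewrite (colorings_components (K := K) k adj_sym).
- apply: eq_bigr => v _; have vn := ltn_ord v.
  rewrite /factor -/u; case: ifP => // /andP[Dv least].
  have [jW /allP hv] := hpos v vn Dv.
  have := hv c; rewrite mem_iota => /(_ (ltn_ord c)) /andP[he _].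
  rewrite hT //; last exact: upd_small.
  rewrite addnK /answer; apply: eq_colorings => x.
  rewrite mem_filter mem_iota add0n => /andP[/= Kx xn] d.
  apply: allowed_upd => //; first by move=> y; apply: hvalid Dv (ltn_ord c).
  exact/KP.
- by move=> x xn Dx; apply/KP => //; apply: Reach0 => //; apply: Dout.
- move=> x y xn yn Dx /(KP _ _ xn yn Dx) h; have Dy := D_ext _ _ Dx h; split=> //.
  by apply/KP => //; apply: reachable_sym.
- move=> x y z xn yn zn Dx /(KP _ _ xn yn Dx) h1; have Dy := D_ext _ _ Dx h1.
  by move=> /(KP _ _ yn zn Dy) h2; apply/KP => //; apply: reachable_trans h1 h2.
- move=> x y xn yn Dx Dy a; apply/KP => //.
  by apply: (ReachS _ a); [apply: Reach0 => //; apply: Dout | apply: Dout].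
Qed.

Lemma value_lt T s : sound T -> value n k W adj P T s < cap n k.
Proof.
move=> h; have [->|ne] := eqVneq (value n k W adj P T s) 0; first by rewrite expn_gt0.
by rewrite (value_sound h ne) cap_gt // size_component.
Qed.

Lemma entry_next T s : sound T -> s < nstates ->
  entry (next_table n k W adj P T) s = value n k W adj P T s.
Proof. by move=> h lt; rewrite /entry get_tab // => i _; apply: value_lt. Qed.

Lemma table_sound r : sound (dp_table n k W adj P r).
Proof.
elim: r => [|r IH] s lt; first by rewrite /dp_table /= /entry get0.
by rewrite entry_next //; apply: value_sound.
Qed.

End Sound.

(* If every connected set has at most [W] vertices around it among those that
   are at most as deep as the whole set, then a separator of size [W] suffices:
   the pivot is a vertex of least depth. *)
Definition shallow_separators (dep : nat -> nat) := forall B v u (Z : seq nat),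
  reachable B v u -> (forall x, reachable B v x -> dep u <= dep x) -> uniq Z ->
  (forall z, z \in Z -> [/\ ~ reachable B v z,
     (exists2 x, reachable B v x & adj z x) & dep z <= dep u]) ->
  size Z <= W.

(** * Every entry that is needed becomes known *)

Section Complete.
Variables (P : nat -> nat -> bool) (dep : nat -> nat).
Hypothesis dep_sep : shallow_separators dep.

Definition admissible s := [/\ s < nstates, root_of s < n, ~~ insep s (root_of s),
  (forall i i', i < W -> i' < W -> dig s i < n -> dig s i = dig s i' -> i = i')
  & (forall i x y, i < W -> reachable (insep s) (root_of s) x ->
       reachable (insep s) (root_of s) y -> adj (dig s i) y -> dep (dig s i) <= dep x)].

Lemma least_dep (p : pred nat) : has p (iota 0 n) ->
  exists u, [/\ u < n, p u & forall x, x < n -> p x -> dep u <= dep x].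
Proof.
move=> /hasP[x0]; rewrite mem_iota => /= xn px0.
have [u pu hu] := @arg_minnP _ (Ordinal xn) (fun x : 'I_n => p x) (fun x : 'I_n => dep x) px0.
exists u; split=> // x lt px; exact: (hu (Ordinal lt)).
Qed.

Lemma adj_ltl x y : adj x y -> x < n.
Proof. by rewrite adj_sym; apply: adj_lt. Qed.

(** Coloring a pivot leaves smaller components, so [r] rounds settle all admissible states whose
    component has at most [r] vertices. The proof exhibits a pivot of least depth that passes the
    test; the program may choose another one, which soundness covers. *)
Lemma table_complete r s : admissible s -> size (component s) <= r ->
  entry (dp_table n k W adj P r) s != 0.
Proof.
elim: r s => [|r IH] s [sS rn rB inj hdep].
  rewrite leqn0 size_eq0 => /eqP e0.
  have : root_of s \in component s.
    rewrite mem_filter mem_iota add0n rn !andbT; apply: (reachable_conn adj_lt).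
    exact: Reach0.
  by rewrite e0.
move=> hsize; rewrite [dp_table _ _ _ _ _ _]/(next_table n k W adj P (dp_table n k W adj P r)).
rewrite entry_next //; last exact: table_sound.
set T := dp_table _ _ _ _ _ _ in IH *.
rewrite /value; case: ifP; first by rewrite addn1.
move/negbT/negP; case; rewrite /pivot -[X in _ < X](size_iota 0 n) -has_find.
have [|u [un su umin]] := @least_dep (conn s).
  apply/hasP; exists (root_of s); rewrite ?mem_iota //.
  by apply: (reachable_conn adj_lt); apply: Reach0.
have ru := conn_reachable adj_lt un su.
apply/hasP; exists u; rewrite ?mem_iota // /good_pivot su.
apply/allP => v; rewrite mem_iota add0n => /= vn; apply/implyP => /andP[sv vu].
have rv := conn_reachable adj_lt vn sv.
have vout : ~~ extend (insep s) u v by rewrite /extend negb_or vu (reachableN rv).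
have Ksub x : reachable (extend (insep s) u) v x -> reachable (insep s) (root_of s) x.
  by move=> h; apply: reachable_trans rv (reachable_extend h).
rewrite /position -[X in _ < X](size_iota 0 W) -has_find.
(* otherwise [u] and the whole separator surround the component of [v] *)
have [j jW nonadj] : exists2 j, j < W &
    forall x, reachable (extend (insep s) u) v x -> ~~ adj (dig s j) x.
  pose K x := `[< reachable (extend (insep s) u) v x >].
  have [w [wn /asboolP Kw wmin]] : exists w, [/\ w < n, K w & forall x, x < n -> K x -> dep w <= dep x].
    apply: least_dep; apply/hasP; exists v; rewrite ?mem_iota //.
    by apply/asboolP; apply: Reach0.
  case: (pselect (exists2 j, j < W &
    forall x, reachable (extend (insep s) u) v x -> ~~ adj (dig s j) x)) => // hno.
  have hadj j : j < W -> exists2 x, reachable (extend (insep s) u) v x & adj (dig s j) x.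
    move=> jW; apply: contra_notP hno => hj; exists j => // x hx; apply/negP => a.
    by apply: hj; exists x.
  have diglt j : j < W -> dig s j < n by move=> /hadj[x _ /adj_ltl].
  suff : size (u :: [seq dig s j | j <- iota 0 W]) <= W by rewrite /= size_map size_iota ltnn.
  apply: (dep_sep (B := extend (insep s) u) (v := v) (u := w)) => //.
  - by move=> x Kx; apply: wmin; [exact: (reachable_lt adj_lt Kx) | apply/asboolP].
  - rewrite /= map_inj_in_uniq ?iota_uniq ?andbT; last first.
      by move=> i i'; rewrite !mem_iota /= => iW iW'; apply: inj => //; apply: diglt.
    apply/mapP => -[i]; rewrite mem_iota /= => iW e.
    have /negP := reachableN ru; apply; apply/hasP; exists i; rewrite ?mem_iota //.
    by rewrite e.
  - move=> z; rewrite inE => /orP[/eqP ->|/mapP[i]].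
      split; first by move/reachableN; rewrite /extend eqxx orbT.
        have [y h a] : exists2 y, reachable (extend (insep s) u) v y & adj y u.
          apply: reachable_neighbor => //.
          exact: reachable_trans (reachable_sym adj_sym adj_lt rv) ru.
        by exists y => //; rewrite adj_sym.
      by apply: umin => //; apply: (reachable_conn adj_lt); apply: Ksub.
    rewrite mem_iota /= => iW ->; have [x hx a] := hadj _ iW; split.
    + move/reachableN/negP; apply; apply/orP; left; apply/hasP.
      by exists i; rewrite ?mem_iota.
    + by exists x.
    + exact: hdep iW (Ksub _ Kw) (Ksub _ hx) a.
apply/hasP; exists j; rewrite ?mem_iota //; apply/allP => c; rewrite mem_iota add0n => /= ck.
have eK x : reachable (insep (upd s j u c v)) v x <-> reachable (extend (insep s) u) v x.
  exact: reachable_upd.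
apply/andP; split; last first.
  apply/allP => x; rewrite mem_iota add0n => /= xn; apply/implyP => h.
  by apply: nonadj; have := conn_reachable adj_lt xn h; rewrite root_upd // => /eK.
have rt := root_upd s jW un ck vn.
have u_out i : i < W -> dig s i != u.
  move=> iW; apply: contraNneq (reachableN ru) => e.
  by apply/hasP; exists i; rewrite ?mem_iota // e.
apply: IH.
  split; rewrite ?rt //.
  - exact: upd_small.
  - by apply: (reachableN (adj := adj) (n := n) (x := v)); apply/eK; apply: Reach0.
  - move=> i i' iW iW'; rewrite !sep_upd //.
    case: (eqVneq i j) => [->|_]; case: (eqVneq i' j) => [->|_] //.
    + by move=> _ e; have := u_out i' iW'; rewrite -e eqxx.
    + by move=> _ e; have := u_out i iW; rewrite e eqxx.
    + exact: inj.
  - move=> i x y iW /eK hx /eK hy; rewrite sep_upd //; case: eqP => _ a.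
      by apply: umin; [exact: (reachable_lt adj_lt hx) | apply: (reachable_conn adj_lt); apply: Ksub].
    exact: hdep iW (Ksub _ hx) (Ksub _ hy) a.
rewrite -ltnS; apply: leq_trans hsize.
apply: (@uniq_leq_size _ (u :: component (upd s j u c v))).
  rewrite /= filter_uniq ?iota_uniq // andbT mem_filter; apply/negP => /andP[h _].
  have := conn_reachable adj_lt un h; rewrite rt => /eK /reachableN.
  by rewrite /extend eqxx orbT.
move=> x; rewrite inE => /orP[/eqP ->|].
  by rewrite mem_filter su mem_iota.
rewrite !mem_filter mem_iota add0n => /andP[h /= xn]; rewrite xn andbT.
have := conn_reachable adj_lt xn h; rewrite rt => /eK hx.
by apply: (reachable_conn adj_lt); apply: Ksub.
Qed.

End Complete.

Section Total.
Variables (P : nat -> nat -> bool) (dep : nat -> nat).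
Hypothesis dep_sep : shallow_separators dep.

Let dig_start v i : v < n -> i < width2 W ->
  dig (start v) i = if i < W then n else if i == W + W then v else 0.
Proof.
move=> vn h; rewrite /dig get_tab // => x _.
by case: ifP => // _; case: ifP => // _; apply: ltn_trans vn n_q.
Qed.

Lemma root_start v : v < n -> root_of (start v) = v.
Proof.
by move=> vn; rewrite /root_of dig_start /width2 ?addn1 // eqxx ifF //; lia.
Qed.

Lemma sep_start v i : v < n -> i < W -> dig (start v) i = n.
Proof. by move=> vn h; rewrite dig_start ?h //; rewrite /width2; lia. Qed.

Lemma adj_out y : adj n y = false.
Proof. by apply/negP; rewrite adj_sym => /adj_lt; rewrite ltnn. Qed.

Lemma insep_start v x : v < n -> x < n -> insep (start v) x = false.
Proof.
move=> vn xn; apply/hasP => -[i]; rewrite mem_iota add0n => /= iW.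
by rewrite sep_start //; lia.
Qed.

Lemma start_small v : v < n -> start v < nstates.
Proof.
move=> vn; apply: ltn_tab => i _; case: ifP => // _; case: ifP => // _.
exact: ltn_trans vn n_q.
Qed.

Lemma start_admissible v : v < n -> admissible dep (start v).
Proof.
move=> vn; split; rewrite ?root_start ?insep_start ?start_small //.
- by move=> i i' iW _; rewrite sep_start // ltnn.
- by move=> i x y iW; rewrite sep_start // adj_out.
Qed.

Lemma reachable_start v x y : v < n ->
  reachable (insep (start v)) x y <-> reachable pred0 x y.
Proof.
move=> vn; split; first by apply: reachable_sub.
elim=> [xn _|z t _ IH a _]; first by apply: Reach0; rewrite ?insep_start.
by apply: (ReachS IH a); rewrite insep_start //; apply: adj_lt a.
Qed.

Lemma total_correct : total_count n k W adj P = colorings (iota 0 n) P.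
Proof.
pose K v x := conn (start v) x.
have KP v x : v < n -> x < n -> reflect (reachable pred0 v x) (K v x).
  move=> vn xn; apply: (iffP (connP k adj_lt W (start v) xn)); rewrite root_start //.
    by move/(reachable_start _ _ vn).
  by move=> h; apply/(reachable_start _ _ vn).
have -> : iota 0 n = [seq x <- iota 0 n | xpredT x] by rewrite filter_predT.
rewrite (colorings_components (K := K) k adj_sym).
- apply: eq_bigr => v _; have vn := ltn_ord v; rewrite /=.
  have -> : is_least n k W adj (start v) v = all (fun y => ~~ K v y) (iota 0 v) by [].
  case: ifP => // _; rewrite (table_sound (start_small vn)).
    rewrite addnK /answer; apply: eq_colorings => x; rewrite mem_filter mem_iota => /andP[_ /= xn] c.
    rewrite /allowed; set b := all _ _; suff -> : b by rewrite andbT.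
    by apply/allP => i; rewrite mem_iota add0n => /= iW; rewrite sep_start // adj_out.
  by apply: (table_complete P dep_sep (start_admissible vn)); apply: size_component.
- by move=> x xn _; apply/KP => //; apply: Reach0.
- by move=> x y xn yn _ /(KP _ _ xn yn) h; split=> //; apply/KP => //; apply: reachable_sym.
- move=> x y z xn yn zn _ /(KP _ _ xn yn) h1 /(KP _ _ yn zn) h2; apply/KP => //.
  exact: reachable_trans h1 h2.
- move=> x y xn yn _ _ a; apply/KP => //; apply: (ReachS _ a) => //.
  exact: Reach0.
Qed.

End Total.
End Table.

(** * Colorings of a graph *)

Section Enumeration.
Variables (k : nat) (adj : nat -> nat -> bool).
Local Notation colorings := (colorings k adj).

Fixpoint coloring_lists (s : seq nat) (A : nat -> nat -> bool) : seq (seq nat) :=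
  if s is x :: s' then
    [seq c :: l | c <- [seq c <- iota 0 k | A x c],
                  l <- coloring_lists s' (remove_color adj A x c)]
  else [:: [::]].

Lemma size_coloring_lists s A : size (coloring_lists s A) = colorings s A.
Proof.
elim: s A => //= x s IH A; rewrite size_allpairs_dep sumnE big_map big_filter.
rewrite big_mkcond -[in LHS](subn0 k) -/(index_iota 0 k) big_mkord.
by apply: eq_bigr => c _; rewrite IH; case: (A x c); rewrite ?mul1n.
Qed.

Lemma uniq_coloring_lists s A : uniq (coloring_lists s A).
Proof.
elim: s A => //= x s IH A; apply: allpairs_uniq_dep; rewrite ?filter_uniq ?iota_uniq //.
move=> [c l] [c' l'] _ _ /= h.
have ec : c = c' by case: h.
have el : l = l' by case: h.
by rewrite ec el.
Qed.

Fixpoint list_ok (s l : seq nat) (A : nat -> nat -> bool) : bool :=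
  match s, l with
  | [::], [::] => true
  | x :: s', c :: l' => [&& c < k, A x c & list_ok s' l' (remove_color adj A x c)]
  | _, _ => false
  end.

Lemma mem_coloring_lists s A l : (l \in coloring_lists s A) = list_ok s l A.
Proof.
elim: s A l => [|x s IH] A [|c l] //=.
  by apply/allpairsPdep => -[c [l [_ _]]].
apply/allpairsPdep/and3P => [[d [l' [h1 h2 [-> ->]]]]|[h1 h2 h3]].
  by move: h1; rewrite mem_filter mem_iota add0n => /andP[-> /= ->]; rewrite -IH.
by exists c, l; rewrite mem_filter mem_iota h1 h2 IH.
Qed.

Lemma list_okP s l (A : nat -> nat -> bool) : size l = size s -> reflect
  ((forall i, i < size s -> nth 0 l i < k /\ A (nth 0 s i) (nth 0 l i)) /\
   (forall i j, i < j < size s -> adj (nth 0 s i) (nth 0 s j) -> nth 0 l i != nth 0 l j))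
  (list_ok s l A).
Proof.
elim: s l A => [|x s IH] [|c l] A //= hs; first by apply: ReflectT; split=> // i j; rewrite ltn0 andbF.
apply: (iffP and3P) => [[h1 h2 /IH[|h3 h4]]|[h1 h2]].
- by case: hs.
- split=> [[|i] //= lt|[|i] [|j] //= lt].
  + by have [-> /andP[-> _]] := h3 i lt.
  + by move=> a; have [_ /andP[_]] := h3 j lt; rewrite a eq_sym.
  + exact: h4.
- have [h3 h4] := h1 0 isT; split=> //; apply/IH; first by case: hs.
  split=> [i lt|i j lt]; last exact: (h2 i.+1 j.+1).
  have [h5 h6] := h1 i.+1 lt; split=> //; rewrite /remove_color h6 /= negb_and.
  by case a : (adj _ _) => //=; have := h2 0 i.+1 lt a; rewrite eq_sym.
Qed.

End Enumeration.

(** Greedy coloring, with lists so that the induction goes through: when [x] is colored, a neighbor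
    loses at most one color and exactly one uncolored neighbor. *)
Lemma colorings_gt0 (k : nat) (adj : nat -> nat -> bool) s (A : nat -> nat -> bool) :
  uniq s -> (forall x y, adj x y = adj y x) ->
  (forall x, x \in s -> count (adj x) s < count (A x) (iota 0 k)) ->
  0 < colorings k adj s A.
Proof.
move=> + adj_sym; elim: s A => //= x s IH A /andP[xs us] h.
have : has (A x) (iota 0 k) by rewrite has_count; apply: leq_trans (h x (mem_head _ _)).
case/hasP => c; rewrite mem_iota => /= ck Axc.
rewrite (bigD1 (Ordinal ck)) //= Axc mul1n addn_gt0 IH // => y ys.
have := h y; rewrite inE ys orbT => /(_ isT) hy.
apply: leq_trans (_ : count (A y) (iota 0 k) - adj y x <= _); first by rewrite /= in hy; lia.
rewrite leq_subLR.
have -> : count (A y) (iota 0 k) =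
    count (fun d => A y d && (adj y x && (d == c))) (iota 0 k) +
    count (remove_color adj A x c y) (iota 0 k).
  elim: (iota 0 k) => //= d l ->; rewrite /remove_color (adj_sym x).
  by case: (A y d); case: (adj y x && (d == c)) => /=; lia.
rewrite leq_add2r; case: (adj y x) => /=.
  apply: leq_trans (_ : count (pred1 c) (iota 0 k) <= 1).
    by apply: sub_count => d /= /andP[].
  by rewrite count_uniq_mem ?iota_uniq // leq_b1.
by rewrite (eq_count (a2 := pred0)) ?count_pred0 // => d; rewrite andbF.
Qed.

Section Graph.
Variables (n : nat) (e : rel 'I_n).
Hypothesis e_sym : symmetric e.
Hypothesis e_irr : irreflexive e.

Definition nat_adj (x y : nat) : bool :=
  [exists u : 'I_n, exists v : 'I_n, [&& e u v, x == u & y == v]].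

Lemma nat_adjE (u v : 'I_n) : nat_adj u v = e u v.
Proof.
apply/existsP/idP => [[u' /existsP[v' /and3P[h /eqP e1 /eqP e2]]]|h].
  by rewrite (val_inj e1) (val_inj e2).
by exists u; apply/existsP; exists v; rewrite h !eqxx.
Qed.

Lemma nat_adj_sym x y : nat_adj x y = nat_adj y x.
Proof.
by apply/existsP/existsP => -[u /existsP[v /and3P[h1 h2 h3]]]; exists v;
  apply/existsP; exists u; rewrite e_sym h1 h2 h3.
Qed.

Lemma nat_adj_lt x y : nat_adj x y -> y < n.
Proof. by case/existsP=> u /existsP[v /and3P[_ _ /eqP ->]]. Qed.

Variable k : nat.
Local Notation col := (coloring e k).

Lemma coloringP (s : col) u v : e u v -> val s u != val s v.
Proof. by move=> h; have /forallP/(_ u)/forallP/(_ v)/implyP := valP s; apply. Qed.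

Lemma colorings_card A :
  colorings k nat_adj (iota 0 n) A = #|[set s : col | [forall x : 'I_n, A x (val s x)]]|.
Proof.
rewrite -size_coloring_lists cardE.
pose f (s : col) : seq nat := [seq val (val s x) | x <- enum 'I_n].
have size_f s : size (f s) = size (iota 0 n) by rewrite size_map size_enum_ord size_iota.
have nth_f s (x : 'I_n) : nth 0 (f s) x = val s x.
  by rewrite (nth_map x) ?size_enum_ord // nth_ord_enum.
have nth_f' s i (lt : i < n) : nth 0 (f s) i = val s (Ordinal lt) by rewrite -nth_f.
have f_inj : injective f.
  move=> s s' h; apply: val_inj; apply/ffunP => x; apply: val_inj.
  by apply: etrans (esym (nth_f s x)) _; rewrite h; apply: nth_f.
rewrite -(size_map f); apply: perm_size; apply: uniq_perm.
- exact: uniq_coloring_lists.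
- by rewrite map_inj_uniq ?enum_uniq.
move=> l; rewrite mem_coloring_lists; apply/idP/mapP => [h|[s]].
  have hsize : size l = n.
    move: h; rewrite -[in RHS](size_iota 0 n); move: (iota 0 n) A => t.
    by elim: t l => [|x t IH] [|c l] A //= /and3P[_ _ /IH ->].
  have hs : size l = size (iota 0 n) by rewrite size_iota.
  have /(list_okP _ _ _ hs)[h1 h2] := h; rewrite size_iota in h1 h2.
  have hk (x : 'I_n) : nth 0 l x < k by have [] := h1 x (ltn_ord x).
  pose s : {ffun 'I_n -> 'I_k} := [ffun x => Ordinal (hk x)].
  have sE (x : 'I_n) : s x = nth 0 l x :> nat by rewrite ffunE.
  have lts (u v : 'I_n) : u < v -> e u v -> s u != s v.
    move=> uv a; rewrite -val_eqE /= !sE.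
    have := h2 u v; rewrite uv ltn_ord => /(_ isT).
    by rewrite !nth_iota // !add0n nat_adjE; apply.
  have hp : proper_coloring e s.
    apply/forallP => u; apply/forallP => v; apply/implyP => a.
    have [uv|vu|/val_inj uv] := ltngtP u v.
    - exact: lts.
    - by rewrite eq_sym lts // e_sym.
    - by rewrite uv e_irr in a.
  exists (exist _ s hp : col).
    rewrite mem_enum inE; apply/forallP => x; rewrite /= sE.
    by have [_] := h1 x (ltn_ord x); rewrite nth_iota.
  apply: (@eq_from_nth _ 0) => [|i]; first by rewrite size_f size_iota.
  by rewrite hsize => lt; rewrite nth_f' /= sE.
rewrite mem_enum inE => /forallP hA ->; apply/(list_okP _ _ _ (size_f s)).
rewrite size_iota; split=> [i lt|i j /andP[ij jn]].
  by rewrite nth_iota // nth_f'; split; [apply: ltn_ord | apply: (hA (Ordinal lt))].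
have lt := ltn_trans ij jn; rewrite !nth_iota // !add0n !nth_f'.
rewrite -[i in nat_adj i]/(val (Ordinal lt)) -[j in nat_adj _ j]/(val (Ordinal jn)) nat_adjE.
by move=> a; have := coloringP s a; rewrite -val_eqE.
Qed.

Lemma coloring_exists : max_degree e < k -> 0 < #|col|.
Proof.
move=> hd; have -> : #|col| = #|[set s : col | [forall x : 'I_n, (fun _ _ => true) (val x) (val (val s x))]]|.
  by apply: eq_card => s; rewrite !inE; apply/esym/forallP.
rewrite -(colorings_card (fun _ _ => true)).
apply: colorings_gt0 (iota_uniq _ _) nat_adj_sym _ => // x; rewrite mem_iota => /= xn.
rewrite count_predT size_iota; apply: leq_ltn_trans hd.
apply: leq_trans (leq_bigmax (Ordinal xn)).
rewrite -size_filter cardE -(size_map val); apply: uniq_leq_size.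
  by rewrite filter_uniq ?iota_uniq.
move=> y; rewrite mem_filter mem_iota => /andP[a /= yn].
apply/mapP; exists (Ordinal yn) => //; rewrite mem_enum inE.
by rewrite -nat_adjE.
Qed.

End Graph.

(** * Unranking *)

Lemma get_add_low b x c v i : i < v -> get b (x + c * b ^ v) i = get b x i.
Proof.
case: b => [|b] iv; first by rewrite exp0n ?muln0 ?addn0; [|lia].
have -> : c * b.+1 ^ v = c * b.+1 ^ (v - i).-1 * b.+1 * b.+1 ^ i.
  by rewrite -!mulnA -expnS -expnD; congr (_ * _ ^ _); lia.
by rewrite /get addnC divnMDl ?expn_gt0 // modnMDl.
Qed.

Lemma get_add_high b x c v : x < b ^ v -> c < b -> get b (x + c * b ^ v) v = c.
Proof.
move=> hx hc; rewrite /get addnC divnMDl; last by case: (b ^ v) hx.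
by rewrite divn_small // addn0 modn_small.
Qed.

Section Unrank.
Variables (n : nat) (e : rel 'I_n) (k W : nat) (dep : nat -> nat).
Hypothesis e_sym : symmetric e.
Hypothesis e_irr : irreflexive e.
Hypothesis dep_sep : shallow_separators n W (nat_adj e) dep.
Hypothesis k_gt0 : 0 < k.

Local Notation col := (coloring e k).
Local Notation adj := (nat_adj e).
Local Notation dig := (dig n k).
Local Notation q := (radix n k).
Local Notation count_prefix := (count_prefix n k W adj).
Local Notation rank := (rank n k W adj).
Local Notation next_color := (next_color n k W adj).

Definition extends a v (s : col) := [forall x : 'I_n, (x < v) ==> (val s x == dig a x :> nat)].

Lemma extendsP a v s :
  reflect (forall x : 'I_n, x < v -> val (s : col) x = dig a x :> nat) (extends a v s).
Proof.
apply: (iffP forallP) => h x; first by move=> lt; apply/eqP; apply: (implyP (h x)).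
by apply/implyP => lt; apply/eqP; apply: h.
Qed.

Lemma count_prefixE a (v : 'I_n) c :
  count_prefix a v c = #|[set s : col | extends a v s & val s v < c]|.
Proof.
rewrite /count_prefix.
rewrite (total_correct _ (nat_adj_sym e_sym) (@nat_adj_lt _ e) _ dep_sep).
rewrite (colorings_card e_sym e_irr); apply: eq_card => s; rewrite !inE.
apply/forallP/andP => [h|[/extendsP h1 h2] x].
  split; last by have /andP[_] := h v; rewrite eqxx.
  by apply/extendsP => x lt; have /andP[/implyP/(_ lt)/eqP] := h x.
apply/andP; split; apply/implyP; first by move=> lt; apply/eqP/h1.
by move/eqP/val_inj ->.
Qed.

Lemma extends_eq a a' v : (forall i, i < v -> dig a i = dig a' i) -> extends a v =1 extends a' v.
Proof.
by move=> h s; apply/extendsP/extendsP => H x lt; rewrite H // h.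
Qed.

Lemma count_prefix_eq a a' (v : 'I_n) c : (forall i, i < v -> dig a i = dig a' i) ->
  count_prefix a v c = count_prefix a' v c.
Proof.
by move=> h; rewrite !count_prefixE; apply: eq_card => s; rewrite !inE (extends_eq h).
Qed.

Lemma rank_eq a a' v : v <= n -> (forall i, i < v -> dig a i = dig a' i) -> rank a v = rank a' v.
Proof.
move=> vn h; apply: eq_bigr => i _; have lt := ltn_ord i.
have lt' : i < n by exact: leq_trans vn.
rewrite h // -[nat_of_ord i]/(nat_of_ord (Ordinal lt')); apply: count_prefix_eq => j ji.
by apply: h; exact: ltn_trans ji _.
Qed.

(** For a downward closed predicate, the number of indices that satisfy it is the first index that
    fails. *)
Lemma count_bool_first (p : nat -> bool) : ~~ p k.-1 ->
  (forall i j, i <= j -> p j -> p i) ->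
  let c := \sum_(i < k) p i in [/\ c < k, ~~ p c & forall i, i < c -> p i].
Proof.
move=> hp hmono; have h j : j <= k -> (\sum_(i < j) p i <= j) /\
    (p j.-1 -> \sum_(i < j) p i = j) /\ (\sum_(i < j) p i < j -> ~~ p (\sum_(i < j) p i)) /\
    forall i, i < \sum_(i < j) p i -> p i.
  elim: j => [|j IH] jk; first by rewrite big_ord0.
  have [h1 [h2 [h3 h4]]] := IH (ltnW jk).
  rewrite big_ord_recr /=; case pj : (p j) => /=; rewrite ?addn1 ?addn0.
    have e1 : \sum_(i < j) p i = j.
      case: (posnP j) => [->|j0]; first by rewrite big_ord0.
      by apply: h2; apply: hmono pj; lia.
    rewrite e1; do !split=> //; first by rewrite ltnn.
    by move=> i; rewrite ltnS => ij; apply: hmono ij pj.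
  do !split=> //; first exact: leqW.
  move=> _; case: (ltngtP (\sum_(i < j) p i) j) h1 => // [/h3 //|->] _.
  by rewrite pj.
have [h1 [h2 [h3 h4]]] := h k (leqnn k).
have lt : \sum_(i < k) p i < k.
  rewrite ltn_neqAle h1 andbT; apply: contraNneq hp => e1; apply: h4; rewrite e1; lia.
by split=> //; apply: h3.
Qed.

Definition prefix_code x v := iteri v (fun v a => a + next_color x a v * q ^ v) 0.

Lemma prefix_code_lt x v : prefix_code x v < q ^ v.
Proof.
elim: v => [|v IH]; first by rewrite expn0.
have -> : prefix_code x v.+1 =
  prefix_code x v + next_color x (prefix_code x v) v * q ^ v by [].
have := next_color_leq n k W adj x (prefix_code x v) v; rewrite expnS.
by set c := next_color _ _ _; move: (q ^ v) IH c => Q; rewrite /radix; nia.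
Qed.

Lemma prefix_code_dig x v i : i < v -> dig (prefix_code x v.+1) i = dig (prefix_code x v) i.
Proof. exact: get_add_low. Qed.

Lemma next_color_lt x a v : next_color x a v < q.
Proof. by apply: leq_ltn_trans (next_color_leq _ _ _ _ _ _ _) _; rewrite /radix; lia. Qed.

Lemma prefix_code_last x v : dig (prefix_code x v.+1) v = next_color x (prefix_code x v) v.
Proof. exact: get_add_high (prefix_code_lt x v) (next_color_lt _ _ _). Qed.

(** Colorings with a common prefix occupy an interval of the lexicographic order that starts at
    [rank]. The invariant is that [x] stays in this interval; choosing the next color selects the
    subinterval that contains [x]. *)
Lemma unrank_range x v : v <= n -> x < #|col| ->
  let a := prefix_code x v in
  rank a v <= x < rank a v + #|[set s : col | extends a v s]|.
Proof.
move=> + hx; elim: v => [|v IH] vn /=.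
  rewrite /rank big_ord0 leq0n add0n; apply: leq_trans hx _.
  by rewrite -cardsT; apply: subset_leq_card; apply/subsetP => s _; rewrite inE; apply/extendsP.
have := IH (ltnW vn); set a := prefix_code x v => /andP[h1 h2].
pose v' := Ordinal vn.
set c := next_color x a v.
have cE d : count_prefix a v d = #|[set s : col | extends a v s & val s v' < d]|.
  exact: (count_prefixE a v').
have [ck hc1 hc2] : [/\ c < k, ~~ (rank a v + count_prefix a v c.+1 <= x) &
    forall i, i < c -> rank a v + count_prefix a v i.+1 <= x].
  apply: (count_bool_first (p := fun i => rank a v + count_prefix a v i.+1 <= x)).
    rewrite -ltnNge prednK // cE; apply: leq_trans h2 _; rewrite leq_add2l.
    by apply: subset_leq_card; apply/subsetP => s; rewrite !inE => ->; rewrite ltn_ord.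
  move=> i j ij; apply: leq_trans; rewrite leq_add2l !cE; apply: subset_leq_card.
  apply/subsetP => s; rewrite !inE => /andP[-> /=] lt.
  exact: leq_trans lt _.
have agree i : i < v -> dig (prefix_code x v.+1) i = dig a i by apply: prefix_code_dig.
have lastE : dig (prefix_code x v.+1) v = c by apply: prefix_code_last.
have -> : rank (prefix_code x v.+1) v.+1 = rank a v + count_prefix a v c.
  rewrite {1}/rank big_ord_recr /= lastE; congr (_ + _).
    exact: rank_eq (ltnW vn) agree.
  exact: (count_prefix_eq (v := v')).
have -> : #|[set s : col | extends (prefix_code x v.+1) v.+1 s]| =
    count_prefix a v c.+1 - count_prefix a v c.
  rewrite !cE.
  have -> : [set s : col | extends a v s & val s v' < c.+1] =
     [set s : col | extends a v s & val s v' < c] :|: [set s | extends (prefix_code x v.+1) v.+1 s].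
    apply/setP => s; rewrite !inE ltnS leq_eqVlt.
    apply/andP/orP => [[hs /orP[/eqP ev|lt]]|[/andP[-> ->]|/extendsP hs]].
    - right; apply/extendsP => y; rewrite ltnS leq_eqVlt => /orP[/eqP yv|lt].
        have -> : y = v' by apply: val_inj.
        by rewrite ev /= lastE.
      by rewrite agree //; apply/extendsP: lt.
    - by left; rewrite hs lt.
    - by rewrite orbT.
    - rewrite (hs v') /= ?lastE ?eqxx //; split=> //; apply/extendsP => y lt.
      by rewrite hs ?agree // leqW.
  rewrite cardsU disjoint_setI0 ?cards0 ?subn0 ?addKn //.
  apply/pred0P => s; rewrite /= !inE; apply/negP => /andP[/andP[_ lt] /extendsP hs].
  by move: lt; rewrite (hs v') //= lastE ltnn.
have le : count_prefix a v c <= count_prefix a v c.+1.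
  rewrite !cE; apply: subset_leq_card; apply/subsetP => s; rewrite !inE => /andP[-> h] /=.
  exact: leqW.
rewrite -addnA subnKC // ltnNge hc1 andbT.
case: (posnP c) => [->|c0]; last by have := hc2 c.-1; rewrite prednK //; apply.
by rewrite cE (eq_card (B := pred0)) ?card0 ?addn0 // => s; rewrite !inE andbF.
Qed.

Lemma unrank_inj : exists g : 'I_#|col| -> col, injective g /\
  forall (i : 'I_#|col|) (x : 'I_n), dig (unrank n k W adj i) x = val (g i) x.
Proof.
have H (i : 'I_#|col|) : exists s : col, extends (unrank n k W adj i) n s.
  have := unrank_range (leqnn n) (ltn_ord i).
  rewrite -[prefix_code i n]/(unrank n k W adj i) => /andP[h1 h2].
  have /card_gt0P[s] : 0 < #|[set s : col | extends (unrank n k W adj i) n s]| by lia.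
  by rewrite inE; exists s.
exists (fun i => xchoose (H i)); split=> [i j|i x]; last first.
  by have /extendsP -> := xchooseP (H i).
move=> hij; apply: val_inj.
(* A full prefix leaves an interval of length one, so the input is recovered as the rank of the
   output. Injectivity follows. *)
have rankE (l : 'I_#|col|) : val l = rank (unrank n k W adj l) n.
  have := unrank_range (leqnn n) (ltn_ord l).
  rewrite -[prefix_code l n]/(unrank n k W adj l) => /andP[h1 h2].
  suff h3 : #|[set s : col | extends (unrank n k W adj l) n s]| <= 1.
    by apply/eqP; rewrite eqn_leq h1 andbT -ltnS (leq_trans h2) // -addn1 leq_add2l.
  apply/card_le1_eqP => s s'; rewrite !inE => /extendsP hs /extendsP hs'.
  apply: val_inj; apply/ffunP => x; apply: val_inj; rewrite /=.
  by have := hs x (ltn_ord x); have := hs' x (ltn_ord x) => -> ->.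
apply: etrans (rankE i) (etrans _ (esym (rankE j))); apply: rank_eq => // y yn.
have /extendsP/(_ (Ordinal yn) yn) <- := xchooseP (H i).
by have /extendsP/(_ (Ordinal yn) yn) <- := xchooseP (H j); rewrite hij.
Qed.

(** No vertex precedes vertex 0 and every color is below [k], so the prefix condition is void; this
    is how the program obtains [Z]. *)
Lemma count_all : 0 < n -> count_prefix 0 0 k = #|col|.
Proof.
move=> n0; rewrite -[X in count_prefix 0 X k]/(val (Ordinal n0)) count_prefixE -cardsT.
by apply: eq_card => s; rewrite !inE ltn_ord andbT; apply/extendsP.
Qed.

End Unrank.

(** * Shallow separators from a tree decomposition *)

Section RootedTree.
Variables (N : finType) (f : rel N).
Hypothesis treeN : is_tree f.

Let f_sym : symmetric f. Proof. by case: treeN => -[]. Qed.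
Let f_irr : irreflexive f. Proof. by case: treeN => -[]. Qed.

Let avoid x : rel N := [rel a b | [&& f a b, a != x & b != x]].

Let avoid_sym x : connect_sym (avoid x).
Proof. by apply: sym_connect_sym => a b; rewrite /avoid /= f_sym [(a != x) && _]andbC. Qed.

Let path_avoid x a p : path f a p -> x \notin a :: p -> path (avoid x) a p.
Proof.
elim: p a => //= b p IH a /andP[fab hp]; rewrite !inE !negb_or => /and3P[xa xb xp].
rewrite IH ?inE ?negb_or ?xb // andbT.
by rewrite /avoid /= fab (eq_sym a) xa (eq_sym b) xb.
Qed.

(** Otherwise a simple path between the two neighbors that avoids [x] closes up through [x] to a
    cycle of length at least 3. *)
Lemma neighbors_disconnected x y1 y2 :
  f x y1 -> f x y2 -> connect (avoid x) y1 y2 -> y1 = y2.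
Proof.
move=> h1 h2 /connectP[p0]; case/shortenP => p hp up _ e2.
apply/eqP; case: p => [|z p] in hp up e2 *; first by rewrite e2.
have [_ _ _ /(_ (x :: y1 :: z :: p))] := treeN.
have xp : x \notin y1 :: z :: p.
  have h a q : path (avoid x) a q -> a != x -> x \notin a :: q.
    elim: q a => [|b q IH] a; first by rewrite inE eq_sym.
    by move=> /= /andP[/and3P[_ _ bx] hq] ax; rewrite inE negb_or eq_sym ax IH.
  by apply: h => //; case/andP: hp => /and3P[].
have sub : path f y1 (z :: p).
  by apply: sub_path hp => a b /and3P[].
suff : ucycle f [:: x, y1, z & p] by move=> hc /(_ hc).
have u3 : uniq [:: x, y1, z & p] by rewrite cons_uniq xp up.
apply/andP; split=> //; rewrite -[cycle _ _]/(path f x (rcons [:: y1, z & p] x)).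
rewrite rcons_path -[path _ _ _]/(f x y1 && path f y1 (z :: p)) h1 sub /=.
by rewrite f_sym -[last z p]/(last y1 (z :: p)) -e2.
Qed.

(** [d] is the distance from an arbitrary root. A vertex has at most one neighbor that is not
    farther from the root than itself: two of them would be connected, through the root, without
    passing through the vertex. *)
Lemma tree_parent : exists (par : N -> N) (d : N -> nat),
  (forall x y, f x y -> par x = y \/ par y = x) /\
  (forall x, d (par x) = (d x).-1 /\ (d x = 0 -> par x = x)).
Proof.
have [_ /card_gt0P[rho _] conn _] := treeN.
pose P x m := `[< exists p, [/\ path f rho p, last rho p = x & size p = m] >].
have exP x : exists m, P x m.
  by have /connectP[p hp e] := conn rho x; exists (size p); apply/asboolP; exists p.
pose d x := ex_minn (exP x).
have dP x : exists2 p, path f rho p /\ last rho p = x & size p = d x.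
  by rewrite /d; case: ex_minnP => m /asboolP[p [h1 h2 h3]] _; exists p.
have dmin x p : path f rho p -> last rho p = x -> d x <= size p.
  by move=> h1 h2; rewrite /d; case: ex_minnP => m _; apply; apply/asboolP; exists p.
(* If a shortest path to [y] met [x], it would have to end there, because [x] is at least as far
   from the root. *)
clearbody d; have d_avoid x y : d y <= d x -> y != x -> connect (avoid x) rho y.
  move=> le ne; have [p [hp ep] sp] := dP y.
  apply/connectP; exists p => //; apply: path_avoid => //.
  apply: contra ne => xp; case/splitPl: xp hp ep sp => p1 p2 e1 hp ep sp.
  move: hp; rewrite cat_path => /andP[hp1 _]; have := dmin _ _ hp1 e1.
  rewrite size_cat in sp => h; have /size0nil p20 : size p2 = 0.
    by apply/eqP; rewrite -leqn0 -(leq_add2l (size p1)) sp addn0 (leq_trans le).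
  by rewrite -ep p20 cats0 e1.
have d_unique x y1 y2 : f x y1 -> f x y2 -> d y1 <= d x -> d y2 <= d x -> y1 = y2.
  move=> h1 h2 le1 le2; apply: (neighbors_disconnected h1 h2).
  have ne y : f x y -> y != x by move=> h; apply: contraTneq h => ->; rewrite f_irr.
  apply: connect_trans (d_avoid _ _ le2 (ne _ h2)).
  by rewrite avoid_sym; apply: d_avoid (ne _ h1).
have d0 x : d x = 0 -> x = rho.
  by have [p [_ <-] <-] := dP x => /size0nil ->.
have dS x : 0 < d x -> exists2 y, f x y & (d y).+1 = d x.
  have [p [hp ep] sp] := dP x => h.
  case/lastP: p hp ep sp => [|p z]; first by move=> _ _ /=; lia.
  rewrite rcons_path last_rcons size_rcons => /andP[hp hz] ez sp.
  exists (last rho p); first by rewrite f_sym -ez.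
  apply/eqP; rewrite eqn_leq -sp ltnS (dmin _ p) //=.
  have [p' [hp' ep'] sp'] := dP (last rho p).
  rewrite -sp' sp; apply: leq_trans (_ : size (rcons p' z) <= _).
    by apply: dmin; rewrite ?last_rcons // rcons_path hp' ep'.
  by rewrite size_rcons.
pose par x := odflt x [pick y | f x y && ((d y).+1 == d x)].
have parP x : 0 < d x -> f x (par x) /\ (d (par x)).+1 = d x.
  move=> /dS[y h1 h2]; rewrite /par; case: pickP => [z /andP[? /eqP ?] //|/(_ y)].
  by rewrite h1 h2 eqxx.
have par0 x : d x = 0 -> par x = x.
  by move=> h; rewrite /par; case: pickP => // z; rewrite h andbF.
exists par, d; split=> [x y fxy|x]; last first.
  by split; [case: (posnP (d x)) => [h|/parP[_ <-]] //; rewrite par0 ?h | apply: par0].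
wlog le : x y fxy / d y <= d x.
  move=> H; case: (leqP (d y) (d x)) => [|/ltnW]; first exact: H.
  by rewrite f_sym in fxy => /(H _ _ fxy) [->|->]; [right|left].
left; case: (posnP (d x)) => [h|/parP[h1 h2]].
  have ex := d0 _ h; have ey : y = rho by apply: d0; lia.
  by rewrite ex ey f_irr in fxy.
by apply: d_unique h1 fxy _ le; lia.
Qed.

End RootedTree.

Lemma treewidth_separators n (e : rel 'I_n) w : symmetric e -> treewidth e <= w ->
  exists dep, shallow_separators n w (nat_adj e) dep.
Proof.
move=> e_sym; rewrite /treewidth; case: ex_minnP => w' /asboolP[N [f [bag [[treeN cover edges conn] hw]]]] _ ww.
have [par [d [fpar dpar]]] := tree_parent treeN.
pose below a x := exists i, iter i par x = a.
have dist i x : d (iter i par x) = d x - i.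
  by elim: i => [|i IH]; rewrite ?subn0 //= (dpar _).1 IH; lia.
have fix0 i x : d x = 0 -> iter i par x = x.
  by move=> h; elim: i => //= i ->; apply: (dpar x).2.
have top_ex v : exists t, v \in bag t /\ forall s, v \in bag s -> d t <= d s.
  have [t0 ht0] := cover v; have [t ht hmin] := @arg_minnP _ t0 (fun t => v \in bag t) d ht0.
  by exists t.
have /choice[top topP] : forall v, exists t, v \in bag t /\ forall s, v \in bag s -> d t <= d s by [].
pose depth v := d (top v).
(* a connected set of nodes can only leave the subtree below [a] through [a] *)
have leave a v s t : v \in bag s -> v \in bag t -> below a s ->
    below a t \/ v \in bag a /\ depth v < d a.
  move=> vs vt hs; have /connectP[p hp ->] := conn v s t vs vt.
  have : below a s \/ v \in bag a /\ depth v < d a by left.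
  elim: p s {vs vt hs} hp => //= y p IH s /andP[/and3P[fsy vs vy] hp] h; apply: IH hp _.
  case: h => [[i hi]|]; last by right.
  have [e1|e1] := fpar _ _ fsy; last by left; exists i.+1; rewrite iterSr e1.
  case: i hi => [|i] hi; last by left; exists i; rewrite -e1 -iterSr.
  rewrite /= in hi; subst s y.
  have [d1 d2] := dpar a; case: (posnP (d a)) => [h0|h0].
    by left; exists 0; rewrite /= d2.
  right; split=> //; apply: leq_ltn_trans ((topP v).2 _ vy) _; lia.
pose dep x := if insub x is Some u then depth (u : 'I_n) else 0.
have depE (u : 'I_n) : dep u = depth u by rewrite /dep valK.
exists dep => B v0 u0 Z hu hmin uZ hZ.
have lt := @nat_adj_lt n e.
have adj_sym := nat_adj_sym e_sym.
have un := reachable_lt lt hu.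
pose u := Ordinal un; pose a := top u.
(* The connected set cannot leave the subtree below [a]: the vertex through which it leaves would
   have smaller depth than [u]. *)
have inside x (xn : x < n) : reachable n (nat_adj e) B u0 x ->
    forall t, Ordinal xn \in bag t -> below a t.
  move=> h; elim: h xn => [xn hB|y z hy IH yz hB] zn t.
    have -> : Ordinal zn = u by apply: val_inj.
    move=> ht; have below_a : below a (top u) by exists 0.
    by case: (leave a u _ t (topP u).1 ht below_a) => // -[_]; rewrite /depth ltnn.
  have yn := reachable_lt lt hy.
  have [s ys zs] : exists2 s, Ordinal yn \in bag s & Ordinal zn \in bag s.
    by apply: edges; rewrite -nat_adjE.
  move=> zt; case: (leave a _ s t zs zt (IH yn s ys)) => // -[_].
  rewrite -depE ltnNge; case/negP; rewrite -/(depth u) -depE; apply: hmin.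
  by apply: reachable_trans hu _; apply: ReachS hy yz hB.
have reach_u0 x : reachable n (nat_adj e) B v0 x -> reachable n (nat_adj e) B u0 x.
  by apply: reachable_trans; apply: reachable_sym.
have bag_u : u \in bag a := (topP u).1.
(* [z] shares a bag below [a] with a vertex of the set. Either the highest bag of [z] is below [a],
   and then it is [a] itself because [z] is not deeper than [u], or the way to that bag shows that
   [z] lies in the bag of [a]. *)
have inbag z (zn : z < n) : z \in Z -> Ordinal zn \in bag a :\ u.
  move=> /hZ[h1 [x hx zx] h3]; rewrite !inE; apply/andP; split.
    by apply: contra_notN h1 => /eqP[->].
  have xn := reachable_lt lt hx.
  have [s zs xs] : exists2 s, Ordinal zn \in bag s & Ordinal xn \in bag s.
    by apply: edges; rewrite -nat_adjE.
  have hs := inside x xn (reach_u0 _ hx) s xs.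
  have [ht hmin'] := topP (Ordinal zn).
  case: (leave a _ s _ zs ht hs) => [[i hi]|[]//].
  have hd := dist i (top (Ordinal zn)).
  have : d (top (Ordinal zn)) <= d a.
    by have := h3; rewrite -[z]/(nat_of_ord (Ordinal zn)) -[u0]/(nat_of_ord u) !depE.
  rewrite hi in hd => hle.
  suff <- : top (Ordinal zn) = a by [].
  (* The root is its own parent, so at depth 0 the depth says nothing about the number [i] of
     steps. *)
  case: (posnP (d (top (Ordinal zn)))) => [h0|h0]; first by rewrite -hi fix0.
  have i0 : i = 0 by lia.
  by rewrite -hi i0.
have Zn z : z \in Z -> z < n.
  by move=> /hZ[_ [x _ zx] _]; apply: lt; rewrite adj_sym; apply: zx.
have : size Z <= #|bag a :\ u|.
  rewrite cardE -(size_map val); apply: uniq_leq_size => // z hz.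
  apply/mapP; exists (Ordinal (Zn _ hz)) => //; rewrite mem_enum; exact: inbag.
have := cardsD1 u (bag a); rewrite bag_u.
have : #|bag a| <= \max_(t : N) #|bag t| by apply: leq_bigmax.
by move: ww; rewrite -hw /width; lia.
Qed.

(** * The sampling program *)

(** Expressions for the parts that terms cannot express: reading the other input channels, tossing
    coins and writing the output. *)
Inductive xp :=
  | XVar of nat
  | XCst of nat
  | XRead of nat & xp
  | XBin of binop & xp & xp.

Fixpoint code (x : xp) : expr :=
  match x with
  | XVar i => cell i
  | XCst c => Const c
  | XRead c a => Read c (code a)
  | XBin o a b => Bin o (code a) (code b)
  end.

Fixpoint xeval (inp : input) (env : seq nat) (x : xp) : nat :=
  match x with
  | XVar i => nth 0 env i
  | XCst c => c
  | XRead c a => inp c (xeval inp env a)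
  | XBin o a b => eval_binop o (xeval inp env a) (xeval inp env b)
  end.

Fixpoint xok (inp : input) Q (env : seq nat) (x : xp) : Prop :=
  match x with
  | XVar i => i < size env
  | XCst c => True
  | XRead c a => bit_length (inp c (xeval inp env a)) <= Q /\ xok inp Q env a
  | XBin o a b => xok inp Q env a /\ xok inp Q env b
  end.

Fixpoint xcost Q (x : xp) : nat :=
  match x with
  | XVar i => Q + cell_cost i Q
  | XCst c => c.+1
  | XRead c a => Q + xcost Q a
  | XBin o a b => xcost Q a + xcost Q b + (xcost Q a + xcost Q b)
  end.

Lemma poly_xcost x : poly_bounded (fun Q => xcost Q x).
Proof. by elim: x => /= [i|c|c a IH|o a IHa b IHb]; rewrite /cell_cost; poly. Qed.

Definition acost i x Q := (cell_cost i Q + xcost Q x).+1.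

Definition env_bits Q (env : seq nat) := forall i, bit_length (nth 0 env i) <= Q.

Lemma holds_take n s env d : holds n s env -> holds n s (take d env).
Proof.
move=> h i; rewrite size_take_min leq_min => /andP[id ie].
by rewrite nth_take // h.
Qed.

Section Steps.
Variables (inp : input) (n Q : nat).
Hypothesis hi : input_ok n inp.
Hypothesis nQ : bit_length n <= Q.

Lemma xevalP s env x : holds n s env -> env_bits Q env -> xok inp Q env x ->
  eval inp s (code x) = xeval inp env x /\ eval_cost inp s (code x) <= xcost Q x.
Proof.
move=> hh hb; elim: x => [i|c|c a IH|o a IHa b IHb].
- move=> lt; split; first by rewrite (eval_cell hi.1) hh.
  by apply: (cost_cell hi.1 nQ); rewrite hh.
- by move=> _; split=> //; apply: cost_const.
- move=> [h1 /IH[h2 h3]]; split; first by rewrite /= h2.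
  have -> : eval_cost inp s (Read c (code a)) =
    bit_length (inp c (eval inp s (code a))) + eval_cost inp s (code a) by [].
  by apply: leq_add; rewrite ?h2.
- move=> [/IHa[h1 h2] /IHb[h3 h4]]; split; first by rewrite /= h1 h3.
  exact: cost_bin.
Qed.

Lemma holds_set s env i v : i <= size env -> holds n s env ->
  holds n (update s (n + i) v) (set_nth 0 env i v).
Proof.
move=> lt hh j; rewrite size_set_nth nth_set_nth /update eqn_add2l /= => lj.
by case: eqP => // ne; apply: hh; lia.
Qed.

Lemma step_assign s env i x r : holds n s env -> env_bits Q env -> i <= size env ->
  xok inp Q env x ->
  exists s', [/\ runs inp (assign i (code x)) s r s' r (acost i x Q),
    holds n s' (set_nth 0 env i (xeval inp env x)) & forall a, a < n -> s' a = s a].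
Proof.
move=> hh hb lt hx; have [h1 h2] := xevalP hh hb hx.
exists (update s (n + i) (xeval inp env x)); split; last 1 first.
- by move=> a an; rewrite update_frame //; lia.
- rewrite -h1; apply: runs_leq (runs_assign hi.1 nQ r i h2) _.
  by rewrite /acost /cell_cost; lia.
- exact: holds_set.
Qed.

Lemma step_while x p (E : nat -> seq nat) (r : nat -> seq bool) K T s :
  (forall i, i <= K -> [/\ env_bits Q (E i), xok inp Q (E i) x &
     (xeval inp (E i) x != 0) = (i < K)]) ->
  (forall i s, i < K -> holds n s (E i) ->
     exists s', runs inp p s (r i) s' (r i.+1) T /\ holds n s' (E i.+1)) ->
  holds n s (E 0) ->
  exists s', runs inp (While (code x) p) s (r 0) s' (r K) (K.+1 * (xcost Q x + T).+1) /\
    holds n s' (E K).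
Proof.
move=> hx hp h0; pose I i s' r' := r' = r i /\ holds n s' (E i).
have [||s' [r' [h1 [h2 h3]]]] :=
  @runs_while inp (code x) p I K T (xcost Q x) s (r 0) _ _ (conj erefl h0).
- move=> i s' r' iK [_ hh]; have [h1 h2 h3] := hx i iK.
  by have [-> h5] := xevalP hh h1 h2.
- move=> i s' r' iK [-> hh]; have [s'' [h1 h2]] := hp i s' iK hh.
  by exists s'', (r i.+1).
by exists s'; rewrite -h2.
Qed.

End Steps.

Definition xadd := XBin Add.
Definition xsub := XBin Defs.Sub.
Definition xmul := XBin Mul.
Definition xdiv := XBin Div.
Definition xmod := XBin Mod.

Fixpoint xpow x d := if d is d'.+1 then xmul x (xpow x d') else XCst 1.

Lemma xeval_pow inp env x d : xeval inp env (xpow x d) = xeval inp env x ^ d.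
Proof. by elim: d => //= d ->; rewrite expnS. Qed.

Lemma xok_pow inp Q env x d : xok inp Q env x -> xok inp Q env (xpow x d).
Proof. by move=> h; elim: d. Qed.

Definition tmax_degree : term := titer tn (tcst 0) (fun u m =>
  tlet (tsum tn (fun v => tadj v u)) (fun d => tif (tlt m d) d m)).

(** The cap must reach both the number of states [radix ^ width2] and [n * k + 2]; two more factors
    [radix] suffice for the latter. *)
Definition loop_cap n k W := radix n k ^ (width2 W + 2).
(** With [N] the cap, [table_modulus] has two factors of about [N < 2 ^ N] and two powers of [cap]
    that are at most [2 ^ (N * N)]; the factor 5 leaves room for all of them. *)
Definition modulus_bits n k W := 5 * (loop_cap n k W * loop_cap n k W).
(** There are at most [2 ^ (n * k)] colorings, and [2 ^ - (i0 + 1)] is at most [delta] if [i0] is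
    the position of its first digit 1. *)
Definition num_flips n k i0 := i0 + 1 + n * k.

Definition xradix := xadd (xadd (XVar 2) (XVar 3)) (XCst 1).

(** The final modulus depends on [k], hence on the maximal degree. To compute that degree, the
    modulus [n + 2] and the cap [n] suffice. *)
Definition compute_colors kx :=
  assign 0 (code (XCst 0)) ;;
  assign 1 (code (XCst 0)) ;;
  assign 2 (code (XRead 0 (XCst 0))) ;;
  assign 1 (code (XVar 2)) ;;
  assign 0 (code (xadd (XVar 2) (XCst 2))) ;;
  compile 3 (tmax_degree 3) ;;
  assign 3 (code kx).

(** The first nonzero digit determines [delta] up to a factor 2, and the search for it takes about
    [log (1 / delta)] rounds. *)
Definition find_digit :=
  assign 4 (code (XCst 0)) ;;
  While (code (XBin Eq (XRead 2 (XVar 4)) (XCst 0)))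
    (assign 4 (code (xadd (XVar 4) (XCst 1)))).

Definition compute_caps W :=
  assign 4 (code (xadd (xadd (XVar 4) (XCst 1)) (xmul (XVar 2) (XVar 3)))) ;;
  assign 1 (code (xpow xradix (width2 W + 2))) ;;
  assign 5 (code (xmul (XCst 5) (xmul (XVar 1) (XVar 1)))) ;;
  assign 0 (code (XCst 1)) ;;
  While (code (XVar 5))
    (assign 0 (code (xadd (XVar 0) (XVar 0))) ;;
     assign 5 (code (xsub (XVar 5) (XCst 1)))).

Definition toss_coins :=
  assign 5 (code (XVar 4)) ;;
  assign 6 (code (XCst 0)) ;;
  While (code (XVar 5))
    (Flip (addr 7) ;;
     assign 6 (code (xadd (xadd (XVar 6) (XVar 6)) (XVar 7))) ;;
     assign 5 (code (xsub (XVar 5) (XCst 1)))).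

Definition tresult W : term :=
  tlet (tmod (tvar 6) (tcount W (tcst 0) (tcst 0) tk)) (tunrank W).

Definition output_colors :=
  assign 5 (code (XCst 0)) ;;
  While (code (xsub (XVar 2) (XVar 5)))
    (Store (cell 5) (code (xmod (XVar 7) xradix)) ;;
     assign 7 (code (xdiv (XVar 7) xradix)) ;;
     assign 5 (code (xadd (XVar 5) (XCst 1)))).

Definition sampler W kx :=
  compute_colors kx ;; find_digit ;; compute_caps W ;; toss_coins ;;
  compile 7 (tresult W 7) ;; output_colors.

Definition push_bit x (b : bool) := x + x + b.

Lemma holds_nil n s : holds n s [::].
Proof. by []. Qed.

Lemma bits_le x Q : x < Q -> bit_length x <= Q.
Proof. by move=> h; apply: leq_trans (bit_length_self x) h. Qed.

Lemma env_bits_cons Q x env : bit_length x <= Q -> env_bits Q env -> env_bits Q (x :: env).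
Proof. by move=> h1 h2 [|i] /=; [exact: h1 | exact: h2]. Qed.

Lemma env_bits_nil Q : 2 <= Q -> env_bits Q [::].
Proof. by move=> h i; rewrite nth_nil; apply: bits_le; lia. Qed.

Lemma push_bits_lt (l : seq bool) : foldl push_bit 0 l < 2 ^ size l.
Proof.
elim/last_ind: l => [//|l b IH]; rewrite foldl_rcons size_rcons expnS /push_bit.
by move: (foldl _ _ _) (2 ^ _) IH => x y; case: b => /=; lia.
Qed.

Lemma bits_pow i Q : i < Q -> bit_length (2 ^ i) <= Q.
Proof. by move=> h; rewrite bit_lengthP ?ltn_exp2l //; lia. Qed.

Section Segments.
Variables (inp : input) (n : nat) (e : rel 'I_n) (k i0 W Q : nat).
Hypothesis e_sym : symmetric e.
Hypothesis hi : input_ok n inp.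
Hypothesis inp_adj : forall x y, y < n -> inp 1 (x * n + y) = nat_adj e x y.
Hypothesis n_gt0 : 0 < n.
Hypothesis k_gt0 : 0 < k.

Let N := loop_cap n k W.
Let B := modulus_bits n k W.
Let L := num_flips n k i0.
Hypothesis hQ : [/\ 2 <= Q, n + 4 <= Q, k + 2 <= Q, N + 2 <= Q & B + 2 <= Q] /\ L + 3 <= Q.

Let Q2 : 2 <= Q. Proof. by case: hQ => -[]. Qed.
Let nQ' : n + 4 <= Q. Proof. by case: hQ => -[]. Qed.
Let kQ : k + 2 <= Q. Proof. by case: hQ => -[]. Qed.
Let NQ : N + 2 <= Q. Proof. by case: hQ => -[]. Qed.
Let BQ : B + 2 <= Q. Proof. by case: hQ => -[]. Qed.
Let LQ : L + 3 <= Q. Proof. by case: hQ. Qed.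
Let nQ : bit_length n <= Q. Proof. by apply: bits_le; lia. Qed.

Ltac bits := repeat first [apply: env_bits_cons | exact: env_bits_nil | apply: bits_le; lia | done].

Lemma degree_sum (u : 'I_n) : #|[set v | e u v]| = \sum_(v < n) nat_adj e v u.
Proof.
rewrite -sum1_card big_mkcond /=; apply: eq_bigr => v _.
by rewrite inE nat_adjE e_sym; case: (e _ _).
Qed.

Lemma den_max_degree env : den inp [:: n + 2; n; n] env tmax_degree (max_degree e).
Proof.
pose deg u := \sum_(v < n) nat_adj e v u.
have -> : max_degree e = \max_(u < n) deg u.
  by apply: eq_bigr => u _; apply: degree_sum.
have dn env' : den inp [:: n + 2; n; n] env' tn n.
  by apply: (@den_global inp [:: n + 2; n; n] env' 2).
have degn u : deg u < n + 2.
  by apply: leq_ltn_trans (sum_bool_leq (fun v => nat_adj e v u) n) _; lia.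
apply: (den_iter (inp := inp) (env0 := [:: n + 2; n; n]) _ (f := fun i => \max_(u < i) deg u)) => //.
- by rewrite big_ord0; apply: den_cst.
- move=> i _ /=; rewrite addn2 ltnS; apply/bigmax_leqP => u _.
  by have := degn u; rewrite addn2.
move=> i env' ti tm lt p di dm; rewrite big_ord_recr /=.
apply: (den_let (x := deg i)).
  apply: (den_sum (inp := inp) (env0 := [:: n + 2; n; n]) _ (g := fun v => nat_adj e v i)) => //=.
    exact: degn.
  move=> v e' t lv p' dv; rewrite -inp_adj //; apply: den_read; apply: den_add.
    by apply: den_mul.
  exact: den_mono di.
move=> e' t p' dt; rewrite /maxn.
apply: den_if => [|_|_] //; first by apply: den_lt => //; apply: den_mono dm.
exact: den_mono dm.
Qed.

Variable r : seq bool.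
Let M := 2 ^ B.

Let L_eq : L = i0 + 1 + n * k. Proof. by []. Qed.

Definition cost_colors c kx T :=
  (acost 0 (XCst 0) T + (acost 1 (XCst 0) T + (acost 2 (XRead 0 (XCst 0)) T +
  (acost 1 (XVar 2) T + (acost 0 (xadd (XVar 2) (XCst 2)) T + (T ^ c +
   acost 3 kx T).+1).+1).+1).+1).+1).+1.

Lemma run_colors c kx s : comp_spec (tmax_degree 3) 3 c ->
  xok inp Q [:: n + 2; n; n; max_degree e] kx ->
  xeval inp [:: n + 2; n; n; max_degree e] kx = k ->
  exists s', runs inp (compute_colors kx) s r s' r (cost_colors c kx Q) /\
    holds n s' [:: n + 2; n; n; k].
Proof.
move=> hc hx1 hx2.
have [] // := @step_assign inp n Q hi nQ s [::] 0 (XCst 0) r (@holds_nil _ _); first by bits.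
move=> s1 [r1 h1 _]; rewrite /= in h1.
have [] // := @step_assign inp n Q hi nQ s1 _ 1 (XCst 0) r h1; first by bits.
move=> s2 [r2 h2 _]; rewrite /= in h2.
have [] // := @step_assign inp n Q hi nQ s2 _ 2 (XRead 0 (XCst 0)) r h2; first by bits.
  by rewrite /= hi.1.
move=> s3 [r3 h3 _]; rewrite /= hi.1 in h3.
have [] // := @step_assign inp n Q hi nQ s3 _ 1 (XVar 2) r h3; first by bits.
move=> s4 [r4 h4 _]; rewrite /= in h4.
have [] // := @step_assign inp n Q hi nQ s4 _ 0 (xadd (XVar 2) (XCst 2)) r h4; first by bits.
move=> s5 [r5 h5 _]; rewrite /= in h5.
have he : env_ok n Q [:: n + 2; n; n].
  by split; [split; rewrite //= ?addn_gt0 ?orbT //; lia | bits].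
have [s6 [r6 e6 _ f6]] := hc inp n Q _ s5 r hi he erefl h5.
have eD : ev inp [:: n + 2; n; n] (tmax_degree 3) = max_degree e.
  by apply: (@den_max_degree [::] [:: n + 2; n; n]); rewrite ?prefix0s ?prefix_refl.
rewrite eD in e6.
have h6 : holds n s6 [:: n + 2; n; n; max_degree e].
  exact: (@holds_ext n s5 s6 [:: n + 2; n; n] _ 3).
have mdn : max_degree e <= n.
  apply/bigmax_leqP => u _; rewrite degree_sum.
  exact: (sum_bool_leq (fun v => nat_adj e v u)).
have [] // := @step_assign inp n Q hi nQ s6 _ 3 kx r h6; first by bits.
move=> s7 [r7 h7 _]; rewrite /= hx2 in h7.
exists s7; split=> //.
exact: runs_seq r1 (runs_seq r2 (runs_seq r3 (runs_seq r4 (runs_seq r5 (runs_seq r6 r7))))).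
Qed.

Definition cost_digit T :=
  (acost 4 (XCst 0) T + T * (xcost T (XBin Eq (XRead 2 (XVar 4)) (XCst 0)) +
     acost 4 (xadd (XVar 4) (XCst 1)) T).+1).+1.

Hypothesis inp_digit : forall i, inp 2 i <= 1.
Hypothesis inp_digit0 : forall i, i <= i0 -> (inp 2 i == 0) = (i < i0).

Lemma run_digit s : holds n s [:: n + 2; n; n; k] ->
  exists s', runs inp find_digit s r s' r (cost_digit Q) /\
    holds n s' [:: n + 2; n; n; k; i0].
Proof.
move=> h0.
have [] // := @step_assign inp n Q hi nQ s _ 4 (XCst 0) r h0; first by bits.
move=> s1 [r1 h1 _]; rewrite /= in h1.
have bE i : i <= i0 -> env_bits Q [:: n + 2; n; n; k; i] by move=> ii; bits.
have [|||s2 [r2 h2]] := @step_while inp n Q hi nQ (XBin Eq (XRead 2 (XVar 4)) (XCst 0))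
  (assign 4 (code (xadd (XVar 4) (XCst 1)))) (fun i => [:: n + 2; n; n; k; i])
  (fun=> r) i0 (acost 4 (xadd (XVar 4) (XCst 1)) Q) s1.
- move=> i ii; split; first exact: bE.
    by split=> //; split=> //; rewrite (bit_length_bool (inp_digit _)); lia.
  by rewrite /= -inp_digit0 //; case: (inp 2 i == 0).
- move=> i s2 ii h2.
  have [] // := @step_assign inp n Q hi nQ s2 _ 4 (xadd (XVar 4) (XCst 1)) r h2.
    exact: bE (ltnW ii).
  move=> s3 [r3 h3 _]; rewrite /= addn1 in h3.
  by exists s3.
- exact: h1.
exists s2; split=> //; apply: runs_leq (runs_seq r1 r2) _.
by rewrite /cost_digit ltnS leq_add2l leq_mul2r; apply/orP; right; lia.
Qed.

Definition cost_caps T :=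
  (acost 4 (xadd (xadd (XVar 4) (XCst 1)) (xmul (XVar 2) (XVar 3))) T +
  (acost 1 (xpow xradix (width2 W + 2)) T +
  (acost 5 (xmul (XCst 5) (xmul (XVar 1) (XVar 1))) T +
  (acost 0 (XCst 1) T +
   T * (xcost T (XVar 5) + (acost 0 (xadd (XVar 0) (XVar 0)) T +
     acost 5 (xsub (XVar 5) (XCst 1)) T).+1).+1).+1).+1).+1).+1.

Lemma run_caps s : holds n s [:: n + 2; n; n; k; i0] ->
  exists s', runs inp (compute_caps W) s r s' r (cost_caps Q) /\
    holds n s' [:: M; N; n; k; L; 0].
Proof.
move=> h0.
have [] // := @step_assign inp n Q hi nQ s _ 4
  (xadd (xadd (XVar 4) (XCst 1)) (xmul (XVar 2) (XVar 3))) r h0; first by bits.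
move=> s1 [r1 h1 _]; rewrite /= -L_eq in h1.
have [] // := @step_assign inp n Q hi nQ s1 _ 1 (xpow xradix (width2 W + 2)) r h1.
- by bits.
- exact: xok_pow.
move=> s2 [r2 h2 _]; rewrite xeval_pow /= -[_ ^ _]/N in h2.
have [] // := @step_assign inp n Q hi nQ s2 _ 5 (xmul (XCst 5) (xmul (XVar 1) (XVar 1))) r h2.
  by bits.
move=> s3 [r3 h3 _]; rewrite /= -[_ * (_ * _)]/B in h3.
have [] // := @step_assign inp n Q hi nQ s3 _ 0 (XCst 1) r h3; first by bits.
move=> s4 [r4 h4 _]; rewrite /= in h4.
have bE i : i <= B -> env_bits Q [:: 2 ^ i; N; n; k; L; B - i].
  by move=> ii; bits; apply: bits_pow; lia.
have [|||s5 [r5 h5]] := @step_while inp n Q hi nQ (XVar 5)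
  (assign 0 (code (xadd (XVar 0) (XVar 0))) ;; assign 5 (code (xsub (XVar 5) (XCst 1))))
  (fun i => [:: 2 ^ i; N; n; k; L; B - i])
  (fun=> r) B ((acost 0 (xadd (XVar 0) (XVar 0)) Q + acost 5 (xsub (XVar 5) (XCst 1)) Q).+1) s4.
- move=> i ii; split; [exact: bE | by [] |].
  by rewrite /= subn_eq0 -ltnNge.
- move=> i s5 ii h5.
  have [] // := @step_assign inp n Q hi nQ s5 _ 0 (xadd (XVar 0) (XVar 0)) r h5.
    exact: bE (ltnW ii).
  move=> s6 [r6 h6 _]; rewrite /= addnn -mul2n -expnS in h6.
  have [] // := @step_assign inp n Q hi nQ s6 _ 5 (xsub (XVar 5) (XCst 1)) r h6.
    by bits; apply: bits_pow; lia.
  move=> s7 [r7 h7 _]; rewrite /= in h7.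
  exists s7; split; first exact: runs_seq r6 r7.
  by have -> : B - i.+1 = B - i - 1 by lia.
- by rewrite subn0.
exists s5; rewrite subnn in h5; split=> //.
apply: runs_leq (runs_seq r1 (runs_seq r2 (runs_seq r3 (runs_seq r4 r5)))) _.
rewrite /cost_caps !ltnS !leq_add2l !ltnS !leq_add2l !ltnS !leq_add2l !ltnS leq_add2l.
by rewrite leq_mul2r; apply/orP; right; lia.
Qed.

Definition cost_coins T :=
  (acost 5 (XVar 4) T + (acost 6 (XCst 0) T + T * (xcost T (XVar 5) +
    ((cell_cost 7 T).+1 + (acost 6 (xadd (xadd (XVar 6) (XVar 6)) (XVar 7)) T +
     acost 5 (xsub (XVar 5) (XCst 1)) T).+1).+1).+1).+1).+1.

Lemma run_coins s : L <= size r -> holds n s [:: M; N; n; k; L; 0] ->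
  exists s', runs inp toss_coins s r s' (drop L r) (cost_coins Q) /\
    holds n s' [:: M; N; n; k; L; 0; foldl push_bit 0 (take L r)].
Proof.
move=> hr h0.
have bM : bit_length M <= Q by apply: bits_pow; lia.
have [] // := @step_assign inp n Q hi nQ s _ 5 (XVar 4) r h0; first by bits.
move=> s1 [r1 h1 _]; rewrite /= in h1.
have [] // := @step_assign inp n Q hi nQ s1 _ 6 (XCst 0) r h1; first by bits.
move=> s2 [r2 h2 _]; rewrite /= in h2.
pose X i := foldl push_bit 0 (take i r).
have bX i : i <= L -> bit_length (X i) <= Q.
  move=> ii; rewrite bit_lengthP; last by lia.
  apply: leq_trans (push_bits_lt _) _; rewrite leq_exp2l // size_take_min.
  by apply: leq_trans (geq_minl _ _) _; lia.
have bE i : i <= L -> env_bits Q [:: M; N; n; k; L; L - i; X i].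
  by move=> ii; bits; apply: bX.
have [|||s5 [r5 h5]] := @step_while inp n Q hi nQ (XVar 5)
  (Flip (addr 7) ;; assign 6 (code (xadd (xadd (XVar 6) (XVar 6)) (XVar 7))) ;;
   assign 5 (code (xsub (XVar 5) (XCst 1))))
  (fun i => [:: M; N; n; k; L; L - i; X i])
  (fun i => drop i r) L (((cell_cost 7 Q).+1 + (acost 6 (xadd (xadd (XVar 6) (XVar 6)) (XVar 7)) Q +
     acost 5 (xsub (XVar 5) (XCst 1)) Q).+1).+1) s2.
- move=> i ii; split; [exact: bE | by [] |].
  by rewrite /= subn_eq0 -ltnNge.
- move=> i s3 ii h3; have ir : i < size r by apply: leq_trans hr.
  pose b := nth false r i.
  rewrite (drop_nth false ir) -/b.
  have r4 : runs inp (Flip (addr 7)) s3 (b :: drop i.+1 r) (update s3 (n + 7) b)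
      (drop i.+1 r) (cell_cost 7 Q).+1.
    have := runs_flip inp (addr 7) s3 b (drop i.+1 r).
    rewrite (eval_addr hi.1) => h; apply: runs_leq h _.
    exact: (cost_addr hi.1 nQ).
  have h4 := holds_set (v := b) nQ (leqnn 7 : 7 <= size [:: M; N; n; k; L; L - i; X i]) h3.
  rewrite /= in h4.
  have bb : bit_length b <= Q by rewrite (bit_length_bool (leq_b1 b)); lia.
  have [] // := @step_assign inp n Q hi nQ _ _ 6 (xadd (xadd (XVar 6) (XVar 6)) (XVar 7))
    (drop i.+1 r) h4.
    by do 6!(apply: env_bits_cons; first by bits); apply: env_bits_cons; [apply: bX; lia | bits].
  move=> s6 [r6 h6 _]; rewrite /= -[_ + _ + _]/(push_bit (X i) b) in h6.
  have eX : push_bit (X i) b = X i.+1 by rewrite /X (take_nth false ir) foldl_rcons.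
  rewrite eX in h6.
  have [] // := @step_assign inp n Q hi nQ s6 _ 5 (xsub (XVar 5) (XCst 1)) (drop i.+1 r) h6.
    by do 6!(apply: env_bits_cons; first by bits); apply: env_bits_cons; [apply: bX; lia | bits].
  move=> s7 [r7 h7 _]; rewrite /= in h7.
  exists s7; split; first exact: runs_seq r4 (runs_seq r6 r7).
  have -> : L - i.+1 = L - i - 1 by lia.
  (* The cell of the last coin is scratch space outside the loop environment. *)
  exact: (holds_take (d := 7) h7).
- by rewrite subn0 /X take0.
exists s5; rewrite subnn in h5; rewrite drop0 in r5; split=> //.
apply: runs_leq (runs_seq r1 (runs_seq r2 r5)) _.
rewrite /cost_coins !ltnS !leq_add2l !ltnS !leq_add2l.
by rewrite leq_mul2r; apply/orP; right; lia.
Qed.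

End Segments.

Section Caps.
Variables n k W : nat.
Hypothesis n_gt0 : 0 < n.
Hypothesis k_gt0 : 0 < k.
Local Notation q := (radix n k).
Local Notation N := (loop_cap n k W).

Let q3 : 3 <= q. Proof. by rewrite /radix; lia. Qed.

Lemma nstates_cap : nstates n k W <= N.
Proof. by rewrite leq_exp2l ?leq_addr //; lia. Qed.

Lemma width_cap : width2 W <= N.
Proof.
apply: leq_trans nstates_cap; apply: ltnW; apply: ltn_expl; lia.
Qed.

Lemma nk_cap : n * k + 2 <= N.
Proof.
apply: leq_trans (_ : q ^ 2 <= _); first by rewrite /radix -mulnn; nia.
by rewrite leq_exp2l ?leq_addl //; lia.
Qed.

Let N3 : 3 <= N. Proof. by apply: leq_trans nk_cap; nia. Qed.

Lemma cap_modulus : N < 2 ^ modulus_bits n k W.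
Proof.
apply: leq_trans (ltn_expl N (isT : 1 < 2)) _; rewrite leq_exp2l // /modulus_bits.
by move: N N3 => x; nia.
Qed.

Lemma table_modulus :
  N * (N * cap n k ^ n + 1) * cap n k ^ N < 2 ^ modulus_bits n k W.
Proof.
have hcap i : i <= N -> cap n k ^ i <= 2 ^ (N * N).
  by move=> h; rewrite -expnM leq_exp2l // leq_mul // nk_cap.
have nN : n <= N by apply: leq_trans nk_cap; nia.
have h1 := hcap _ nN; have h2 := hcap _ (leqnn N).
have h3 := ltn_expl N (isT : 1 < 2).
have h4 : 0 < 2 ^ (N * N) by rewrite expn_gt0.
(* The first two summands pay for the two factors of size [N] and for the two powers of [cap]; the
   positive remainder makes the inequality strict. *)
have -> : modulus_bits n k W = (N + N) + (N * N + N * N) + (3 * (N * N) - (N + N)).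
  by rewrite /modulus_bits; move: N N3 => x; nia.
have h5 : 2 <= 2 ^ (3 * (N * N) - (N + N)).
  by rewrite -[X in X <= _]expn1 leq_exp2l //; move: N N3 => x; nia.
rewrite !expnD.
move: (cap n k ^ n) (cap n k ^ N) (2 ^ (N * N)) (2 ^ N) (2 ^ (3 * (N * N) - (N + N))) h1 h2 h3 h4 h5 => a b X Y Z.
move: N N3 => x x3 h1 h2 h3 h4 h5.
have e1 : x * a + 1 <= Y * X * 1.
  rewrite muln1; apply: leq_trans (_ : x.+1 * X <= _).
      have : x * a <= x * X by rewrite leq_mul2l h1 orbT.
      by rewrite mulSn; lia.
  by rewrite leq_mul2r h3 orbT.
apply: leq_ltn_trans (_ : Y * Y * (X * X) < _).
  have -> : Y * Y * (X * X) = Y * (Y * X * 1) * X by nia.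
  by rewrite !leq_mul // ltnW.
by rewrite ltn_Pmulr // !muln_gt0 h4 /=; case: Y h3 {e1}.
Qed.

End Caps.

Section Output.
Variables (inp : input) (n k Q a0 a1 a4 a5 a6 x : nat).
Hypothesis hi : input_ok n inp.
Hypothesis nQ : bit_length n <= Q.
Hypothesis hb : env_bits Q [:: a0; a1; n; k; a4; a5; a6; x].
Hypothesis nQ' : n + 2 <= Q.
Local Notation q := (radix n k).

Definition cost_output T :=
  (acost 5 (XCst 0) T + T * (xcost T (xsub (XVar 2) (XVar 5)) +
    ((T + cell_cost 5 T + xcost T (xmod (XVar 7) xradix)).+1 +
     (acost 7 (xdiv (XVar 7) xradix) T + acost 5 (xadd (XVar 5) (XCst 1)) T).+1).+1).+1).+1.

Lemma run_output s r : holds n s [:: a0; a1; n; k; a4; a5; a6; x] ->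
  exists s', runs inp output_colors s r s' r (cost_output Q) /\
    forall v, v < n -> s' v = dig n k x v.
Proof.
move=> h0.
have [] // := @step_assign inp n Q hi nQ s _ 5 (XCst 0) r h0 hb.
move=> s1 [r1 h1 _]; rewrite /= in h1.
have q0 : 0 < q by rewrite /radix; lia.
pose env i := [:: a0; a1; n; k; a4; i; a6; x %/ q ^ i].
have bE i : i <= n -> env_bits Q (env i).
  move=> ii; have bi : bit_length i <= Q by apply: bits_le; lia.
  have bx : bit_length (x %/ q ^ i) <= Q.
    by apply: leq_trans (hb 7) => /=; apply: bit_length_mono; apply: leq_div.
  by do !apply: env_bits_cons; rewrite ?(hb 0) ?(hb 1) ?(hb 2) ?(hb 3) ?(hb 4) ?(hb 6) //;
    apply: env_bits_nil; lia.
(* The invariant also describes the output cells, which lie outside the environment; hence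
   [runs_while] instead of [step_while]. *)
pose I i s' r' := [/\ r' = r, holds n s' (env i) & forall v, v < i -> s' v = dig n k x v].
have [|||s2 [r2 [h2 [er _ hv]]]] := @runs_while inp (code (xsub (XVar 2) (XVar 5)))
  (Store (cell 5) (code (xmod (XVar 7) xradix)) ;;
   assign 7 (code (xdiv (XVar 7) xradix)) ;;
   assign 5 (code (xadd (XVar 5) (XCst 1)))) I n
  ((Q + cell_cost 5 Q + xcost Q (xmod (XVar 7) xradix)).+1 +
     (acost 7 (xdiv (XVar 7) xradix) Q + acost 5 (xadd (XVar 5) (XCst 1)) Q).+1).+1
  (xcost Q (xsub (XVar 2) (XVar 5))) s1 r.
- move=> i s2 r2 ii [_ h2 _].
  have [-> h3] := @xevalP inp n Q hi nQ s2 _ (xsub (XVar 2) (XVar 5)) h2 (bE _ ii) (conj isT isT).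
  by split=> //; rewrite /= subn_eq0 -ltnNge.
- move=> i s2 r2 ii [-> h2 hv].
  have bi := bE i (ltnW ii).
  have [] := @xevalP inp n Q hi nQ s2 _ (xmod (XVar 7) xradix) h2 bi; first by [].
  rewrite [xeval _ _ _]/(dig n k x i) => e3 c3.
  have [e4 c4] := @xevalP inp n Q hi nQ s2 _ (XVar 5) h2 bi isT.
  have r3 := runs_store inp (cell 5) (code (xmod (XVar 7) xradix)) s2 r.
  rewrite e3 [eval _ _ (cell 5)]e4 [xeval _ _ _]/= in r3.
  set s3 := update s2 i _ in r3.
  have h3 : holds n s3 (env i).
    by move=> j lt; rewrite /s3 /update ifF ?h2 //; lia.
  have [] // := @step_assign inp n Q hi nQ s3 _ 7 (xdiv (XVar 7) xradix) r h3 bi.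
  move=> s4 [r4 h4 f4]; rewrite /= in h4.
  have ed : x %/ q ^ i %/ (n + k + 1) = x %/ q ^ i.+1 by rewrite -divnMA -expnSr.
  rewrite ed in h4.
  have b4 : env_bits Q [:: a0; a1; n; k; a4; i; a6; x %/ q ^ i.+1].
    by move=> j; case: (eqVneq j 5) => [->|ne]; [exact: (bi 5) |
      have := bE i.+1 ii j; do 5!(case: j ne => [|j] ne //=); case: j ne].
  have [] // := @step_assign inp n Q hi nQ s4 _ 5 (xadd (XVar 5) (XCst 1)) r h4 b4.
  move=> s5 [r5 h5 f5]; rewrite /= addn1 in h5.
  exists s5, r; split.
    apply: runs_leq (runs_seq r3 (runs_seq r4 r5)) _.
    have c5 : eval_cost inp s2 (cell 5) <= Q + cell_cost 5 Q := c4.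
    by move: c3 c5; lia.
  split=> // v; rewrite ltnS leq_eqVlt => /orP[/eqP ->|lt].
    by rewrite f5 // f4 // /s3 update_same.
  have vn : v < n by lia.
  by rewrite f5 // f4 // /s3 /update ifF ?hv //; lia.
- by split=> //; rewrite /env expn0 divn1.
exists s2; split=> //; rewrite er in h2.
apply: runs_leq (runs_seq r1 h2) _.
by rewrite /cost_output ltnS leq_add2l leq_mul2r; apply/orP; right; lia.
Qed.

End Output.

Ltac polyc := rewrite /acost /cell_cost;
  repeat first [exact: poly_id | exact: poly_const | exact: poly_xcost | exact: poly_pow
  | apply: poly_succ | apply: poly_add | apply: poly_mul].

Lemma poly_cost_colors c kx : poly_bounded (cost_colors c kx).
Proof. by rewrite /cost_colors; polyc. Qed.

Lemma poly_cost_digit : poly_bounded cost_digit.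
Proof. by rewrite /cost_digit; polyc. Qed.

Lemma poly_cost_caps W : poly_bounded (cost_caps W).
Proof. by rewrite /cost_caps; polyc. Qed.

Lemma poly_cost_coins : poly_bounded cost_coins.
Proof. by rewrite /cost_coins; polyc. Qed.

Lemma poly_cost_output : poly_bounded cost_output.
Proof. by rewrite /cost_output; polyc. Qed.

Section Run.
Variables W : nat.

Definition Q_ok n k i0 Q :=
  [/\ 2 <= Q, n + 4 <= Q, k + 2 <= Q, loop_cap n k W + 2 <= Q & modulus_bits n k W + 2 <= Q] /\
  num_flips n k i0 + 3 <= Q.

Definition sample n (e : rel 'I_n) k i0 r :=
  unrank n k W (nat_adj e)
    (foldl push_bit 0 (take (num_flips n k i0) r) %% count_prefix n k W (nat_adj e) 0 0 k).

Theorem run_sampler kx : exists c, forall inp n (e : rel 'I_n) k i0 Q r,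
  symmetric e -> input_ok n inp ->
  (forall x y, y < n -> inp 1 (x * n + y) = nat_adj e x y) ->
  (forall i, inp 2 i <= 1) -> (forall i, i <= i0 -> (inp 2 i == 0) = (i < i0)) ->
  0 < n -> 0 < k -> Q_ok n k i0 Q -> num_flips n k i0 <= size r ->
  xok inp Q [:: n + 2; n; n; max_degree e] kx ->
  xeval inp [:: n + 2; n; n; max_degree e] kx = k ->
  exists s' r', runs inp (sampler W kx) empty_memory r s' r' (Q ^ c) /\
    forall v, v < n -> s' v = dig n k (sample e k i0 r) v.
Proof.
have [c1 h1] := comp_ok (tmax_degree 3) (isT : 2 <= 3).
have [c2 h2] := comp_ok (tresult W 7) (isT : 2 <= 7).
(* The code of the coloring may have [Q ^ c2] bits, so the output loop is charged with the length
   bound [Q ^ c2.+1]. *)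
have [c hc] : poly_bounded (fun Q => (cost_colors c1 kx Q + (cost_digit Q + (cost_caps W Q +
    (cost_coins Q + (Q ^ c2 + cost_output (Q ^ c2.+1)).+1).+1).+1).+1).+1).
  have [co ho] := poly_cost_output.
  have hco : poly_bounded (fun Q => cost_output (Q ^ c2.+1)).
    exists (c2.+1 * co) => Q Q2; rewrite expnM; apply: ho.
    exact: leq_trans Q2 (pow_ge _ Q2).
  do 5!(apply: poly_succ; apply: poly_add;
    [first [exact: poly_cost_colors | exact: poly_cost_digit | exact: poly_cost_caps
      | exact: poly_cost_coins | exact: poly_pow] |]).
  exact: hco.
exists c => inp n e k i0 Q r e_sym hi hadj hd hd0 n0 k0 hQ hr kx1 kx2.
have [[Q2 nQ kQ NQ BQ] LQ] := hQ.
have [s1 [r1 m1]] := run_colors e_sym hi hadj n0 k0 hQ r empty_memory h1 kx1 kx2.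
have [s2 [r2 m2]] := run_digit hi n0 k0 hQ r hd hd0 m1.
have [s3 [r3 m3]] := run_caps hi n0 k0 hQ r m2.
have [s4 [r4 m4]] := run_coins hi n0 k0 hQ hr m3.
set X := foldl push_bit 0 _ in m4.
set env := [:: 2 ^ modulus_bits n k W; loop_cap n k W; n; k; num_flips n k i0; 0; X] in m4.
have bn : bit_length n <= Q by apply: bits_le; lia.
have bX : bit_length X <= Q.
  rewrite /X bit_lengthP; last by lia.
  apply: leq_trans (push_bits_lt (take (num_flips n k i0) r)) _; rewrite leq_exp2l // size_take_min.
  by apply: leq_trans (geq_minl _ _) _; lia.
have benv : env_bits Q env.
  do !apply: env_bits_cons => //; try (apply: bits_le; lia); last exact: env_bits_nil.
  by apply: bits_pow; lia.
have he : env_ok n Q env by split=> //; split=> //=; [rewrite expn_gt0 | lia].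
have [s5 [r5 e5 b5 f5]] := h2 inp n Q env s4 (drop (num_flips n k i0) r) hi he erefl m4.
have eR : ev inp env (tresult W 7) = sample e k i0 r.
  have NM := cap_modulus W n0 k0; have cM := table_modulus W n0 k0.
  have dk env' : den inp env env' tk k by apply: (@den_global inp env env' 3).
  have dX : den inp env [::] (tvar 6) X by apply: (@den_global inp env [::] 6).
  have dc : den inp env [::] (tcount W (tcst 0) (tcst 0) tk)
      (count_prefix n k W (nat_adj e) 0 0 k).
    apply: (den_count (n := n) (k := k) (adj := nat_adj e)) => //.
    - exact: nstates_cap.
    - exact: width_cap.
    - exact: nk_cap.
  rewrite /sample -/X.
  have h : den inp env [::] (tresult W) (unrank n k W (nat_adj e)
      (X %% count_prefix n k W (nat_adj e) 0 0 k)).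
    apply: (den_let (x := X %% count_prefix n k W (nat_adj e) 0 0 k)).
      exact: den_mod dX dc.
    move=> env' t _; move: (X %% _) => x dt.
    have [S1 S2 S3] := And3 (nstates_cap W n0 k0) (width_cap W n0 k0) (nk_cap W n0 k0).
    exact: (den_unrank (env0 := env) _ _ _ n0 k0 hadj S1 S2 S3 NM cM dt).
  exact: (h env (prefix0s _) (prefix_refl _)).
rewrite eR in e5 b5.
have QQ : Q <= Q ^ c2.+1 by apply: pow_ge.
have m5 : holds n s5 (rcons env (sample e k i0 r)) by apply: holds_ext f5 e5.
have b6 : env_bits (Q ^ c2.+1) (rcons env (sample e k i0 r)).
  move=> i; rewrite nth_rcons; case: ifP => _; first exact: leq_trans (benv i) QQ.
  case: ifP => _; first by apply: leq_trans b5 _; rewrite leq_exp2l.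
  by apply: bits_le; lia.
have nQ2 : n + 2 <= Q ^ c2.+1 by apply: leq_trans QQ; lia.
have [s6 [r6 h6]] := @run_output inp n k (Q ^ c2.+1) _ _ _ _ _ _ hi (leq_trans bn QQ) b6
  nQ2 s5 (drop (num_flips n k i0) r) m5.
exists s6, (drop (num_flips n k i0) r); split; last exact: h6.
apply: runs_leq (hc _ Q2).
exact: runs_seq r1 (runs_seq r2 (runs_seq r3 (runs_seq r4 (runs_seq r5 r6)))).
Qed.

End Run.

(** The largest requirement is [5 * N ^ 2] for the loop cap [N <= Y ^ (width2 W + 2)], where
    [Y = n + k + i0 + 10]; one more factor [Y >= 10] absorbs the constants. *)
Definition time_exponent W := (width2 W + 2).*2.+1.

Lemma Q_ok_pow W n k i0 : Q_ok W n k i0 ((n + k + i0 + 10) ^ time_exponent W).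
Proof.
set Y := n + k + i0 + 10; rewrite /time_exponent.
have [a ea] : exists a, width2 W + 2 = a.+1 by exists (width2 W).+1; lia.
have NX : loop_cap n k W <= Y ^ (width2 W + 2).
  by rewrite /loop_cap ea leq_exp2r // /radix /Y; lia.
have YX : Y <= Y ^ (width2 W + 2) by rewrite ea -[X in X <= _]expn1 leq_exp2l // /Y; lia.
rewrite expnS -addnn expnD /Q_ok /modulus_bits /num_flips.
move: (loop_cap n k W) (Y ^ _) NX YX => N X NX YX.
have Y10 : 10 <= Y by rewrite /Y; lia.
have NN : N * N <= X * X by rewrite leq_mul.
have XX : 10 * X <= X * X by rewrite leq_mul2r; apply/orP; right; lia.
have YXX : 10 * (X * X) <= Y * (X * X) by rewrite leq_mul2r Y10 orbT.
have nk : n * k + i0 + 4 <= Y * Y by rewrite /Y; nia.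
have YY : Y * Y <= X * X by rewrite leq_mul.
by split; [split|]; move: NN XX YXX nk YY; rewrite /Y; lia.
Qed.

Lemma coloring_input_ok (R : realType) n (e : rel 'I_n) (delta : R) phi :
  input_ok n (coloring_input e delta phi).
Proof. by split=> // i; apply: leq_b1. Qed.

(** Here [x] need not be a vertex: the program also asks for the neighbors of the mark [n]. *)
Lemma coloring_input_adj (R : realType) n (e : rel 'I_n) (delta : R) phi x y : y < n ->
  coloring_input e delta phi 1 (x * n + y) = nat_adj e x y.
Proof.
move=> yn; congr nat_of_bool; apply/existsP/existsP => -[u /existsP[v]].
  move=> /andP[euv /eqP h]; exists u; apply/existsP; exists v; rewrite euv /=.
  have n0 : 0 < n by lia.
  have := congr1 (modn^~ n) h; have := congr1 (divn^~ n) h.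
  rewrite /= !divnMDl // !modnMDl !divn_small ?ltn_ord // !modn_small ?ltn_ord // !addn0.
  by move=> -> ->; rewrite !eqxx.
move=> /and3P[euv /eqP -> /eqP ->]; exists u; apply/existsP; exists v.
by rewrite euv eqxx.
Qed.

(** * The law of the output *)

Import Order.TTheory GRing.Theory Num.Theory.

Lemma sum_tuple_cons n (F : seq bool -> nat) :
  \sum_(r : n.+1.-tuple bool) F r =
  \sum_(r : n.-tuple bool) (F (true :: r) + F (false :: r)).
Proof.
rewrite (reindex (fun p : bool * n.-tuple bool => [tuple of p.1 :: p.2])) /=; last first.
  exists (fun t : n.+1.-tuple bool => (thead t, [tuple of behead t])).
    by move=> [b t] _ /=; congr (_, _); apply: val_inj.
  by move=> t _; rewrite [RHS]tuple_eta; apply: val_inj.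
rewrite -(pair_bigA _ (fun b (t : n.-tuple bool) => F (b :: t))) /=.
by rewrite big_bool /= big_split.
Qed.

(** Each number of [L] bits arises from [2 ^ (m - L)] coin sequences; the start value [x0] makes the
    induction work. *)
Lemma sum_bits m L x0 (p : nat -> nat) : L <= m ->
  \sum_(r : m.-tuple bool) p (foldl push_bit x0 (take L r)) =
  2 ^ (m - L) * \sum_(X < 2 ^ L) p (x0 * 2 ^ L + X).
Proof.
elim: L m x0 => [|L IH] m x0 Lm.
  under eq_bigr do rewrite take0 /=.
  by rewrite sum_nat_const card_tuple card_bool subn0 big_ord1 muln1 addn0.
case: m Lm => // m Lm.
rewrite (sum_tuple_cons m (fun r => p (foldl push_bit x0 (take L.+1 r)))) big_split /= !IH //.
rewrite subSS -mulnDr; congr (_ * _).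
rewrite [in RHS]expnS mul2n -addnn big_split_ord /= addnC.
by congr (_ + _); apply: eq_bigr => X _; congr p; rewrite /push_bit /=; lia.
Qed.

Lemma count_residue Z i T : i < Z -> \sum_(X < T) (X %% Z == i) = (T + (Z.-1 - i)) %/ Z.
Proof.
move=> iZ; elim: T => [|T IH]; first by rewrite big_ord0 divn_small //; lia.
rewrite big_ord_recr /= IH addSn divnS; last by lia.
rewrite addnC; congr (nat_of_bool _ + _).
apply/eqP/idP => [e|/dvdnP[c e]].
  rewrite (divn_eq T Z) e -addnS -addnA; apply: dvdn_add; first exact: dvdn_mull.
  by have -> : i + (Z.-1 - i).+1 = Z by lia.
have h : T + Z = c * Z + i by lia.
have -> : T %% Z = (T + Z) %% Z by rewrite modnDr.
by rewrite h modnMDl modn_small.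
Qed.

(** Each residue is hit [T / Z] times up to an error of at most 1, which with [T = 2 ^ L] gives a
    deviation of at most [2 ^- L] per coloring. *)
Lemma count_residue_bounds Z i T : i < Z ->
  let h := \sum_(X < T) (X %% Z == i) in h * Z <= T + Z /\ T <= h * Z + Z.
Proof.
move=> iZ /=; rewrite count_residue //.
have := leq_divM (T + (Z.-1 - i)) Z; have := ltn_ceil (T + (Z.-1 - i)) (leq_ltn_trans (leq0n i) iZ).
rewrite mulSn; move: (_ * _)%N => a h1 h2; split; lia.
Qed.

Local Open Scope ring_scope.

Section Law.
Variables (R : realType) (T : finType) (m L Z : nat) (g : 'I_Z -> T).
Hypothesis g_inj : injective g.
Hypothesis cardT : #|T| = Z.
Hypothesis Z_gt0 : (0 < Z)%N.
Hypothesis Lm : (L <= m)%N.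

Definition residue (r : seq bool) : 'I_Z :=
  Ordinal (ltn_pmod (foldl push_bit 0%N (take L r)) Z_gt0).
Definition outcome (r : m.-tuple bool) : T := g (residue r).

Lemma coin_law_outcome i :
  coin_law R outcome (g i) = (\sum_(X < 2 ^ L) (X %% Z == i)%N)%:R / 2 ^+ L.
Proof.
rewrite /coin_law.
have -> : #|[set r | outcome r == g i]| =
    (2 ^ (m - L) * \sum_(X < 2 ^ L) (X %% Z == i)%N)%N.
  rewrite -sum1_card big_mkcond /= -(sum_bits 0 (fun X => (X %% Z == i)%N : nat) Lm).
  apply: eq_bigr => r _; rewrite inE (inj_eq g_inj) -val_eqE /=.
  by case: eqP.
rewrite natrM natrX -[in X in _ / X](subnK Lm) exprD invfM mulrACA divff ?mul1r //.
by rewrite expf_neq0 // pnatr_eq0.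
Qed.

Lemma coin_law_near x : `|coin_law R outcome x - uniform R x| <= 2 ^- L.
Proof.
have /codomP[i ->] : x \in codom g.
  apply: inj_card_onto g_inj _ x; by rewrite card_ord cardT.
rewrite coin_law_outcome /uniform cardT.
have := count_residue_bounds (2 ^ L) (ltn_ord i); rewrite /=.
set h := (\sum_(X < _) _)%N => -[h1 h2].
have Z0 : 0 < Z%:R :> R by rewrite ltr0n.
have P0 : 0 < 2 ^+ L :> R by rewrite exprn_gt0.
have e1 : h%:R / 2 ^+ L - Z%:R^-1 = (h%:R * Z%:R - 2 ^+ L) / (2 ^+ L * Z%:R) :> R.
  by field; rewrite !gt_eqF.
rewrite e1 normrM [X in _ * X]gtr0_norm ?invr_gt0 ?mulr_gt0 //.
rewrite ler_pdivrMr ?mulr_gt0 // mulKf ?gt_eqF //.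
move: h1 h2; rewrite -!(ler_nat R) !natrD !natrM natrX => h1 h2.
by rewrite ler_norml; apply/andP; split; lra.
Qed.

Lemma dTV_outcome : dTV (coin_law R outcome) (@uniform R T) <= Z%:R / 2 ^+ L.
Proof.
apply: bigmax_le => [|S _]; first by rewrite divr_ge0 ?exprn_ge0.
rewrite -sumrB; apply: le_trans (ler_norm_sum _ _ _) _.
apply: le_trans (_ : \sum_(x in T) 2 ^- L <= _); last first.
  by rewrite sumr_const -[#|_|]/#|T| cardT mulr_natl.
rewrite [X in _ <= X](bigID (mem S)) /= -[X in X <= _]addr0 lerD //.
  by apply: ler_sum => x _; apply: coin_law_near.
by apply: sumr_ge0 => x _; rewrite invr_ge0 exprn_ge0.
Qed.

End Law.

(** * Number of colors, digits of the bias and logarithms *)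

Section Reals.
Variable R : realType.

Lemma num_colorsP (eps : R) d : 0 < eps ->
  (1 + eps) * d%:R <= (num_colors eps d)%:R < (1 + eps) * d%:R + 1.
Proof.
move=> e0; rewrite /num_colors; set y := (1 + eps) * d%:R.
have y0 : 0 <= y by rewrite mulr_ge0 ?ler0n //; lra.
have c0 : 0 <= Num.ceil y by rewrite ceil_ge0; lra.
have /andP[h1 h2] := ceil_itv y.
have -> : (`|Num.ceil y|%N)%:R = (Num.ceil y)%:~R :> R by rewrite natr_absz ger0_norm.
by rewrite h2 /=; move: h1; rewrite intrB; lra.
Qed.

Lemma num_colors_eq (eps : R) d K :
  (1 + eps) * d%:R <= K%:R < (1 + eps) * d%:R + 1 -> num_colors eps d = K.
Proof.
move=> /andP[h1 h2]; rewrite /num_colors (@ceil_def _ _ K%:Z) //.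
by rewrite intrB -!pmulrn h1 andbT; lra.
Qed.

Lemma num_colors_rat (a b d : nat) : (0 < b)%N ->
  num_colors (a%:R / b%:R : R) d = (((a + b) * d + b.-1) %/ b)%N.
Proof.
move=> b0; apply: num_colors_eq.
have B0 : 0 < b%:R :> R by rewrite ltr0n.
have -> : (1 + a%:R / b%:R) * d%:R = ((a + b) * d)%:R / b%:R :> R.
  by rewrite natrM natrD; field; rewrite gt_eqF.
set x := ((a + b) * d)%N; set K := (_ %/ b)%N.
rewrite ler_pdivrMr // -ltrBlDr ltr_pdivlMr // mulrBl mul1r ltrBlDr -natrM -natrD ltr_nat ler_nat.
have h1 := leq_divM (x + b.-1) b; have h2 := ltn_ceil (x + b.-1) b0.
rewrite mulSn -/K in h2; rewrite -/K in h1.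
by apply/andP; split; lia.
Qed.

Lemma first_digit (delta : R) : 0 < delta < 1 -> exists i0,
  [/\ forall i, (i <= i0)%N -> (binary_digit delta i == 0%N) = (i < i0)%N,
      1 <= 2 ^+ i0.+1 * delta & 2 ^+ i0 * delta < 1].
Proof.
move=> /andP[d0 d1].
have ex : exists i, 1 <= 2 ^+ i.+1 * delta.
  exists (Num.bound delta^-1); rewrite -ler_pdivrMr // mul1r ltW //.
  exact: upper_nthrootP.
have [i0 h1 h2] := ex_minnP ex; exists i0.
have h3 i : (i < i0)%N -> 2 ^+ i.+1 * delta < 1.
  by move=> lt; rewrite ltNge; apply/negP => /h2; rewrite leqNgt lt.
have h4 : 2 ^+ i0 * delta < 1.
  case: i0 h1 h2 h3 => [|i] h1 h2 h3; first by rewrite expr0 mul1r.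
  exact: h3.
split=> // i; rewrite leq_eqVlt => /orP[/eqP ->|lt].
  rewrite ltnn /binary_digit (@truncn_def _ _ 1) //.
  by rewrite h1 /=; move: h4; rewrite exprS; lra.
rewrite lt /binary_digit (@truncn_def _ _ 0%N) //.
by rewrite h3 // mulr_ge0 ?exprn_ge0 // ltW.
Qed.

Lemma binary_digit_le1 (delta : R) i : (binary_digit delta i <= 1)%N.
Proof. by rewrite /binary_digit -ltnS ltn_mod. Qed.

Lemma digit_log (delta : R) i0 : 0 < delta < 1 -> 2 ^+ i0 * delta < 1 ->
  i0%:R <= (ln 2)^-1 * ln (1 / delta).
Proof.
move=> /andP[d0 d1] h; have l2 : 0 < ln 2 :> R by apply: ln_gt0; lra.
rewrite ler_pdivlMl // mulr_natr -lnXn // ltW // ltr_ln ?posrE ?exprn_gt0 ?divr_gt0 //.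
by rewrite ltr_pdivlMr.
Qed.

End Reals.

(** The expression [kx] is the only part of the program that depends on [eps]: it reads channel 3,
    or it evaluates a fixed formula when [eps] is rational. *)
Lemma sampler_correct (R : realType) (eps : R) (w : nat) (phi : nat -> nat) (kx : xp) :
  0 < eps ->
  (forall n (e : rel 'I_n) (delta : R) Q, (num_colors eps (max_degree e) + 2 <= Q)%N ->
     let inp := coloring_input e delta phi in
     let env := [:: n + 2; n; n; max_degree e]%N in
     xok inp Q env kx /\ xeval inp env kx = num_colors eps (max_degree e)) ->
  coloring_sampler eps w phi (sampler w kx).
Proof.
move=> eps0 hkx; have [c hc] := run_sampler w kx.
(* With [S = 1 + n + ln (1 / delta)], the summands of [n + k + i0 + 10] are at most [S],
   [(2 + eps) * S], [(ln 2)^-1 * S] and [10 * S]. *)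
pose K := Num.bound (13 + eps + (ln 2)^-1).
pose p := (time_exponent w * c.+1)%N.
(* The same constant serves as coefficient and as exponent of the time bound. *)
exists (maxn (K ^ p) p) => n e delta [e_sym e_irr] tw deg hdelta.
set k := num_colors eps (max_degree e).
have /andP[k1 k2] := num_colorsP (max_degree e) eps0.
rewrite -/k in k1 k2.
have degk : (max_degree e + 2 <= k)%N by rewrite -(ler_nat R) natrD; apply: le_trans deg k1.
have k0 : (0 < k)%N by lia.
(* The hypothesis on the degree fails for degree 0, so the graph has an edge and in particular a
   vertex. *)
have deg0 : (0 < max_degree e)%N.
  by rewrite lt0n; apply/eqP => h; move: deg; rewrite h mulr0; lra.
have n0 : (0 < n)%N.
  by case: n e {e_sym e_irr tw deg k k1 k2 degk k0} deg0 => // e; rewrite /max_degree big_ord0.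
have degn : (max_degree e <= n)%N.
  by apply/bigmax_leqP => v _; apply: leq_trans (max_card _) _; rewrite card_ord.
have [i0 [hd1 hd2 hd3]] := first_digit hdelta.
have [dep sep] := treewidth_separators e_sym tw.
have [g [g_inj gE]] := unrank_inj e_sym e_irr sep k0.
have Z0 : (0 < #|coloring e k|)%N by apply: coloring_exists e_sym e_irr _ _; lia.
pose Y := (n + k + i0 + 10)%N.
pose Q := (Y ^ time_exponent w)%N.
have hQ : Q_ok w n k i0 Q := Q_ok_pow w n k i0.
have [[Q2 nQ kQ NQ BQ] LQ] := hQ.
pose L := num_flips n k i0; pose m := (Q ^ c.+1)%N.
have QQ : (Q <= m)%N by apply: pow_ge.
have Lm : (L <= m)%N by apply: leq_trans QQ; rewrite /L; lia.
exists m, (outcome (m := m) L g Z0); split.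
- have ln0 : 0 <= ln (1 / delta).
    case/andP: hdelta => d0 d1; apply: ln_ge0.
    by rewrite ler_pdivlMr // mul1r ltW.
  set S := 1 + n%:R + ln (1 / delta).
  have S1 : 1 <= S by rewrite /S; have := ler0n R n; lra.
  have YS : Y%:R <= K%:R * S.
    apply: le_trans (_ : (13 + eps + (ln 2)^-1) * S <= _); last first.
      rewrite ler_wpM2r //; first by lra.
      have l2 : 0 < ln 2 :> R by apply: ln_gt0; lra.
      have := invr_gt0 (ln 2 : R); rewrite l2 => li.
      by apply/ltW/archi_boundP; lra.
    have l2 : 0 < (ln 2)^-1 :> R by rewrite invr_gt0; apply: ln_gt0; lra.
    have hi := digit_log hdelta hd3.
    have kn : k%:R <= (1 + eps) * n%:R + 1.
      apply: le_trans (ltW k2) _; rewrite lerD2r ler_pM2l ?ler_nat //; lra.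
    have nS : n%:R <= S by rewrite /S; lra.
    have lS : ln (1 / delta) <= S by rewrite /S; have := ler0n R n; lra.
    rewrite /Y !natrD.
    have e1 : eps * n%:R <= eps * S by rewrite ler_pM2l.
    have e2 : (ln 2)^-1 * ln (1 / delta) <= (ln 2)^-1 * S by rewrite ler_pM2l.
    by rewrite !mulrDl; lra.
  have -> : m = (Y ^ p)%N by rewrite /m /Q -expnM.
  rewrite natrX; apply: le_trans (_ : (K%:R * S) ^+ p <= _).
    by rewrite lerXn2r // nnegrE ?ler0n // mulr_ge0 ?ler0n //; lra.
  rewrite exprMn ler_pM ?exprn_ge0 ?ler0n //; first by lra.
    by rewrite -natrX ler_nat leq_maxl.
  by apply: ler_weXn2l => //; apply: leq_maxr.
- move=> r.
  have [] := hc (coloring_input e delta phi) n e k i0 Q r e_sym (coloring_input_ok _ _ _)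
    (@coloring_input_adj _ _ _ _ _) (binary_digit_le1 delta) hd1 n0 k0 hQ.
  + by rewrite size_tuple.
  + by have [] := hkx n e delta Q kQ.
  + by have [] := hkx n e delta Q kQ.
  move=> s [r' [[t ht htQ] hs]]; exists s, r', t; split=> //.
    by apply: leq_trans htQ _; rewrite leq_exp2l.
  move=> v; rewrite (hs v (ltn_ord v)) /outcome -gE; congr dig.
  by rewrite /sample (count_all k e_sym e_irr sep n0).
apply: le_trans (dTV_outcome R g_inj erefl Z0 Lm) _.
(* The distance is at most [Z / 2 ^ L] with [Z <= 2 ^ (n * k)], hence at most
   [2 ^ - (i0 + 1) <= delta]. *)
have Zk : (#|coloring e k| <= 2 ^ (n * k))%N.
  have -> : #|coloring e k| = colorings k (nat_adj e) (iota 0 n) (fun _ _ => true).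
    by rewrite (colorings_card e_sym e_irr); apply: eq_card => s; rewrite !inE; apply/esym/forallP.
  apply: leq_trans (colorings_leq _ _ _ _) _; rewrite size_iota mulnC expnM.
  by rewrite leq_exp2r // ltnW // ltn_expl.
have P1 : 0 < 2 ^+ i0.+1 :> R by rewrite exprn_gt0.
have P2 : 0 < 2 ^+ (n * k) :> R by rewrite exprn_gt0.
have -> : 2 ^+ L = 2 ^+ (n * k) * 2 ^+ i0.+1 :> R.
  by rewrite -exprD /L /num_flips addn1 addnC.
rewrite ler_pdivrMr ?mulr_gt0 // mulrCA; apply: le_trans (_ : 2 ^+ (n * k) <= _).
  by rewrite -natrX ler_nat.
by rewrite ler_peMr ?(ltW P2) // mulrC.
Qed.

Theorem corollary1p2 (R : realType) (eps : R) (w : nat) :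
  0 < eps ->
  (exists p : cmd, coloring_sampler eps w (num_colors eps) p) /\
  ((exists q : rat, eps = ratr q) ->
     exists p : cmd, coloring_sampler eps w (fun _ => 0%N) p).
Proof.
move=> eps0; split.
  exists (sampler w (XRead 3 (XVar 3))); apply: sampler_correct => // n e delta Q hQ /=.
  by split=> //; split=> //; apply: bits_le; lia.
move=> [q eq].
have q0 : 0 < q by rewrite -(ltr0q R) -eq.
pose a := `|numq q|%N; pose b := `|denq q|%N.
have b0 : (0 < b)%N by rewrite absz_gt0 denq_neq0.
have eab : eps = a%:R / b%:R.
  rewrite eq /ratr /a /b !natr_absz !gtr0_norm ?denq_gt0 ?numq_gt0 //.
exists (sampler w (xdiv (xadd (xmul (XCst (a + b)) (XVar 3)) (XCst b.-1)) (XCst b))).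
apply: sampler_correct => // n e delta Q hQ /=; split=> //.
by rewrite eab num_colors_rat.
Qed.
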